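(* Let $(s,p)$ satisfy one of the following conditions: (i) $\frac12\le s<\frac34$ and $1\le p<\frac{4}{3-4s}$; (ii) $s\ge\frac34$ and $1\le p<\infty$. Suppose that $u_0\in\mathcal FL^{s,p}(\mathbb T)$ (complex-valued) has infinite momentum in the sense that $$|P(\mathbf P_{\le N}u_0)|\to\infty\quad\text{as }N\to\infty.$$ Then, for any $T>0$, there exists no distributional solution $u\in C([-T,T];\mathcal FL^{s,p}(\mathbb T))$ to the complex-valued first renormalized mKdV equation $$\partial_tu+\partial_x^3u=\pm\Big(|u|^2-\frac1{2\pi}\int_{\mathbb T}|u|^2\,dx\Big)\partial_xu\qquad(\text{mKdV1})$$ satisfying both of the following conditions: (i) $u|_{t=0}=u_0$; (ii) the smooth global solutions $\{u_N\}_{N\in\mathbb N}$ of mKdV1 with $u_N|_{t=0}=\mathbf P_{\le N}u_0$ satisfy $u_N\to u$ in $C([-T,T];\mathcal FL^{s,p}(\mathbb T))$ as $N\to\infty$.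
   Context: $\mathbb T=\mathbb R/(2\pi\mathbb Z)$, $\langle n\rangle=(1+n^2)^{1/2}$, $\hat f(n)=\frac1{2\pi}\int_{\mathbb T}f(x)e^{-inx}\,dx$. $\mathcal FL^{s,p}(\mathbb T)$ is the space of distributions with norm $\|f\|_{\mathcal FL^{s,p}}=\|\langle n\rangle^s\hat f(n)\|_{\ell^p_n(\mathbb Z)}$. $\mathbf P_{\le N}$ is the Dirichlet projection onto the spatial frequencies $\{|n|\le N\}$. The momentum is $P(f)=\frac1{2\pi}\int_{\mathbb T}\mathrm{Im}(\overline f\,\partial_xf)\,dx=\sum_{n\in\mathbb Z}n|\hat f(n)|^2$. The sign $\pm$ is fixed, and either sign is allowed. For smooth complex-valued initial data, mKdV1 has a unique smooth global-in-time solution; $u_N$ denotes this solution with data $\mathbf P_{\le N}u_0$. A distributional solution is a function that satisfies the equation (in particular, for which the nonlinearity makes sense) when tested against smooth functions compactly supported in time. *)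

(* Defs.v *)
From Stdlib Require Export Reals ZArith.
From Coquelicot Require Export Coquelicot.

Open Scope R_scope.

(* Functions on T = R/(2 pi Z) are represented by 2 pi-periodic functions on R.
   Complex-valued functions of real variables are differentiated
   componentwise; integrals are Riemann integrals in the real normed module C. *)

Definition cis (theta : R) : C := (cos theta, sin theta).

Definition CInt (f : R -> C) (a b : R) : C :=
  RInt (V := C_R_CompleteNormedModule) f a b.

Definition CDerive_n (f : R -> C) (n : nat) (x : R) : C :=
  (Derive_n (fun y => Re (f y)) n x, Derive_n (fun y => Im (f y)) n x).

Definition CDerive (f : R -> C) (x : R) : C := CDerive_n f 1 x.

Definition C_lim_seq (z : nat -> C) (l : C) : Prop :=
  filterlim z eventually (locally l).

Definition symsum {G : AbelianMonoid} (a : Z -> G) (N : nat) : G :=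
  sum_n (fun k => a (Z.of_nat k - Z.of_nat N)%Z) (2 * N).

(* Rpower 0 p = 1 in the standard library, hence the case distinction. *)
Definition rpow (x p : R) : R := if Rle_dec x 0 then 0 else Rpower x p.

Definition Rbar_rpow (x : Rbar) (p : R) : Rbar :=
  match x with
  | Finite r => Finite (rpow r p)
  | p_infty => p_infty
  | m_infty => Finite 0
  end.

Definition periodic (f : R -> C) : Prop := forall x, f (x + 2 * PI) = f x.

Definition smooth (f : R -> C) : Prop :=
  forall n x, ex_derive_n (fun y => Re (f y)) n x
           /\ ex_derive_n (fun y => Im (f y)) n x.

Fixpoint of_class (k : nat) (g : R -> R -> R) : Prop :=
  (forall t x, continuity_2d_pt g t x) /\
  match k with
  | O => True
  | S k' =>
      (forall t x, ex_derive (fun t' => g t' x) t) /\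
      (forall t x, ex_derive (fun x' => g t x') x) /\
      of_class k' (fun t x => Derive (fun t' => g t' x) t) /\
      of_class k' (fun t x => Derive (fun x' => g t x') x)
  end.

Definition smooth2 (f : R -> R -> C) : Prop :=
  forall k, of_class k (fun t x => Re (f t x))
         /\ of_class k (fun t x => Im (f t x)).

Definition dt (f : R -> R -> C) (t x : R) : C := CDerive (fun t' => f t' x) t.
Definition dx3 (f : R -> R -> C) (t x : R) : C := CDerive_n (f t) 3 x.

(* A distribution on T is a linear functional on the smooth periodic functions
   that is bounded by some C^k norm.  Its values on other functions are
   irrelevant.  The duality is bilinear (no complex conjugation). *)

Definition functional : Type := (R -> C) -> C.

Definition test (phi : R -> C) : Prop := smooth phi /\ periodic phi.

Definition is_distribution (f : functional) : Prop :=
  (forall (a : C) (phi psi : R -> C), test phi -> test psi ->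
     f (fun x => a * phi x + psi x)%C = (a * f phi + f psi)%C) /\
  (exists (k : nat) (K : R), forall (phi : R -> C) (B : R), test phi ->
     (forall j x, (j <= k)%nat -> Cmod (CDerive_n phi j x) <= B) ->
     Cmod (f phi) <= K * B).

Definition dist_eq (f g : functional) : Prop :=
  forall phi, test phi -> f phi = g phi.

Definition dist_minus (f g : functional) : functional :=
  fun phi => (f phi - g phi)%C.

Definition dist_of_fun (v : R -> C) : functional :=
  fun phi => CInt (fun x => v x * phi x)%C 0 (2 * PI).

Definition fourier_coef (f : functional) (n : Z) : C :=
  (RtoC (/ (2 * PI)) * f (fun x => cis (- (IZR n * x))))%C.

Definition dirichlet (N : nat) (f : functional) (x : R) : C :=
  symsum (G := C_AbelianMonoid)
    (fun n => fourier_coef f n * cis (IZR n * x))%C N.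

Definition bracket (n : Z) : R := sqrt (1 + IZR n ^ 2).

(* The partial sums are nondecreasing, so Lim_seq is the value of the series
   in [0, +oo]; the norm is p_infty outside of the space. *)
Definition FL_norm (s p : R) (f : functional) : Rbar :=
  Rbar_rpow
    (Lim_seq (symsum (G := R_AbelianMonoid)
       (fun n => rpow (Rpower (bracket n) s * Cmod (fourier_coef f n)) p)))
    (/ p).

Definition in_FL (s p : R) (f : functional) : Prop :=
  is_distribution f /\ is_finite (FL_norm s p f).

Definition continuous_FL (T s p : R) (u : R -> functional) : Prop :=
  (forall t, -T <= t <= T -> in_FL s p (u t)) /\
  (forall t, -T <= t <= T -> forall eps, 0 < eps ->
     exists delta, 0 < delta /\
       forall t', -T <= t' <= T -> Rabs (t' - t) < delta ->
         Rbar_lt (FL_norm s p (dist_minus (u t') (u t))) eps).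

Definition converges_FL (T s p : R) (v : nat -> R -> R -> C)
    (u : R -> functional) : Prop :=
  forall eps, 0 < eps -> exists N0, forall N, (N0 <= N)%nat ->
    forall t, -T <= t <= T ->
      Rbar_lt (FL_norm s p (dist_minus (dist_of_fun (v N t)) (u t))) eps.

Definition momentum (f : R -> C) : R :=
  / (2 * PI) * RInt (fun x => Im (Cconj (f x) * CDerive f x)%C) 0 (2 * PI).

Definition mass (f : R -> C) : R :=
  / (2 * PI) * RInt (fun x => Cmod (f x) ^ 2) 0 (2 * PI).

Definition nonlin (f : R -> C) (x : R) : C :=
  (RtoC (Cmod (f x) ^ 2 - mass f) * CDerive f x)%C.

Definition smooth_global_solution (sigma : R) (v : R -> R -> C) : Prop :=
  smooth2 v /\ (forall t, periodic (v t)) /\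
  (forall t x, (dt v t x + dx3 v t x)%C = (RtoC sigma * nonlin (v t) x)%C).

Definition spacetime_test (T : R) (phi : R -> R -> C) : Prop :=
  smooth2 phi /\ (forall t, periodic (phi t)) /\
  (exists r, 0 <= r < T /\ forall t x, r < Rabs t -> phi t x = RtoC 0).

(* For rough u the product |u|^2 d_x u is not defined pointwise.  The
   nonlinearity makes sense as a distribution when, for every test function,
   the pairings of the nonlinearities of the Dirichlet truncations of u
   converge; the limit is then its value. *)
Definition nonlin_pairing (T : R) (u : R -> functional) (phi : R -> R -> C)
    (l : C) : Prop :=
  C_lim_seq
    (fun M => CInt (fun t =>
       dist_of_fun (nonlin (dirichlet M (u t))) (phi t)) (- T) T) l.

Definition distributional_solution (sigma T : R) (u : R -> functional) : Prop :=
  forall phi, spacetime_test T phi ->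
    exists l, nonlin_pairing T u phi l /\
      CInt (fun t => u t (fun x => - dt phi t x - dx3 phi t x)%C) (- T) T
      = (RtoC sigma * l)%C.

Definition admissible (s p : R) : Prop :=
  (1 / 2 <= s < 3 / 4 /\ 1 <= p < 4 / (3 - 4 * s)) \/ (3 / 4 <= s /\ 1 <= p).

Definition infinite_momentum (f : functional) : Prop :=
  is_lim_seq (fun N => Rabs (momentum (dirichlet N f))) p_infty.

(* Main.v *)
Require Import Defs.
From Stdlib Require Import Lra Lia Psatz Classical_Prop.
From mathcomp Require Import ssreflect.
Open Scope general_if_scope.

(** The theorem holds because the momentum drives a rotation of every Fourier coefficient, while convergence in
    [C([-T,T]; FL^{s,p})] forces the coefficients to stay near their initial values for a time that does not
    depend on [N].

    Let [c n t] be the Fourier coefficients of the smooth solution with truncated data and [P] its momentum, which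
    is conserved ([momentum_conserved]).  In Fourier variables the nonlinearity at frequency [n] is the sum over
    [n = x - z + y] of products [c x * conj (c z) * c y].  The interactions with [y = z] produce the term
    [Ci * P * c n], up to the bounded self-interaction [n * |c n|^2 * c n], and the remaining ones, symmetrised in
    [x] and [y], have the symbol [(x + y) / 2] and oscillate in time with the phase
    [3 * (n - x) * (n - y) * (x + y)] ([resonance_decomposition], [phase_cubes]).  After multiplication by
    [cis (- ((n^3 + sigma * P) * t))] the momentum disappears from the equation for the coefficients
    ([profile_ode]).  If these rotated coefficients are equicontinuous at [t = 0] uniformly in [N]
    ([rotated_coefficient_equicontinuous]), the contradiction is immediate: at [t = PI / |P|], a time that tends to
    zero, the gauge factor equals [-1], so a coefficient that started at a nonzero value [z0] must be close both to
    [z0] and to [- z0].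

    Equicontinuity is an a priori bound, obtained without any well-posedness theory.  In the admissible range a
    bound in [FL^{s,p}] controls [sup_n <n>^{1/2} |c n|] and a Sobolev norm slightly above [H^{1/4}]
    ([FL_sup_bound], [FL_sobolev_bound]).  The trilinear sum does not converge absolutely at this regularity, but
    its time integral over [[s, t]] with frozen coefficients does: the factor [x + y] of the symbol divides the
    phase, and interpolation with the trivial bound yields an operator of size [(t - s)^a] with [a > 1/2]
    ([integrated_interaction_bound]).  Boundedness of this operator rests on one weighted double sum over
    frequencies ([decaying_double_sum_resonant]).  The equation is thus a Young differential equation: the defect
    of the frozen-coefficient approximation is additive up to [(t - s)^{2a}], and since [2a > 1] the sewing lemma
    ([sewing]) controls it.  Taking [a > 1/2] costs a fraction of a derivative at high frequency; increments are
    therefore measured with the weaker weight [<n>^{5/16}] and the loss is recovered by interpolation with the sup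
    bound ([interpolation_step], [holder_bound]).

    All this is done on finite sums.  Since each solution is smooth, its Fourier series converges
    ([fourier_inversion]) and truncation at a high frequency [K], chosen after [N], perturbs the equation by an
    arbitrarily small error ([nonlin_truncation]), whereas no constant depends on [K]. *)

(** * Symmetric sums over the integers *)

Notation SZ K f := (symsum (G := R_AbelianMonoid) f K).
Notation SC K f := (symsum (G := C_AbelianMonoid) f K).

Lemma symsum_ext_loc (G : AbelianMonoid) K (f g : Z -> G) :
  (forall n, (- Z.of_nat K <= n <= Z.of_nat K)%Z -> f n = g n) ->
  symsum f K = symsum g K.
Proof. move=> H. apply: sum_n_ext_loc => n Hn. apply: H. lia. Qed.

Lemma symsum_ext (G : AbelianMonoid) K (f g : Z -> G) :
  (forall n, f n = g n) -> symsum f K = symsum g K.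
Proof. move=> H. apply: symsum_ext_loc => n _. exact: H. Qed.

Lemma symsum_swap (G : AbelianMonoid) K L (F : Z -> Z -> G) :
  symsum (fun x => symsum (F x) L) K = symsum (fun y => symsum (fun x => F x y) K) L.
Proof. exact: sum_n_switch. Qed.

Lemma SZ_le_loc K (f g : Z -> R) :
  (forall n, (- Z.of_nat K <= n <= Z.of_nat K)%Z -> f n <= g n) -> SZ K f <= SZ K g.
Proof.
move=> H.
rewrite (symsum_ext_loc _ K f (fun n => if Z_le_dec (Z.abs n) (Z.of_nat K) then f n else 0));
  last by move=> n Hn; case: Z_le_dec => //; lia.
rewrite (symsum_ext_loc _ K g (fun n => if Z_le_dec (Z.abs n) (Z.of_nat K) then g n else 0));
  last by move=> n Hn; case: Z_le_dec => //; lia.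
apply: sum_n_m_le => k. case: Z_le_dec => Hk; last lra. apply: H. lia.
Qed.

Lemma SZ_le K (f g : Z -> R) : (forall n, f n <= g n) -> SZ K f <= SZ K g.
Proof. move=> H. apply: SZ_le_loc => n _. exact: H. Qed.

Lemma SZ_plus K (f g : Z -> R) : SZ K (fun n => f n + g n) = SZ K f + SZ K g.
Proof. exact: sum_n_plus. Qed.

Lemma SZ_scal K c (f : Z -> R) : SZ K (fun n => c * f n) = c * SZ K f.
Proof. exact: (sum_n_mult_l (K := R_Ring)). Qed.

Lemma SZ_nonneg K (f : Z -> R) : (forall n, 0 <= f n) -> 0 <= SZ K f.
Proof.
move=> H. have -> : 0 = SZ K (fun _ => 0 * 0) by rewrite SZ_scal; ring.
apply: SZ_le => n. move: (H n). lra.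
Qed.

(** Unlike symmetric ranges, windows are stable under shifts. *)
Definition window {G : AbelianMonoid} (A : Z) (L : nat) (f : Z -> G) : G :=
  sum_n (fun k => f (A + Z.of_nat k)%Z) L.

Lemma symsum_window (G : AbelianMonoid) K (f : Z -> G) :
  symsum f K = window (- Z.of_nat K) (2 * K) f.
Proof. apply: sum_n_ext => k. f_equal. lia. Qed.

Lemma window_last (G : AbelianMonoid) A L (f : Z -> G) :
  window A (S L) f = plus (window A L f) (f (A + Z.of_nat (S L))%Z).
Proof. by rewrite /window sum_Sn. Qed.

Lemma window_first (G : AbelianMonoid) A L (f : Z -> G) :
  window A (S L) f = plus (f A) (window (A + 1) L f).
Proof.
rewrite /window /sum_n sum_Sn_m; last lia. f_equal; first by f_equal; lia.
rewrite -sum_n_m_S. apply: sum_n_m_ext => k. f_equal. lia.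
Qed.

Lemma window_grow A L p q (f : Z -> R) : (forall n, 0 <= f n) ->
  window (G := R_AbelianMonoid) A L f
    <= window (G := R_AbelianMonoid) (A - Z.of_nat p) (L + p + q) f.
Proof.
move=> H. elim: q => [|q IH].
  elim: p => [|p IH].
    rewrite (_ : (A - Z.of_nat 0 = A)%Z); last lia.
    rewrite (_ : (L + 0 + 0 = L)%nat); last lia. exact: Rle_refl.
  apply: Rle_trans IH _.
  rewrite (_ : (L + S p + 0 = S (L + p + 0))%nat); last lia. rewrite window_first.
  rewrite (_ : (A - Z.of_nat (S p) + 1 = A - Z.of_nat p)%Z); last lia.
  move: (H (A - Z.of_nat (S p))%Z) => H1.
  apply: (Rle_trans _ (0 + window (G := R_AbelianMonoid) (A - Z.of_nat p) (L + p + 0) f)); last exact: Rplus_le_compat_r.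
  rewrite Rplus_0_l. exact: Rle_refl.
apply: Rle_trans IH _.
rewrite (_ : (L + p + S q = S (L + p + q))%nat); last lia. rewrite window_last.
move: (H (A - Z.of_nat p + Z.of_nat (S (L + p + q)))%Z) => H1.
apply: (Rle_trans _ (window (G := R_AbelianMonoid) (A - Z.of_nat p) (L + p + q) f + 0)); last exact: Rplus_le_compat_l.
rewrite Rplus_0_r. exact: Rle_refl.
Qed.

Lemma SZ_shift_le K K' c (f : Z -> R) : (forall n, 0 <= f n) ->
  (Z.of_nat K + Z.abs c <= Z.of_nat K')%Z ->
  SZ K (fun y => f (y + c)%Z) <= SZ K' f.
Proof.
move=> H Hc. rewrite !symsum_window.
have -> : window (G := R_AbelianMonoid) (- Z.of_nat K) (2 * K) (fun y => f (y + c)%Z)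
   = window (G := R_AbelianMonoid) (- Z.of_nat K + c) (2 * K) f.
  apply: sum_n_ext => k. f_equal. lia.
apply: Rle_trans (window_grow _ _ (Z.to_nat (- Z.of_nat K + c + Z.of_nat K'))
  (2 * K' - 2 * K - Z.to_nat (- Z.of_nat K + c + Z.of_nat K')) f H) _.
apply: Req_le. f_equal; lia.
Qed.

Lemma SZ_mono K K' (f : Z -> R) : (forall n, 0 <= f n) -> (K <= K')%nat -> SZ K f <= SZ K' f.
Proof.
move=> H HK. apply: Rle_trans (SZ_shift_le K K' 0 f H _); last lia.
apply: SZ_le => n. rewrite Z.add_0_r. exact: Rle_refl.
Qed.

Lemma SZ_term K n (f : Z -> R) : (forall n, 0 <= f n) -> (Z.abs n <= Z.of_nat K)%Z -> f n <= SZ K f.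
Proof.
move=> H HK. have -> : f n = SZ 0 (fun y => f (y + n)%Z).
  by rewrite /symsum /= sum_O; f_equal; lia.
apply: SZ_shift_le => //=.
Qed.

Lemma symsum_S (G : AbelianMonoid) K (f : Z -> G) :
  symsum f (S K) = plus (f (- Z.of_nat (S K))%Z) (plus (symsum f K) (f (Z.of_nat (S K)))).
Proof.
rewrite !symsum_window (_ : (2 * S K = S (S (2 * K)))%nat); last lia.
rewrite window_first window_last. do 2 f_equal; last by f_equal; lia.
by f_equal; lia.
Qed.

Lemma symsum_delta (G : AbelianMonoid) K m (f : Z -> G) : (Z.abs m <= Z.of_nat K)%Z ->
  (forall n, n <> m -> f n = zero) -> symsum f K = f m.
Proof.
have Z0 : forall L (g : Z -> G), (forall n, (- Z.of_nat L <= n <= Z.of_nat L)%Z -> g n = zero) -> symsum g L = zero.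
  move=> L g Hg. elim: L Hg => [|L IH] Hg.
    rewrite /symsum /= sum_O. apply: Hg. lia.
  rewrite symsum_S IH; last by move=> n Hn; apply: Hg; lia.
  rewrite !Hg; try lia. by rewrite !plus_zero_l.
move=> Hm Hf. elim: K Hm => [|K IH] Hm.
  rewrite /symsum /= sum_O. f_equal. lia.
rewrite symsum_S.
case: (Z_le_dec (Z.abs m) (Z.of_nat K)) => HK.
  rewrite IH // !(Hf (- Z.of_nat (S K))%Z) ?(Hf (Z.of_nat (S K))); try lia.
  by rewrite plus_zero_l plus_zero_r.
rewrite Z0; last by move=> n Hn; apply: Hf; lia.
case: (Z_le_dec m 0) => Hs.
  rewrite (Hf (Z.of_nat (S K))); last lia. rewrite !plus_zero_r. f_equal. lia.
rewrite (Hf (- Z.of_nat (S K))%Z); last lia. rewrite !plus_zero_l. f_equal. lia.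
Qed.

(** * Polynomial weights *)

(** [1 + |n|] is equivalent to [bracket n] and satisfies the triangle inequality with constant one. *)
Definition jap (n : Z) : R := 1 + Rabs (IZR n).
Definition wt (q : R) (n : Z) : R := Rpower (jap n) q.

Lemma jap_ge1 n : 1 <= jap n.
Proof. rewrite /jap. move: (Rabs_pos (IZR n)). lra. Qed.

Lemma wt_pos q n : 0 < wt q n.
Proof. exact: exp_pos. Qed.

Lemma wt_ge0 q n : 0 <= wt q n.
Proof. left. exact: wt_pos. Qed.

Lemma wt_add p q n : wt (p + q) n = wt p n * wt q n.
Proof. exact: Rpower_plus. Qed.

Lemma wt_0 n : wt 0 n = 1.
Proof. apply: Rpower_O. move: (jap_ge1 n). lra. Qed.

Lemma wt_1 n : wt 1 n = jap n.
Proof. apply: Rpower_1. move: (jap_ge1 n). lra. Qed.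

Lemma wt_opp n q : wt (- q) n * wt q n = 1.
Proof. by rewrite -wt_add Rplus_opp_l wt_0. Qed.

Lemma wt_le_exp p q n : p <= q -> wt p n <= wt q n.
Proof.
move=> H. move: (jap_ge1 n) => [H1|H1].
  case: H => [H|->]; last lra. by left; apply: Rpower_lt.
rewrite /wt -H1 /Rpower ln_1 !Rmult_0_r. lra.
Qed.

Lemma wt_le_1 q n : 0 <= q -> wt (- q) n <= 1.
Proof. move=> H. have := wt_le_exp (- q) 0 n ltac:(lra). by rewrite wt_0. Qed.

Lemma Rpower_base_anti x y q : 0 <= q -> 0 < x <= y -> Rpower y (- q) <= Rpower x (- q).
Proof.
move=> Hq Hxy. rewrite !Rpower_Ropp. apply: Rinv_le_contravar; first exact: exp_pos.
exact: Rle_Rpower_l.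
Qed.

Lemma wt_le_neg q m n : 0 <= q -> jap m <= jap n -> wt (- q) n <= wt (- q) m.
Proof. move=> Hq H. apply: Rpower_base_anti => //. move: (jap_ge1 m). lra. Qed.

Lemma wt_even q n : wt q (- n) = wt q n.
Proof. by rewrite /wt /jap opp_IZR Rabs_Ropp. Qed.

Lemma wt_sub_sym q m n : wt q (m - n) = wt q (n - m).
Proof. rewrite -wt_even. f_equal. lia. Qed.

Lemma jap_add m n : jap (m + n) <= jap m + jap n.
Proof. rewrite /jap plus_IZR. move: (Rabs_triang (IZR m) (IZR n)). lra. Qed.

Lemma jap_sub m n : jap (m - n) <= jap m + jap n.
Proof. rewrite /jap minus_IZR. move: (Rabs_triang (IZR m) (- IZR n)). rewrite Rabs_Ropp /Rminus. lra. Qed.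

Lemma wt_neg_half q c m n : 0 <= q -> 0 < c -> jap n <= c * jap m ->
  wt (- q) m <= Rpower c q * wt (- q) n.
Proof.
move=> Hq Hc H. have Hm := jap_ge1 m. have Hn := jap_ge1 n.
have : wt q n <= Rpower c q * wt q m.
  rewrite /wt Rpower_mult_distr; try lra. apply: Rle_Rpower_l => //. lra.
move=> E. have P1 := wt_pos q m. have P2 := wt_pos q n. have P3 := exp_pos (q * ln c).
rewrite -/(Rpower c q) in P3.
have -> : wt (- q) m = / wt q m by rewrite /wt Rpower_Ropp.
have -> : wt (- q) n = / wt q n by rewrite /wt Rpower_Ropp.
apply: (Rmult_le_reg_r (wt q m * wt q n)); first exact: Rmult_lt_0_compat.
field_simplify; lra.
Qed.

(** The weight at the larger frequency is at most the weight of the same order at the smaller one. *)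
Lemma wt_young a b m n : 0 <= a -> 0 <= b -> wt (- a) m * wt (- b) n <= wt (- (a + b)) m + wt (- (a + b)) n.
Proof.
move=> Ha Hb. rewrite (Ropp_plus_distr a b) !wt_add.
have P1 := wt_pos (- a) m. have P2 := wt_pos (- b) m.
have P3 := wt_pos (- a) n. have P4 := wt_pos (- b) n.
case: (Rle_dec (jap m) (jap n)) => H.
  have := wt_le_neg b m n Hb H. nra.
have := wt_le_neg a n m Ha ltac:(lra). nra.
Qed.

(** * Convolution estimates *)

Lemma Rpower_step q x : 1 < q -> 1 <= x ->
  (q - 1) * Rpower (1 + x) (- q) <= Rpower x (1 - q) - Rpower (1 + x) (1 - q).
Proof.
move=> Hq Hx.
have [c [E Hc]] : exists c, Rpower (1 + x) (1 - q) - Rpower x (1 - q)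
    = (1 - q) * Rpower c (1 - q - 1) * (1 + x - x) /\ x < c < 1 + x.
  apply: (MVT_cor2 (fun y => Rpower y (1 - q)) (fun y => (1 - q) * Rpower y (1 - q - 1))); first lra.
  move=> c Hc. apply: derivable_pt_lim_power. lra.
have := Rpower_base_anti c (1 + x) q ltac:(lra) ltac:(lra).
rewrite (_ : 1 - q - 1 = - q) in E; last ring. nra.
Qed.

(** A bounded increasing function on the integers whose increments dominate [wt (- q)]; summing the increments
    bounds the sum of the weights over any window, wherever it is centred. *)
Definition telescoper (q : R) (z : Z) : R :=
  if Z_le_dec 0 z then 1 - wt (1 - q) z else wt (1 - q) z - 1.

Lemma telescoper_bound q z : 1 < q -> -1 <= telescoper q z <= 1.
Proof.
move=> Hq. have H1 := wt_pos (1 - q) z. have := wt_le_exp (1 - q) 0 z ltac:(lra). rewrite wt_0.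
rewrite /telescoper. case: Z_le_dec => _; lra.
Qed.

Lemma telescoper_step q z : 1 < q ->
  wt (- q) z <= Rpower 2 q / (q - 1) * (telescoper q (z + 1) - telescoper q z).
Proof.
move=> Hq. have P2 : 1 <= Rpower 2 q.
  rewrite -(Rpower_O 2); last lra. apply: Rle_Rpower; lra.
apply: (Rmult_le_reg_l (q - 1)); first lra.
have -> : (q - 1) * (Rpower 2 q / (q - 1) * (telescoper q (z + 1) - telescoper q z))
  = Rpower 2 q * (telescoper q (z + 1) - telescoper q z) by field; lra.
rewrite /telescoper. case: (Z_le_dec 0 z) => Hz.
  case: Z_le_dec => [_|]; last lia.
  have Hz' : 0 <= IZR z by apply: (IZR_le 0).
  rewrite /wt /jap plus_IZR !Rabs_pos_eq; try lra.
  have := Rpower_step q (1 + IZR z) Hq ltac:(lra).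
  have -> : 1 + (1 + IZR z) = 1 + (IZR z + 1) by ring.
  have H : Rpower (1 + IZR z) (- q) <= Rpower 2 q * Rpower (1 + (IZR z + 1)) (- q).
    apply: Rle_trans (Rmult_le_compat_l (Rpower 2 q) (Rpower (2 * (1 + IZR z)) (- q)) _ _ _); last 1 first.
    - apply: Rpower_base_anti; lra.
    - rewrite -Rpower_mult_distr; try lra. rewrite -Rmult_assoc -Rpower_plus Rplus_opp_r Rpower_O; lra.
    - lra.
  have := exp_pos ((1-q) * ln (1 + IZR z)). rewrite -/(Rpower _ _). nra.
have Hz' : IZR z <= -1 by apply: (IZR_le _ (-1)); lia.
have -> : (if Z_le_dec 0 (z + 1) then 1 - wt (1 - q) (z + 1) else wt (1 - q) (z + 1) - 1)
   = Rpower (- IZR z) (1 - q) - 1.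
  case: Z_le_dec => H.
    have -> : z = (-1)%Z by lia. rewrite /wt /jap /= Rabs_R0 Rplus_0_r.
    rewrite (_ : - (-1) = 1); last lra. rewrite /Rpower ln_1 Rmult_0_r exp_0. ring.
  rewrite /wt /jap plus_IZR Rabs_left1; last by rewrite -plus_IZR; apply: (IZR_le _ 0); lia.
  do 2 f_equal. ring.
rewrite /wt /jap Rabs_left1; last lra.
have := Rpower_step q (- IZR z) Hq ltac:(lra).
have : 0 < Rpower (1 + - IZR z) (- q) by exact: exp_pos.
set u := Rpower (1 + - IZR z) (- q). set v := Rpower (1 + - IZR z) (1 - q).
set w := Rpower (- IZR z) (1 - q). set k := Rpower 2 q in P2 *. clearbody u v w k. move=> Hu Hs.
have Hs' : 0 <= w - v by nra.
have -> : k * (w - 1 - (v - 1)) = (k - 1) * (w - v) + (w - v) by ring. nra.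
Qed.

(** The inner variable of the double sums enters the frequencies through [x + c] or [c - x] only. *)
Definition unit_slope (m : Z -> Z) : Prop :=
  exists c, (forall x, m x = (x + c)%Z) \/ (forall x, m x = (c - x)%Z).

Lemma sum_wt q : 1 < q -> exists C, 0 < C /\ forall K m, unit_slope m ->
  SZ K (fun x => wt (- q) (m x)) <= C.
Proof.
move=> Hq. exists (Rpower 2 q / (q - 1) * 2).
have P : 0 < Rpower 2 q / (q - 1) by apply: Rdiv_lt_0_compat; [exact: exp_pos | lra].
split; first lra.
suff H K c : SZ K (fun x => wt (- q) (x + c)) <= Rpower 2 q / (q - 1) * 2.
  move=> K m [c [E|E]].
    rewrite (symsum_ext _ K _ (fun x => wt (- q) (x + c))) => // n. by rewrite E.
  rewrite (symsum_ext _ K _ (fun x => wt (- q) (x + - c))) => // n. by rewrite E wt_sub_sym.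
rewrite symsum_window.
suff {}H L : window (G := R_AbelianMonoid) (- Z.of_nat K) L (fun x => wt (- q) (x + c))
   <= Rpower 2 q / (q - 1) * (telescoper q (- Z.of_nat K + c + Z.of_nat L + 1) - telescoper q (- Z.of_nat K + c)).
  apply: Rle_trans (H _) _. apply: Rmult_le_compat_l; first lra.
  have := telescoper_bound q (- Z.of_nat K + c) Hq.
  have := telescoper_bound q (- Z.of_nat K + c + Z.of_nat (2 * K) + 1) Hq. lra.
elim: L => [|L IH].
  rewrite /window sum_O.
  have := telescoper_step q (- Z.of_nat K + c) Hq.
  rewrite (_ : (- Z.of_nat K + Z.of_nat 0 + c = - Z.of_nat K + c)%Z); last lia.
  by rewrite (_ : (- Z.of_nat K + c + Z.of_nat 0 + 1 = - Z.of_nat K + c + 1)%Z); last lia.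
rewrite window_last.
have := telescoper_step q (- Z.of_nat K + c + Z.of_nat (S L)) Hq.
rewrite (_ : (- Z.of_nat K + Z.of_nat (S L) + c = - Z.of_nat K + c + Z.of_nat (S L))%Z); last lia.
rewrite (_ : (- Z.of_nat K + c + Z.of_nat L + 1 = - Z.of_nat K + c + Z.of_nat (S L))%Z) in IH; last lia.
move=> H. apply: Rle_trans (Rplus_le_compat _ _ _ _ IH H) _. lra.
Qed.

Lemma Rpower2_le q : q <= 1 -> Rpower 2 q <= 2.
Proof. move=> H. rewrite -{2}(Rpower_1 2); last lra. apply: Rle_Rpower; lra. Qed.

Lemma Rpower2_pos q : 0 < Rpower 2 q.
Proof. exact: exp_pos. Qed.

(** Since the larger of the two frequencies is at least half of [k], a factor [wt (- e) k] can be
    taken out of a product of two weights; Young's inequality then decouples what remains. *)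
Lemma wt_conv_pointwise a b e m n k : 0 <= e <= 1 -> e <= a -> e <= b -> jap k <= jap m + jap n ->
  wt (- a) m * wt (- b) n <= 2 * wt (- e) k * (wt (- (a + b - e)) m + wt (- (a + b - e)) n).
Proof.
move=> He Ha Hb Hk.
have T := Rpower2_le e ltac:(lra). have Tp := Rpower2_pos e.
have Pk := wt_pos (- e) k.
case: (Rle_dec (jap n) (jap m)) => H.
  have H1 := wt_neg_half e 2 m k ltac:(lra) ltac:(lra) ltac:(lra).
  have Y := wt_young (a - e) b m n ltac:(lra) ltac:(lra).
  rewrite (_ : a - e + b = a + b - e) in Y; last ring.
  have -> : wt (- a) m = wt (- e) m * wt (- (a - e)) m by rewrite -wt_add; f_equal; ring.
  have Pm := wt_pos (- (a - e)) m. have Pn := wt_pos (- b) n. have P3 := wt_pos (- e) m.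
  rewrite Rmult_assoc. apply: Rmult_le_compat => //; [lra | nra | nra].
have H1 := wt_neg_half e 2 n k ltac:(lra) ltac:(lra) ltac:(lra).
have Y := wt_young a (b - e) m n ltac:(lra) ltac:(lra).
rewrite (_ : a + (b - e) = a + b - e) in Y; last ring.
have -> : wt (- b) n = wt (- e) n * wt (- (b - e)) n by rewrite -wt_add; f_equal; ring.
have Pm := wt_pos (- a) m. have Pn := wt_pos (- (b - e)) n. have P3 := wt_pos (- e) n.
rewrite -Rmult_assoc (Rmult_comm (wt (- a) m)) Rmult_assoc.
apply: Rmult_le_compat => //; [lra | nra | nra].
Qed.

Lemma wt_conv a b e : 0 <= e <= 1 -> e <= a -> e <= b -> 1 < a + b - e ->
  exists C, 0 < C /\ forall K m m' k, unit_slope m -> unit_slope m' ->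
    (forall x, jap k <= jap (m x) + jap (m' x)) ->
    SZ K (fun x => wt (- a) (m x) * wt (- b) (m' x)) <= C * wt (- e) k.
Proof.
move=> He Ha Hb Hab. have [C [C0 HC]] := sum_wt _ Hab.
exists (4 * C). split; first lra. move=> K m m' k Hm Hm' Hk.
apply: Rle_trans (SZ_le _ _ (fun x => 2 * wt (- e) k * (wt (- (a + b - e)) (m x) + wt (- (a + b - e)) (m' x))) _) _.
  move=> x. exact: wt_conv_pointwise.
rewrite SZ_scal SZ_plus. have H1 := HC K m Hm. have H2 := HC K m' Hm'. have H3 := wt_pos (- e) k.
rewrite (_ : 4 * C * wt (- e) k = 2 * wt (- e) k * (C + C)); last ring.
apply: Rmult_le_compat_l; [lra | exact: Rplus_le_compat].
Qed.

Lemma SZ_iter K L (F : Z -> Z -> R) (G H : Z -> R) C B :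
  0 <= C -> (forall x, 0 <= G x) -> (forall x, SZ L (fun y => F x y) <= C * H x) ->
  SZ K (fun x => G x * H x) <= B -> SZ K (fun x => SZ L (fun y => G x * F x y)) <= C * B.
Proof.
move=> HC HG HF HB. apply: Rle_trans (Rmult_le_compat_l C _ _ HC HB). rewrite -SZ_scal.
apply: SZ_le => x. rewrite SZ_scal.
rewrite (_ : C * (G x * H x) = G x * (C * H x)); last ring. exact: Rmult_le_compat_l.
Qed.

Lemma SZ_iter1 K L (F : Z -> Z -> R) (G : Z -> R) C B :
  0 <= C -> (forall x, 0 <= G x) -> (forall x, SZ L (fun y => F x y) <= C) ->
  SZ K G <= B -> SZ K (fun x => SZ L (fun y => G x * F x y)) <= C * B.
Proof.
move=> HC HG HF HB. apply: (SZ_iter K L F G (fun _ => 1)) => //.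
  move=> x. rewrite Rmult_1_r. exact: HF.
rewrite (symsum_ext _ K _ G). exact: HB. move=> n. exact: Rmult_1_r.
Qed.

(** * The double sum *)

Ltac slope := match goal with |- unit_slope ?m =>
  exists (m 0%Z); cbv beta; first [ left; intros; lia | right; intros; lia ] end.

Ltac japs := intros; cbv beta; first
  [ apply: Rle_trans _ (jap_add _ _); right; f_equal; lia
  | apply: Rle_trans _ (jap_sub _ _); right; f_equal; lia
  | rewrite Rplus_comm; apply: Rle_trans _ (jap_sub _ _); right; f_equal; lia ].

Lemma wt_mul p q n : wt p n * wt q n = wt (p + q) n.
Proof. by rewrite wt_add. Qed.

Definition double_sum (K : nat) (F : Z -> Z -> R) : R := SZ K (fun x => SZ K (fun y => F x y)).

Lemma double_sum_le K F G : (forall x y, F x y <= G x y) -> double_sum K F <= double_sum K G.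
Proof. move=> H. apply: SZ_le => x. exact: SZ_le. Qed.

Lemma double_sum_ext K F G : (forall x y, F x y = G x y) -> double_sum K F = double_sum K G.
Proof. move=> H. apply: symsum_ext => x. exact: symsum_ext. Qed.

Lemma double_sum_plus K F G : double_sum K (fun x y => F x y + G x y) = double_sum K F + double_sum K G.
Proof. rewrite /double_sum -SZ_plus. apply: symsum_ext => x. exact: SZ_plus. Qed.

Lemma double_sum_scal K c F : double_sum K (fun x y => c * F x y) = c * double_sum K F.
Proof. rewrite /double_sum -SZ_scal. apply: symsum_ext => x. exact: SZ_scal. Qed.

Lemma double_sum_swap K F : double_sum K F = double_sum K (fun x y => F y x).
Proof. exact: symsum_swap. Qed.

(** The six lemmas that follow bound the pieces of the sum over [x] and [y] (with [z = x + y - n]) that arise in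
    [decaying_double_sum_resonant].  In the [low] ones the large factor of the symbol has been absorbed by powers
    of [n], in the [high] ones by powers of [z].  The names record which weights are left beside: those of
    distances to [n] ([near]) or those of the frequencies themselves ([free]). *)
Lemma sum_low_near_near g p : 0 < g <= 1/64 -> 1/2 <= p <= 5/8 -> exists C, 0 < C /\ forall K n,
  double_sum K (fun x y => wt (-(1-g)) (n - x) * wt (-(1-g)) (n - y) * wt (-p) (x + y - n))
   <= C * wt (- (p - 4 * g)) n.
Proof.
move=> Hg Hp.
have [C1 [P1 H1]] := wt_conv (1 - g) p (p - 2 * g) ltac:(lra) ltac:(lra) ltac:(lra) ltac:(lra).
have [C2 [P2 H2]] := wt_conv (1 - g) (p - 2 * g) (p - 4 * g) ltac:(lra) ltac:(lra) ltac:(lra) ltac:(lra).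
exists (C1 * C2). split; first nra. move=> K n.
rewrite (double_sum_ext _ _ (fun x y => wt (-(1-g)) (n - x) * (wt (-(1-g)) (n - y) * wt (-p) (x + y - n))));
  last by move=> x y; ring.
rewrite Rmult_assoc. apply: (SZ_iter K K _ _ (fun x => wt (- (p - 2 * g)) x)); first lra.
- move=> x. exact: wt_ge0.
- move=> x. apply: H1; [slope | slope | japs].
- apply: H2; [slope | slope | japs].
Qed.

Lemma sum_low_near_free g p p' : 0 < g <= 1/64 -> 1/2 + 2 * g <= p <= 5/8 -> 1/2 + 2 * g <= p' <= 5/8 ->
  exists C, 0 < C /\ forall K n,
  double_sum K (fun x y => wt (-(1-g)) (n - x) * wt (-p) y * wt (-p') (x + y - n)) <= C.
Proof.
move=> Hg Hp Hp'.
have [C1 [P1 H1]] := wt_conv p p' (p + p' - 1 - g) ltac:(lra) ltac:(lra) ltac:(lra) ltac:(lra).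
have [C2 [P2 H2]] := sum_wt (1 - g + (p + p' - 1 - g)) ltac:(lra).
exists (C1 * C2). split; first nra. move=> K n.
rewrite (double_sum_ext _ _ (fun x y => wt (-(1-g)) (n - x) * (wt (-p) y * wt (-p') (x + y - n))));
  last by move=> x y; ring.
apply: (SZ_iter K K _ _ (fun x => wt (- (p + p' - 1 - g)) (n - x))); first lra.
- move=> x. exact: wt_ge0.
- move=> x. apply: H1; [slope | slope | japs].
- rewrite (symsum_ext _ _ _ (fun x => wt (-(1 - g + (p + p' - 1 - g))) (n - x))).
    apply: H2. slope.
  move=> x. rewrite wt_mul. f_equal. ring.
Qed.

Lemma sum_low_free_free g p p' q : 0 < g <= 1/64 -> 1/2 + 2 * g <= p <= 5/8 -> 1/2 + 2 * g <= p' <= 5/8 -> 1 + 2 * g <= q ->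
  exists C, 0 < C /\ forall K n,
  double_sum K (fun x y => wt (-p) x * wt (-p') y * wt (-q) (x + y - n)) <= C.
Proof.
move=> Hg Hp Hp' Hq.
have [C1 [P1 H1]] := wt_conv p' q (1/2) ltac:(lra) ltac:(lra) ltac:(lra) ltac:(lra).
have [C2 [P2 H2]] := wt_conv p (1/2) 0 ltac:(lra) ltac:(lra) ltac:(lra) ltac:(lra).
exists (C1 * C2). split; first nra. move=> K n.
rewrite (double_sum_ext _ _ (fun x y => wt (-p) x * (wt (-p') y * wt (-q) (x + y - n))));
  last by move=> x y; ring.
apply: (SZ_iter K K _ _ (fun x => wt (- (1/2)) (n - x))); first lra.
- move=> x. exact: wt_ge0.
- move=> x. apply: H1; [slope | slope | japs].
- have := H2 K (fun x => x) (fun x => (n - x)%Z) n. rewrite Ropp_0 wt_0 Rmult_1_r. apply; [slope | slope | japs].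
Qed.

Lemma sum_high_near_near g q : 0 < g <= 1/64 -> 5/8 + 3 * g <= q -> exists C, 0 < C /\ forall K n,
  double_sum K (fun x y => wt (-q) (x + y - n) * wt (-(1-g)) (n - y) * wt (-(1-g)) (n - x))
   <= C * wt (- (1/4)) n.
Proof.
move=> Hg Hq.
have [C1 [P1 H1]] := wt_conv q (1 - g) (5/8 + g) ltac:(lra) ltac:(lra) ltac:(lra) ltac:(lra).
have [C2 [P2 H2]] := wt_conv (1 - g) (5/8 + g) (1/4) ltac:(lra) ltac:(lra) ltac:(lra) ltac:(lra).
exists (C1 * C2). split; first nra. move=> K n.
rewrite (double_sum_ext _ _ (fun x y => wt (-(1-g)) (n - x) * (wt (-q) (x + y - n) * wt (-(1-g)) (n - y))));
  last by move=> x y; ring.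
rewrite Rmult_assoc. apply: (SZ_iter K K _ _ (fun x => wt (- (5/8 + g)) x)); first lra.
- move=> x. exact: wt_ge0.
- move=> x. apply: H1; [slope | slope | japs].
- apply: H2; [slope | slope | japs].
Qed.

Lemma sum_high_near_free g p q : 0 < g <= 1/64 -> 1/2 + 2 * g <= p <= 5/8 -> 1 + 2 * g <= q ->
  exists C, 0 < C /\ forall K n,
  double_sum K (fun x y => wt (-q) (x + y - n) * wt (-(1-g)) (n - x) * wt (-p) x) <= C * wt (- (1/4)) n.
Proof.
move=> Hg Hp Hq.
have [C1 [P1 H1]] := sum_wt q ltac:(lra).
have [C2 [P2 H2]] := wt_conv (1 - g) p (1/4) ltac:(lra) ltac:(lra) ltac:(lra) ltac:(lra).
exists (C1 * C2). split; first nra. move=> K n.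
rewrite (double_sum_ext _ _ (fun x y => (wt (-(1-g)) (n - x) * wt (-p) x) * wt (-q) (x + y - n)));
  last by move=> x y; ring.
rewrite Rmult_assoc. apply: SZ_iter1; first lra.
- move=> x. apply: Rmult_le_pos; exact: wt_ge0.
- move=> x. apply: H1. slope.
- apply: H2; [slope | slope | japs].
Qed.

Lemma sum_high_free_free g p p' q : 0 < g <= 1/64 -> 1/2 + 2 * g <= p -> 1/2 + 2 * g <= p' -> 1 + 2 * g <= q ->
  exists C, 0 < C /\ forall K n,
  double_sum K (fun x y => wt (-q) (x + y - n) * wt (-p) x * wt (-p') y) <= C.
Proof.
move=> Hg Hp Hp' Hq.
have [C1 [P1 H1]] := sum_wt q ltac:(lra).
have [C2 [P2 H2]] := sum_wt (p + p') ltac:(lra).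
have P : 0 < C1 * C2 by apply: Rmult_lt_0_compat.
exists (C1 * C2 + C1 * C2). split; first lra. move=> K n.
apply: Rle_trans (double_sum_le _ _ (fun x y => wt (- (p + p')) x * wt (-q) (x + y - n) + wt (- (p + p')) y * wt (-q) (x + y - n)) _) _.
  move=> x y. have := wt_young p p' x y ltac:(lra) ltac:(lra). have := wt_pos (-q) (x + y - n). nra.
rewrite double_sum_plus (double_sum_swap K (fun x y => wt (- (p + p')) y * _)).
apply: Rplus_le_compat; (apply: SZ_iter1; [lra | | |]).
- move=> x. exact: wt_ge0.
- move=> x. apply: H1. slope.
- apply: H2. slope.
- move=> x. exact: wt_ge0.
- move=> x. apply: H1. slope.
- apply: H2. slope.
Qed.

(** One of the two frequencies is at least half as large as [k], and its weight can be traded for one at [k]. *)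
Lemma wt_split a b k m n : 0 <= a <= 1 -> 0 <= b <= 1 -> jap k <= jap m + jap n ->
  wt (- a) m * wt (- b) n <= 2 * (wt (- b) k * wt (- a) m + wt (- a) k * wt (- b) n).
Proof.
move=> Ha Hb Hk. have Ta := Rpower2_le a ltac:(lra). have Tb := Rpower2_le b ltac:(lra).
have P1 := wt_pos (- a) m. have P2 := wt_pos (- b) n.
have P3 := wt_pos (- a) k. have P4 := wt_pos (- b) k.
have P5 : 0 <= wt (- b) k * wt (- a) m by nra. have P6 : 0 <= wt (- a) k * wt (- b) n by nra.
case: (Rle_dec (jap n) (jap m)) => H.
  have H1 := wt_neg_half a 2 m k ltac:(lra) ltac:(lra) ltac:(lra).
  have H2 : wt (- a) m <= 2 * wt (- a) k by nra. nra.
have H1 := wt_neg_half b 2 n k ltac:(lra) ltac:(lra) ltac:(lra).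
have H2 : wt (- b) n <= 2 * wt (- b) k by nra. nra.
Qed.

(** The rate [1/4] becomes [wt (- (1/8))] in the trilinear estimates, after taking square roots. *)
Definition decaying_double_sum (F : Z -> Z -> Z -> R) : Prop :=
  exists C, 0 < C /\ forall K n, double_sum K (F n) <= C * wt (- (1/4)) n.

Lemma decaying_le F G : (forall n x y, F n x y <= G n x y) ->
  decaying_double_sum G -> decaying_double_sum F.
Proof.
move=> H [C [C0 HC]]. exists C. split=> // K n. apply: Rle_trans (HC K n). exact: double_sum_le.
Qed.

Lemma decaying_plus F G : decaying_double_sum F -> decaying_double_sum G ->
  decaying_double_sum (fun n x y => F n x y + G n x y).
Proof.
move=> [C [C0 HC]] [D [D0 HD]]. exists (C + D). split; first lra. move=> K n.
rewrite double_sum_plus Rmult_plus_distr_r. exact: Rplus_le_compat.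
Qed.

Lemma decaying_scal c F : 0 < c -> decaying_double_sum F -> decaying_double_sum (fun n x y => c * F n x y).
Proof.
move=> Hc [C [C0 HC]]. exists (c * C). split; first exact: Rmult_lt_0_compat. move=> K n.
rewrite double_sum_scal Rmult_assoc. apply: Rmult_le_compat_l (HC K n). lra.
Qed.

Lemma decaying_wt q e F : q <= e - 1/4 ->
  (exists C, 0 < C /\ forall K n, double_sum K (F n) <= C * wt (- e) n) ->
  decaying_double_sum (fun n x y => wt q n * F n x y).
Proof.
move=> Hq [C [C0 HC]]. exists C. split=> // K n. rewrite double_sum_scal.
apply: Rle_trans (Rmult_le_compat_l _ _ _ (wt_ge0 _ _) (HC K n)) _.
have := wt_le_exp (q - e) (- (1/4)) n ltac:(lra).
rewrite /Rminus wt_add. nra.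
Qed.

Lemma decaying_wt0 q F : q <= - (1/4) -> (exists C, 0 < C /\ forall K n, double_sum K (F n) <= C) ->
  decaying_double_sum (fun n x y => wt q n * F n x y).
Proof.
move=> Hq [C [C0 HC]]. apply: (decaying_wt q 0); first lra.
exists C. split=> // K n. rewrite Ropp_0 wt_0 Rmult_1_r. exact: HC.
Qed.

Lemma decaying_swap F : decaying_double_sum (fun n x y => F n y x) -> decaying_double_sum F.
Proof. move=> [C [C0 HC]]. exists C. split=> // K n. rewrite double_sum_swap. exact: HC. Qed.

Lemma decaying_ext F G : (forall n x y, F n x y = G n x y) ->
  decaying_double_sum G -> decaying_double_sum F.
Proof. move=> H. apply: decaying_le => n x y. rewrite H. exact: Rle_refl. Qed.

Ltac wts := repeat rewrite wt_mul.

(** With [z = x + y - n] one has [x + y = n + z], so the symbol is absorbed by [wt (1 + g) n] when [|z| <= 2|n|]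
    and by [wt (1 + g) z] otherwise.  In the first case [wt_split] is applied to the pairs [(n - x, x)] and
    [(n - y, y)], in the second to [(n - y, x)] and [(n - x, y)], whose sums or differences are [z].  The four
    products that result in each case are the terms [t1] to [t4] and [s1] to [s4].  The total decay
    [13/8 + 4 * g] is that of two Sobolev weights [1/2 + 2 * g] and one sup weight [5/8 = 2 * 5/16]. *)
Lemma decaying_double_sum_resonant g px py pz :
  0 < g <= 1/64 -> 1/2 + 2 * g <= px <= 5/8 -> 1/2 + 2 * g <= py <= 5/8 -> 1/2 + 2 * g <= pz <= 5/8 ->
  13/8 + 4 * g <= px + py + pz ->
  decaying_double_sum (fun n x y =>
    wt (1 + g) (x + y) * (wt (- (1 - g)) (n - x) * wt (- (1 - g)) (n - y)
      * (wt (- px) x * wt (- py) y * wt (- pz) (x + y - n)))).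
Proof.
move=> Hg Hx Hy Hz Hs. set a := 1 - g.
pose t1 n x y := wt (1 + g - px - py) n * (wt (-a) (n - x) * wt (-a) (n - y) * wt (-pz) (x + y - n)).
pose t2 n x y := wt (1 + g - px - a) n * (wt (-a) (n - x) * wt (-py) y * wt (-pz) (x + y - n)).
pose t3 n x y := wt (1 + g - py - a) n * (wt (-a) (n - y) * wt (-px) x * wt (-pz) (x + y - n)).
pose t4 n x y := wt (1 + g - 2 * a + 1/2) n * (wt (-px) x * wt (-py) y * wt (-(pz + 1/2)) (x + y - n)).
pose s1 n x y := wt (- (px + py + pz - 1 - g)) (x + y - n) * wt (-a) (n - y) * wt (-a) (n - x).
pose s2 n x y := wt (- (pz + px + a - 1 - g)) (x + y - n) * wt (-a) (n - y) * wt (-py) y.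
pose s3 n x y := wt (- (pz + py + a - 1 - g)) (x + y - n) * wt (-a) (n - x) * wt (-px) x.
pose s4 n x y := wt (-(1/4)) n * (wt (- (pz + 2 * a - 1 - g - 1/4)) (x + y - n) * wt (-px) x * wt (-py) y).
apply: (decaying_le _ (fun n x y => 72 * (t1 n x y + (t2 n x y + (t3 n x y + (t4 n x y
  + (s1 n x y + (s2 n x y + (s3 n x y + s4 n x y)))))))));
last first.
- apply: decaying_scal; first lra.
  repeat apply: decaying_plus.
  + apply: (decaying_wt _ (pz - 4 * g)); first lra. apply: sum_low_near_near; lra.
  + apply: decaying_wt0; first by rewrite /a; lra. apply: sum_low_near_free; lra.
  + apply: decaying_wt0; first by rewrite /a; lra.
    have [C [C0 HC]] := sum_low_near_free g px pz Hg Hx Hz. exists C. split=> // K n.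
    rewrite double_sum_swap. apply: Rle_trans (HC K n). apply: double_sum_le => x y. right.
    by rewrite (Z.add_comm y x).
  + apply: decaying_wt0; first by rewrite /a; lra. apply: (sum_low_free_free g); lra.
  + apply: sum_high_near_near; rewrite /a; lra.
  + apply: decaying_swap.
    have [C [C0 HC]] := sum_high_near_free g py (pz + px + a - 1 - g) Hg Hy ltac:(rewrite /a; lra).
    exists C. split=> // K n. apply: Rle_trans (HC K n). apply: double_sum_le => x y. right.
    by rewrite /s2 (Z.add_comm y x).
  + apply: sum_high_near_free; rewrite /a; lra.
  + apply: decaying_wt0; first lra. apply: (sum_high_free_free g); rewrite /a; lra.
move=> n x y.
have Pt1 : 0 <= t1 n x y by repeat apply: Rmult_le_pos; exact: wt_ge0.
have Pt2 : 0 <= t2 n x y by repeat apply: Rmult_le_pos; exact: wt_ge0.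
have Pt3 : 0 <= t3 n x y by repeat apply: Rmult_le_pos; exact: wt_ge0.
have Pt4 : 0 <= t4 n x y by repeat apply: Rmult_le_pos; exact: wt_ge0.
have Ps1 : 0 <= s1 n x y by repeat apply: Rmult_le_pos; exact: wt_ge0.
have Ps2 : 0 <= s2 n x y by repeat apply: Rmult_le_pos; exact: wt_ge0.
have Ps3 : 0 <= s3 n x y by repeat apply: Rmult_le_pos; exact: wt_ge0.
have Ps4 : 0 <= s4 n x y by repeat apply: Rmult_le_pos; exact: wt_ge0.
set z := (x + y - n)%Z.
have P q m : 0 <= wt q m by exact: wt_ge0.
have Jz : jap (x + y) <= jap n + jap z.
  apply: Rle_trans _ (jap_add _ _). right. f_equal. rewrite /z. lia.
have Jn := jap_ge1 n. have Jz1 := jap_ge1 z. have Jxy := jap_ge1 (x + y).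
have Ha : 0 <= a <= 1 by rewrite /a; lra.
case: (Rle_dec (jap z) (2 * jap n)) => Hzn.
- have W : wt (1 + g) (x + y) <= 9 * wt (1 + g) n.
    apply: Rle_trans (Rpower (3 * jap n) (1 + g)) _ _ _.
      apply: Rle_Rpower_l; lra.
    rewrite -Rpower_mult_distr; try lra. apply: Rmult_le_compat_r; first exact: P.
    apply: Rle_trans (Rle_Rpower 3 (1 + g) (INR 2) _ _) _; rewrite ?Rpower_pow /=; lra.
  have V : wt (- pz) z <= 2 * (wt (1/2) n * wt (- (pz + 1/2)) z).
    have -> : wt (- pz) z = wt (1/2) z * wt (- (pz + 1/2)) z by rewrite wt_mul; f_equal; lra.
    have : wt (1/2) z <= 2 * wt (1/2) n.
      apply: Rle_trans (Rpower (2 * jap n) (1/2)) _ _ _.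
        apply: Rle_Rpower_l; lra.
      rewrite -Rpower_mult_distr; try lra. apply: Rmult_le_compat_r; first exact: P.
      apply: Rpower2_le. lra.
    have := P (- (pz + 1/2)) z. nra.
  have S1 := wt_split a px n (n - x) x Ha ltac:(lra) ltac:(japs).
  have S2 := wt_split a py n (n - y) y Ha ltac:(lra) ltac:(japs).
  apply: (Rle_trans _ (9 * wt (1 + g) n * ((2 * (wt (- px) n * wt (- a) (n - x) + wt (- a) n * wt (- px) x))
     * (2 * (wt (- py) n * wt (- a) (n - y) + wt (- a) n * wt (- py) y)) * wt (- pz) z))).
    apply: Rmult_le_compat => //; first by repeat apply: Rmult_le_pos.
    have -> : wt (- a) (n - x) * wt (- a) (n - y) * (wt (- px) x * wt (- py) y * wt (- pz) z)
     = (wt (- a) (n - x) * wt (- px) x) * (wt (- a) (n - y) * wt (- py) y) * wt (- pz) z by ring.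
    apply: Rmult_le_compat_r => //. apply: Rmult_le_compat => //; exact: Rmult_le_pos.
  have V' : wt (1 + g) n * (wt (- a) n * wt (- a) n) * (wt (- px) x * wt (- py) y) * wt (- pz) z <= 2 * t4 n x y.
    apply: Rle_trans (Rmult_le_compat_l _ _ _ _ V) _; first by repeat apply: Rmult_le_pos.
    right. rewrite /t4 -/z.
    have -> : wt (1 + g - 2 * a + 1/2) n = wt (1 + g) n * (wt (- a) n * wt (- a) n) * wt (1/2) n.
      wts. f_equal. ring. ring.
  have -> : 9 * wt (1 + g) n * ((2 * (wt (- px) n * wt (- a) (n - x) + wt (- a) n * wt (- px) x))
     * (2 * (wt (- py) n * wt (- a) (n - y) + wt (- a) n * wt (- py) y)) * wt (- pz) z)
   = 36 * (t1 n x y + t2 n x y + t3 n x y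
     + wt (1 + g) n * (wt (- a) n * wt (- a) n) * (wt (- px) x * wt (- py) y) * wt (- pz) z).
    rewrite /t1 /t2 /t3 -/z /Rminus !wt_add. ring.
  lra.
have Hnz : jap n <= jap z by lra.
have W : wt (1 + g) (x + y) <= 4 * wt (1 + g) z.
  apply: Rle_trans (Rpower (2 * jap z) (1 + g)) _ _ _.
    apply: Rle_Rpower_l; lra.
  rewrite -Rpower_mult_distr; try lra. apply: Rmult_le_compat_r; first exact: P.
  apply: Rle_trans (Rle_Rpower 2 (1 + g) (INR 2) _ _) _; rewrite ?Rpower_pow /=; lra.
have S1 := wt_split a px z (n - y) x Ha ltac:(lra) ltac:(rewrite /z; japs).
have S2 := wt_split a py z (n - x) y Ha ltac:(lra) ltac:(rewrite /z; japs).
apply: (Rle_trans _ (4 * wt (1 + g) z * ((2 * (wt (- px) z * wt (- a) (n - y) + wt (- a) z * wt (- px) x))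
   * (2 * (wt (- py) z * wt (- a) (n - x) + wt (- a) z * wt (- py) y)) * wt (- pz) z))).
  apply: Rmult_le_compat => //; first by repeat apply: Rmult_le_pos.
  have -> : wt (- a) (n - x) * wt (- a) (n - y) * (wt (- px) x * wt (- py) y * wt (- pz) z)
   = (wt (- a) (n - y) * wt (- px) x) * (wt (- a) (n - x) * wt (- py) y) * wt (- pz) z by ring.
  apply: Rmult_le_compat_r => //. apply: Rmult_le_compat => //; exact: Rmult_le_pos.
have V' : wt (1 + g) z * (wt (- a) z * wt (- a) z) * (wt (- px) x * wt (- py) y) * wt (- pz) z <= s4 n x y.
  have V := wt_le_neg (1/4) n z ltac:(lra) Hnz.
  have -> : wt (1 + g) z * (wt (- a) z * wt (- a) z) * (wt (- px) x * wt (- py) y) * wt (- pz) z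
    = wt (- (1/4)) z * (wt (- (pz + 2 * a - 1 - g - 1/4)) z * wt (-px) x * wt (-py) y).
    have -> : wt (- (pz + 2 * a - 1 - g - 1/4)) z = wt (1/4) z * (wt (1 + g) z * (wt (- a) z * wt (- a) z) * wt (- pz) z).
      wts. f_equal. ring.
    have := wt_opp z (1/4). set u := wt (- (1/4)) z. set v := wt (1/4) z => E.
    transitivity (u * v * (wt (1 + g) z * (wt (- a) z * wt (- a) z) * (wt (- px) x * wt (- py) y) * wt (- pz) z)); last ring.
    rewrite E. ring.
  rewrite /s4 -/z. apply: Rmult_le_compat_r => //. by repeat apply: Rmult_le_pos.
have -> : 4 * wt (1 + g) z * ((2 * (wt (- px) z * wt (- a) (n - y) + wt (- a) z * wt (- px) x))
   * (2 * (wt (- py) z * wt (- a) (n - x) + wt (- a) z * wt (- py) y)) * wt (- pz) z)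
 = 16 * (s1 n x y + s2 n x y + s3 n x y
   + wt (1 + g) z * (wt (- a) z * wt (- a) z) * (wt (- px) x * wt (- py) y) * wt (- pz) z).
  rewrite /s1 /s2 /s3 -/z.
  have -> : wt (- (px + py + pz - 1 - g)) z = wt (1 + g) z * wt (- px) z * wt (- py) z * wt (- pz) z by wts; f_equal; ring.
  have -> : wt (- (pz + px + a - 1 - g)) z = wt (1 + g) z * wt (- px) z * wt (- a) z * wt (- pz) z by wts; f_equal; ring.
  have -> : wt (- (pz + py + a - 1 - g)) z = wt (1 + g) z * wt (- py) z * wt (- a) z * wt (- pz) z by wts; f_equal; ring.
  ring.
lra.
Qed.

(** * Trilinear estimates *)

(** The time regularity [a] of the rotated coefficients. *)
Definition holder (g : R) : R := 1/2 + g/2.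

(** The size of the integrated symbol once the power [holder g] of the time step has been taken out. *)
Definition kernel (g : R) (n x y : Z) : R :=
  wt (holder g) (x + y) * wt (- (1 - holder g)) (n - x) * wt (- (1 - holder g)) (n - y).

Definition sobolev_bounded (g R0 : R) (f : Z -> R) : Prop :=
  forall K, SZ K (fun x => wt (1/2 + 2 * g) x * f x ^ 2) <= R0.

Lemma kernel_pos g n x y : 0 < kernel g n x y.
Proof. repeat apply: Rmult_lt_0_compat; exact: wt_pos. Qed.

Lemma wt_sqr p n : wt p n ^ 2 = wt (2 * p) n.
Proof. rewrite /= Rmult_1_r wt_mul. f_equal. ring. Qed.

Lemma sum_product_xy K F G R0 : 0 <= R0 -> (forall x, 0 <= F x) -> (forall x, 0 <= G x) ->
  (forall L, SZ L F <= R0) -> (forall L, SZ L G <= R0) ->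
  double_sum K (fun x y => F x * G y) <= R0 * R0.
Proof. move=> H0 HF HG bF bG. exact: SZ_iter1. Qed.

Lemma sum_product_xz K n F G R0 : 0 <= R0 -> (forall x, 0 <= F x) -> (forall x, 0 <= G x) ->
  (forall L, SZ L F <= R0) -> (forall L, SZ L G <= R0) ->
  double_sum K (fun x y => F x * G (x + y - n)%Z) <= R0 * R0.
Proof.
move=> H0 HF HG bF bG. apply: SZ_iter1 => // x.
rewrite (symsum_ext _ K _ (fun y => G (y + (x - n))%Z)); last by move=> y; f_equal; lia.
apply: Rle_trans (SZ_shift_le K (K + Z.to_nat (Z.abs (x - n))) _ G HG _) (bG _). lia.
Qed.

(** With [l] depending on the output frequency this replaces the Cauchy-Schwarz inequality for the double sums:
    the constants need not be homogeneous in the coefficients. *)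
Lemma amgm_weighted l l' u v : 0 < l -> l' * l = 1 -> u * v <= / 2 * (l * u ^ 2 + l' * v ^ 2).
Proof.
move=> Hl E. have Hl' : 0 < l' by nra.
have : 0 <= l * (u - l' * v) ^ 2 by apply: Rmult_le_pos; [lra | exact: pow2_ge_0].
have -> : l * (u - l' * v) ^ 2 = l * u ^ 2 + l' * (l' * l) * v ^ 2 - 2 * (l' * l) * u * v by ring.
rewrite E. lra.
Qed.

Lemma trilinear_of_squares R0 (V : Z -> Z -> Z -> R) :
  decaying_double_sum (fun n x y => V n x y ^ 2) -> 0 <= R0 ->
  exists C, 0 < C /\ forall K n (U : Z -> Z -> R), double_sum K (fun x y => U x y ^ 2) <= R0 ->
    double_sum K (fun x y => U x y * V n x y) <= C * wt (- (1/8)) n.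
Proof.
move=> [C [C0 HC]] H0. exists (/ 2 * (R0 + C)). split; first nra. move=> K n U HU.
apply: Rle_trans (double_sum_le _ _ (fun x y => / 2 * (wt (- (1/8)) n * U x y ^ 2 + wt (1/8) n * V n x y ^ 2)) _) _.
  move=> x y. apply: amgm_weighted; first exact: wt_pos. by rewrite Rmult_comm wt_opp.
rewrite double_sum_scal double_sum_plus !double_sum_scal.
have P := wt_pos (- (1/8)) n. have Q := wt_pos (1/8) n.
have H1 : wt (1/8) n * double_sum K (fun x y => V n x y ^ 2) <= C * wt (- (1/8)) n.
  apply: Rle_trans (Rmult_le_compat_l _ _ _ (Rlt_le _ _ Q) (HC K n)) _. right.
  have -> : wt (- (1/8)) n = wt (1/8) n * wt (- (1/4)) n by rewrite wt_mul; f_equal; lra. ring.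
have H2 := Rmult_le_compat_l _ _ _ (Rlt_le _ _ P) HU. lra.
Qed.

Lemma kernel_sqr g n x y :
  kernel g n x y ^ 2 = wt (1 + g) (x + y) * (wt (- (1 - g)) (n - x) * wt (- (1 - g)) (n - y)).
Proof.
rewrite /kernel !Rpow_mult_distr !wt_sqr Rmult_assoc.
have -> : 2 * holder g = 1 + g by rewrite /holder; lra.
by have -> : 2 * - (1 - holder g) = - (1 - g) by rewrite /holder; lra.
Qed.

Lemma sobolev_term g f x : wt (1/2 + 2 * g) x * f x ^ 2 = (wt (1/4 + g) x * f x) ^ 2.
Proof. rewrite Rpow_mult_distr wt_sqr. do 2 f_equal. lra. Qed.

Lemma sobolev_nonneg g f x : 0 <= wt (1/2 + 2 * g) x * f x ^ 2.
Proof. apply: Rmult_le_pos; [exact: wt_ge0 | exact: pow2_ge_0]. Qed.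

Lemma decaying_kernel g px py pz : 0 < g <= 1/64 ->
  1/4 + g <= px <= 5/16 -> 1/4 + g <= py <= 5/16 -> 1/4 + g <= pz <= 5/16 -> 13/16 + 2 * g <= px + py + pz ->
  decaying_double_sum (fun n x y => (kernel g n x y * (wt (- px) x * wt (- py) y * wt (- pz) (x + y - n))) ^ 2).
Proof.
move=> Hg Hx Hy Hz Hs.
apply: (decaying_ext _ _ _ (decaying_double_sum_resonant g (2 * px) (2 * py) (2 * pz) _ _ _ _ _)); try lra.
move=> n x y. rewrite Rpow_mult_distr kernel_sqr !Rpow_mult_distr !wt_sqr.
rewrite !(_ : forall p, 2 * - p = - (2 * p)); intros; ring.
Qed.

(** The three trilinear estimates differ in the slot that is controlled by the sup weight [5/16] alone; the other two
    slots are square summable with weight [1/4 + g].  The output weight [1/8 = 2 * 5/16 - 1/2] is such that [5/16]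
    is the midpoint of [1/8] and [1/2], as [interpolation_step] requires. *)
Lemma trilinear_z g R0 : 0 < g <= 1/64 -> 0 <= R0 -> exists C, 0 < C /\ forall K n f f',
  sobolev_bounded g R0 f -> sobolev_bounded g R0 f' ->
  double_sum K (fun x y => kernel g n x y * (f x * wt (- (5/16)) (x + y - n) * f' y)) <= C * wt (- (1/8)) n.
Proof.
move=> Hg HR. set h := 1/4 + g.
have D : decaying_double_sum (fun n x y => (kernel g n x y * (wt (- h) x * wt (- h) y * wt (- (5/16)) (x + y - n))) ^ 2)
  by apply: decaying_kernel => //; rewrite /h; lra.
have [C [C0 HC]] := trilinear_of_squares (R0 * R0) _ D ltac:(nra).
exists C. split=> // K n f f' Hf Hf'.
rewrite (double_sum_ext _ _ (fun x y => (wt h x * f x) * (wt h y * f' y) *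
  (kernel g n x y * (wt (- h) x * wt (- h) y * wt (- (5/16)) (x + y - n))))).
  apply: HC. rewrite (double_sum_ext _ _ (fun x y => (wt (1/2 + 2 * g) x * f x ^ 2) * (wt (1/2 + 2 * g) y * f' y ^ 2))).
    apply: sum_product_xy => // x; exact: sobolev_nonneg.
  move=> x y. by rewrite !sobolev_term Rpow_mult_distr.
move=> x y. have E1 := wt_opp x h. have E2 := wt_opp y h.
transitivity ((wt (- h) x * wt h x) * (wt (- h) y * wt h y) * (kernel g n x y * (f x * wt (- (5/16)) (x + y - n) * f' y))); last ring.
rewrite E1 E2. ring.
Qed.

Lemma trilinear_y g R0 : 0 < g <= 1/64 -> 0 <= R0 -> exists C, 0 < C /\ forall K n f f',
  sobolev_bounded g R0 f -> sobolev_bounded g R0 f' ->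
  double_sum K (fun x y => kernel g n x y * (f x * f' (x + y - n)%Z * wt (- (5/16)) y)) <= C * wt (- (1/8)) n.
Proof.
move=> Hg HR. set h := 1/4 + g.
have D : decaying_double_sum (fun n x y => (kernel g n x y * (wt (- h) x * wt (- (5/16)) y * wt (- h) (x + y - n))) ^ 2)
  by apply: decaying_kernel => //; rewrite /h; lra.
have [C [C0 HC]] := trilinear_of_squares (R0 * R0) _ D ltac:(nra).
exists C. split=> // K n f f' Hf Hf'.
rewrite (double_sum_ext _ _ (fun x y => (wt h x * f x) * (wt h (x + y - n) * f' (x + y - n)%Z) *
  (kernel g n x y * (wt (- h) x * wt (- (5/16)) y * wt (- h) (x + y - n))))).
  apply: HC. rewrite (double_sum_ext _ _ (fun x y => (wt (1/2 + 2 * g) x * f x ^ 2) * (wt (1/2 + 2 * g) (x + y - n) * f' (x + y - n)%Z ^ 2))).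
    apply: (sum_product_xz K n (fun x => wt (1/2 + 2 * g) x * f x ^ 2) (fun z => wt (1/2 + 2 * g) z * f' z ^ 2)) => // x; exact: sobolev_nonneg.
  move=> x y. by rewrite !sobolev_term Rpow_mult_distr.
move=> x y. have E1 := wt_opp x h. have E2 := wt_opp (x + y - n) h.
transitivity ((wt (- h) x * wt h x) * (wt (- h) (x + y - n) * wt h (x + y - n)) * (kernel g n x y * (f x * f' (x + y - n)%Z * wt (- (5/16)) y))); last ring.
rewrite E1 E2. ring.
Qed.

Lemma kernel_sym g n x y : kernel g n x y = kernel g n y x.
Proof. rewrite /kernel (Z.add_comm x y). ring. Qed.

Lemma trilinear_x g R0 : 0 < g <= 1/64 -> 0 <= R0 -> exists C, 0 < C /\ forall K n f f',
  sobolev_bounded g R0 f -> sobolev_bounded g R0 f' ->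
  double_sum K (fun x y => kernel g n x y * (wt (- (5/16)) x * f (x + y - n)%Z * f' y)) <= C * wt (- (1/8)) n.
Proof.
move=> Hg HR. have [C [C0 HC]] := trilinear_y g R0 Hg HR. exists C. split=> // K n f f' Hf Hf'.
apply: Rle_trans (HC K n f' f Hf' Hf). rewrite double_sum_swap. apply: double_sum_le => x y. right.
rewrite kernel_sym (Z.add_comm y x). ring.
Qed.

(** Among the three input frequencies one is at least a third of the output frequency: its
    sup bound pays for the decay in the output. *)
Lemma largest_frequency R0 f1 f2 f3 n x z y : (n = x - z + y)%Z ->
  0 <= f1 <= R0 * wt (- (1/2)) x -> 0 <= f2 <= R0 * wt (- (1/2)) z -> 0 <= f3 <= R0 * wt (- (1/2)) y ->
  f1 * f2 * f3 <= 3 * R0 * wt (- (3/16)) n *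
    (wt (- (5/16)) x * f2 * f3 + f1 * wt (- (5/16)) z * f3 + f1 * f2 * wt (- (5/16)) y).
Proof.
move=> E H1 H2 H3.
have P q m : 0 < wt q m by exact: wt_pos.
have J : jap n <= jap x + jap z + jap y.
  rewrite E. have := jap_add (x - z) y. have := jap_sub x z. lra.
have K3 : Rpower 3 (3/16) <= 3.
  apply: Rle_trans (Rle_Rpower 3 (3/16) 1 _ _) _; rewrite ?Rpower_1; lra.
have K m : jap n <= 3 * jap m -> wt (- (1/2)) m <= 3 * wt (- (3/16)) n * wt (- (5/16)) m.
  move=> Hm. have := wt_neg_half (3/16) 3 m n ltac:(lra) ltac:(lra) Hm.
  have -> : wt (- (1/2)) m = wt (- (3/16)) m * wt (- (5/16)) m by rewrite wt_mul; f_equal; lra.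
  move=> H. apply: Rmult_le_compat_r; first by left. have := P (-(3/16)) n. nra.
have R0p : 0 <= R0 by have := P (-(1/2)) x; nra.
have A1 : 0 <= wt (- (5/16)) x * f2 * f3 by repeat apply: Rmult_le_pos; try lra; left.
have A2 : 0 <= f1 * wt (- (5/16)) z * f3 by repeat apply: Rmult_le_pos; try lra; left.
have A3 : 0 <= f1 * f2 * wt (- (5/16)) y by repeat apply: Rmult_le_pos; try lra; left.
have B : 0 <= 3 * R0 * wt (- (3/16)) n by repeat apply: Rmult_le_pos; try lra; left.
rewrite !Rmult_plus_distr_l.
have B1 := Rmult_le_pos _ _ B A1. have B2 := Rmult_le_pos _ _ B A2. have B3 := Rmult_le_pos _ _ B A3.
case: (Rle_dec (jap n) (3 * jap x)) => Hx.
  have H : f1 <= 3 * R0 * wt (- (3/16)) n * wt (- (5/16)) x.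
    have := Rmult_le_compat_l R0 _ _ R0p (K x Hx). lra.
  have := Rmult_le_compat_r (f2 * f3) _ _ ltac:(nra) H. lra.
case: (Rle_dec (jap n) (3 * jap z)) => Hz.
  have H : f2 <= 3 * R0 * wt (- (3/16)) n * wt (- (5/16)) z.
    have := Rmult_le_compat_l R0 _ _ R0p (K z Hz). lra.
  have := Rmult_le_compat_r (f1 * f3) _ _ ltac:(nra) H. lra.
have H : f3 <= 3 * R0 * wt (- (3/16)) n * wt (- (5/16)) y.
  have := Rmult_le_compat_l R0 _ _ R0p (K y ltac:(lra)). lra.
have := Rmult_le_compat_r (f1 * f2) _ _ ltac:(nra) H. lra.
Qed.

(** * Complex-valued functions of a real variable *)

(** Sums in the monoids [C_AbelianMonoid] and [R_AbelianMonoid] hide the carrier from [ring]. *)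
Ltac cring := match goal with |- @eq _ ?a ?b => change (@eq C a b); ring end.
Ltac rring := match goal with |- @eq _ ?a ?b => change (@eq R a b); ring end.

Definition cderiv (f : R -> C) (t : R) (l : C) : Prop :=
  is_derive (fun s => Re (f s)) t (Re l) /\ is_derive (fun s => Im (f s)) t (Im l).

Lemma rderiv_plus (f g : R -> R) x a b :
  is_derive f x a -> is_derive g x b -> is_derive (fun s => f s + g s) x (a + b).
Proof. exact: is_derive_plus. Qed.

Lemma rderiv_minus (f g : R -> R) x a b :
  is_derive f x a -> is_derive g x b -> is_derive (fun s => f s - g s) x (a - b).
Proof. exact: is_derive_minus. Qed.

Lemma rderiv_mult (f g : R -> R) x a b :
  is_derive f x a -> is_derive g x b -> is_derive (fun s => f s * g s) x (a * g x + f x * b).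
Proof. move=> /is_derive_Reals H1 /is_derive_Reals H2. apply/is_derive_Reals. exact: derivable_pt_lim_mult. Qed.

Lemma rderiv_const (c x : R) : is_derive (fun _ => c) x 0.
Proof. exact: (is_derive_const (K := R_AbsRing)). Qed.

Lemma rderiv_id (x : R) : is_derive (fun y => y) x 1.
Proof. exact: (is_derive_id (K := R_AbsRing)). Qed.

Lemma rderiv_eq (f : R -> R) x a b : is_derive f x a -> a = b -> is_derive f x b.
Proof. by move=> H <-. Qed.

Lemma cderiv_eq f t a b : cderiv f t a -> a = b -> cderiv f t b.
Proof. by move=> H <-. Qed.

Lemma cderiv_ext f g t l : (forall s, f s = g s) -> cderiv f t l -> cderiv g t l.
Proof.
move=> H [H1 H2]. split; [apply: is_derive_ext H1 | apply: is_derive_ext H2] => s; by rewrite H.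
Qed.

Lemma cderiv_const c t : cderiv (fun _ => c) t 0.
Proof. split; exact: rderiv_const. Qed.

Lemma cderiv_minus f g t a b : cderiv f t a -> cderiv g t b -> cderiv (fun s => f s - g s)%C t (a - b)%C.
Proof. move=> [H1 H2] [H3 H4]. split; exact: rderiv_minus. Qed.

Lemma cderiv_mult f g t a b : cderiv f t a -> cderiv g t b ->
  cderiv (fun s => f s * g s)%C t (a * g t + f t * b)%C.
Proof.
move=> [H1 H2] [H3 H4]. split.
  apply: rderiv_eq (rderiv_minus _ _ _ _ _ (rderiv_mult _ _ _ _ _ H1 H3) (rderiv_mult _ _ _ _ _ H2 H4)) _.
  rewrite /Re /Im /=. ring.
apply: rderiv_eq (rderiv_plus _ _ _ _ _ (rderiv_mult _ _ _ _ _ H1 H4) (rderiv_mult _ _ _ _ _ H2 H3)) _.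
rewrite /Re /Im /=. ring.
Qed.

Lemma cderiv_scal c f t a : cderiv f t a -> cderiv (fun s => c * f s)%C t (c * a)%C.
Proof.
move=> H. apply: cderiv_eq (cderiv_mult _ _ _ _ _ (cderiv_const c t) H) _. ring.
Qed.

Lemma cderiv_scal_r c f t a : cderiv f t a -> cderiv (fun s => f s * c)%C t (a * c)%C.
Proof.
move=> H. apply: cderiv_eq (cderiv_mult _ _ _ _ _ H (cderiv_const c t)) _. ring.
Qed.

Lemma Re_symsum K (f : Z -> C) : Re (SC K f) = SZ K (fun n => Re (f n)).
Proof.
rewrite /symsum. elim: (2 * K)%nat => [|L IH]; first by rewrite !sum_O.
by rewrite !sum_Sn -IH.
Qed.

Lemma Im_symsum K (f : Z -> C) : Im (SC K f) = SZ K (fun n => Im (f n)).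
Proof.
rewrite /symsum. elim: (2 * K)%nat => [|L IH]; first by rewrite !sum_O.
by rewrite !sum_Sn -IH.
Qed.

Lemma cderiv_symsum K (f : Z -> R -> C) t (d : Z -> C) : (forall n, cderiv (f n) t (d n)) ->
  cderiv (fun s => SC K (fun n => f n s)) t (SC K d).
Proof.
move=> H. split.
  apply: (is_derive_ext (fun s => SZ K (fun n => Re (f n s)))); first by move=> s; rewrite Re_symsum.
  rewrite Re_symsum.
  apply: (is_derive_sum_n (fun k s => Re (f (Z.of_nat k - Z.of_nat K)%Z s))) => k _.
  exact: (proj1 (H _)).
apply: (is_derive_ext (fun s => SZ K (fun n => Im (f n s)))); first by move=> s; rewrite Im_symsum.
rewrite Im_symsum.
apply: (is_derive_sum_n (fun k s => Im (f (Z.of_nat k - Z.of_nat K)%Z s))) => k _.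
exact: (proj2 (H _)).
Qed.

Lemma Cmod_symsum K (f : Z -> C) : Cmod (SC K f) <= SZ K (fun n => Cmod (f n)).
Proof.
rewrite /symsum. elim: (2 * K)%nat => [|L IH]; first by rewrite !sum_O; lra.
rewrite !sum_Sn. apply: Rle_trans (Cmod_triangle _ _) _. exact: Rplus_le_compat_r.
Qed.

Lemma SC_plus K (f g : Z -> C) : SC K (fun n => f n + g n)%C = (SC K f + SC K g)%C.
Proof. exact: sum_n_plus. Qed.

Lemma SC_scal K c (f : Z -> C) : SC K (fun n => c * f n)%C = (c * SC K f)%C.
Proof. exact: (sum_n_mult_l (K := C_Ring)). Qed.

Lemma SC_opp K (f : Z -> C) : SC K (fun n => - f n)%C = (- SC K f)%C.
Proof.
rewrite (symsum_ext _ K _ (fun n => (- (1)) * f n)%C); last by move=> n; cring. rewrite SC_scal. cring.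
Qed.

Lemma SC_minus K (f g : Z -> C) : SC K (fun n => f n - g n)%C = (SC K f - SC K g)%C.
Proof. by rewrite /Cminus SC_plus SC_opp. Qed.

Lemma SC_0 K : SC K (fun _ => RtoC 0) = RtoC 0.
Proof.
rewrite (symsum_ext _ K _ (fun n => 0 * 0)%C); last by move=> n; cring. rewrite SC_scal. cring.
Qed.

Lemma SC_scal_r K c (f : Z -> C) : SC K (fun n => f n * c)%C = (SC K f * c)%C.
Proof. rewrite Cmult_comm -SC_scal. apply: symsum_ext => n. exact: Cmult_comm. Qed.

Lemma SC_conj K (f : Z -> C) : Cconj (SC K f) = SC K (fun n => Cconj (f n)).
Proof.
rewrite /symsum. elim: (2 * K)%nat => [|L IH]; first by rewrite !sum_O.
rewrite !sum_Sn -IH. exact: Cplus_conj.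
Qed.

Lemma Cmod_Ci : Cmod Ci = 1.
Proof. rewrite /Cmod /= -[RHS]sqrt_1. f_equal. ring. Qed.

Lemma Cmod_le_parts z : Cmod z <= Rabs (Re z) + Rabs (Im z).
Proof.
rewrite {1}(_ : z = (RtoC (Re z) + Ci * RtoC (Im z))%C).
  apply: Rle_trans (Cmod_triangle _ _) _. rewrite Cmod_mult !Cmod_R.
  rewrite Cmod_Ci. lra.
case: z => a b. rewrite /Cplus /Cmult /Re /Im /=. f_equal; ring.
Qed.

Lemma Re_le_Cmod z : Rabs (Re z) <= Cmod z.
Proof. have := Rmax_Cmod z. have := Rmax_l (Rabs (Re z)) (Rabs (Im z)). rewrite /Re /Im. lra. Qed.
Lemma Im_le_Cmod z : Rabs (Im z) <= Cmod z.
Proof. have := Rmax_Cmod z. have := Rmax_r (Rabs (Re z)) (Rabs (Im z)). rewrite /Re /Im. lra. Qed.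

Lemma mean_value_bound (f f' : R -> R) a b B : a <= b -> (forall t, a <= t <= b -> is_derive f t (f' t)) ->
  (forall t, a <= t <= b -> Rabs (f' t) <= B) -> Rabs (f b - f a) <= B * (b - a).
Proof.
move=> Hab Hd HB.
have M x : Rmin a b <= x <= Rmax a b -> a <= x <= b by rewrite Rmin_left ?Rmax_right.
have [c [Hc E]] : exists c, Rmin a b <= c <= Rmax a b /\ f b - f a = f' c * (b - a).
  apply: (MVT_gen f a b f').
    move=> x Hx. apply: Hd. apply: M. lra.
  move=> x Hx. apply: derivable_continuous_pt. exists (f' x). apply/is_derive_Reals. apply: Hd. exact: M.
rewrite E Rabs_mult (Rabs_pos_eq (b - a)); last lra. apply: Rmult_le_compat_r; first lra. apply: HB. exact: M.
Qed.

Lemma cderiv_bound f a b B : a <= b ->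
  (forall t, a <= t <= b -> exists d, cderiv f t d /\ Cmod d <= B) ->
  Cmod (f b - f a)%C <= 2 * B * (b - a).
Proof.
move=> Hab H.
have D1 t : a <= t <= b -> is_derive (fun s => Re (f s)) t (Derive (fun s => Re (f s)) t).
  move=> /H [d [[H1 _] _]]. apply: Derive_correct. by eexists; exact: H1.
have D2 t : a <= t <= b -> is_derive (fun s => Im (f s)) t (Derive (fun s => Im (f s)) t).
  move=> /H [d [[_ H1] _]]. apply: Derive_correct. by eexists; exact: H1.
have B1 : Rabs (Re (f b) - Re (f a)) <= B * (b - a).
  apply: (mean_value_bound (fun s => Re (f s)) _ _ _ _ Hab D1) => t /H [d [[H1 _] HB]].
  rewrite (is_derive_unique _ _ _ H1). have := Re_le_Cmod d. lra.
have B2 : Rabs (Im (f b) - Im (f a)) <= B * (b - a).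
  apply: (mean_value_bound (fun s => Im (f s)) _ _ _ _ Hab D2) => t /H [d [[_ H1] HB]].
  rewrite (is_derive_unique _ _ _ H1). have := Im_le_Cmod d. lra.
apply: Rle_trans (Cmod_le_parts _) _.
rewrite (_ : Re (f b - f a)%C = Re (f b) - Re (f a)) //.
rewrite (_ : Im (f b - f a)%C = Im (f b) - Im (f a)) //. lra.
Qed.

(** * Sewing *)

(** If [r] fails to be additive only by [(t - s)^q] with [1 < q], then bisecting an interval [k] times
    produces a geometric series of defects plus [2^k] increments of length [(t - s) / 2^k]; a quadratic
    bound on the increments disappears in the limit, and a linear one survives unchanged. *)
Lemma sewing (q H L E T1 : R) (r : R -> R -> C) : 1 < q -> 0 <= H -> 0 <= L ->
  (forall s t, 0 <= s < t -> t <= T1 ->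
     Cmod (r s t - (r s ((s + t) / 2)%R + r ((s + t) / 2)%R t))%C <= H * Rpower (t - s) q) ->
  (forall s t, 0 <= s < t -> t <= T1 -> Cmod (r s t) <= L * (t - s) ^ 2 + E * (t - s)) ->
  forall s t, 0 <= s < t -> t <= T1 ->
    Cmod (r s t) <= / (1 - Rpower 2 (1 - q)) * H * Rpower (t - s) q + E * (t - s).
Proof.
move=> Hq HH HL Hd Hr.
set k := Rpower 2 (1 - q).
have k0 : 0 < k by exact: exp_pos.
have k1 : k < 1 by have := Rpower_lt 2 (1 - q) 0 ltac:(lra) ltac:(lra); rewrite Rpower_O /k; lra.
set c := / (1 - k). have c0 : 0 < c by apply: Rinv_0_lt_compat; lra.
have ck : c = 1 + k * c by rewrite /c; field; lra.
have key m : forall s t, 0 <= s < t -> t <= T1 ->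
    Cmod (r s t) <= c * H * Rpower (t - s) q + E * (t - s) + L * (t - s) ^ 2 * (/ 2) ^ m.
  elim: m => [|m IH] s t Hs Ht.
    have := Hr s t Hs Ht. have : 0 <= c * H * Rpower (t - s) q.
      apply: Rmult_le_pos; [apply: Rmult_le_pos; lra | left; exact: exp_pos]. simpl. lra.
  set u := (s + t) / 2.
  have E1 : u - s = (t - s) / 2 by rewrite /u; lra. have E2 : t - u = (t - s) / 2 by rewrite /u; lra.
  have I1 := IH s u ltac:(lra) ltac:(lra). have I2 := IH u t ltac:(lra) ltac:(lra).
  rewrite E1 in I1. rewrite E2 in I2.
  have R2 : 2 * Rpower ((t - s) / 2) q = k * Rpower (t - s) q.
    rewrite /k /Rdiv -Rpower_mult_distr; try lra.
    have -> : Rpower (/ 2) q = Rpower 2 (- q).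
      rewrite -{1}(Rpower_1 2); last lra. rewrite -Rpower_Ropp Rpower_mult. f_equal. ring.
    have -> : 1 - q = 1 + - q by ring. rewrite Rpower_plus Rpower_1; last lra. ring.
  have D := Hd s t Hs Ht. rewrite -/u in D.
  have T : Cmod (r s t) <= Cmod (r s t - (r s u + r u t))%C + (Cmod (r s u) + Cmod (r u t)).
    apply: Rle_trans (Rplus_le_compat_l _ _ _ (Cmod_triangle _ _)).
    apply: Rle_trans _ (Cmod_triangle _ _). right. f_equal. ring.
  have EQ : c * H * Rpower (t - s) q = H * Rpower (t - s) q + 2 * (c * H * Rpower ((t - s) / 2) q).
    rewrite {1}ck. transitivity (H * Rpower (t - s) q + c * H * (k * Rpower (t - s) q)); first ring.
    rewrite -R2. ring.
  simpl. simpl in I1, I2. lra.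
move=> s t Hs Ht. apply: le_epsilon => eps Heps.
set A := L * (t - s) ^ 2. have A0 : 0 <= A by apply: Rmult_le_pos; [lra | exact: pow2_ge_0].
have [m Hm] : exists m, A * (/ 2) ^ m < eps.
  have [N HN] := pow_lt_1_zero (/ 2) ltac:(rewrite Rabs_pos_eq; lra) (eps / (A + 1)) ltac:(apply: Rdiv_lt_0_compat; lra).
  exists N. have := HN N (le_n N). rewrite Rabs_pos_eq; last by left; apply: pow_lt; lra.
  move=> Hlt. apply: Rle_lt_trans (Rmult_le_compat_r _ A (A + 1) _ _) _; try lra.
    left; apply: pow_lt; lra.
  apply: (Rlt_le_trans _ ((A + 1) * (eps / (A + 1)))); first by apply: Rmult_lt_compat_l; lra.
  right. field. lra.
have := key m s t Hs Ht. rewrite -/A. lra.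
Qed.

(** * Oscillating trilinear forms *)

Definition phase (n x y : Z) : R := 3 * IZR (n - x) * IZR (n - y) * IZR (x + y).

(** An antiderivative of [fun t => cis (- (w * t))], including the resonant case. *)
Definition oscillation_primitive (w t : R) : C :=
  if Req_EM_T w 0 then RtoC t else (sin (w * t) / w, cos (w * t) / w).

Definition nonresonant (n x y : Z) : R :=
  if Z.eq_dec x n then 0 else if Z.eq_dec y n then 0 else 1.

(** The symbol vanishes when [x + y = 0], where the phase vanishes without one of the two resonances. *)
Definition symbol (n x y : Z) : R := nonresonant n x y * IZR (x + y).

Definition trilinear (W : Z -> Z -> C) (K : nat) (a b c : Z -> C) (n : Z) : C :=
  SC K (fun x => SC K (fun y => W x y * (a x * Cconj (b (x + y - n)%Z) * c y))%C).

Definition interaction (c0 : C) (t : R) (n x y : Z) : C :=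
  (RtoC (symbol n x y) * c0 * cis (- (phase n x y * t)))%C.

(** The time integral of [interaction] over [[s, t]]. *)
Definition integrated_interaction (c0 : C) (s t : R) (n x y : Z) : C :=
  (RtoC (symbol n x y) * c0 *
    (oscillation_primitive (phase n x y) t - oscillation_primitive (phase n x y) s))%C.

Lemma Cmod_cis th : Cmod (cis th) = 1.
Proof.
rewrite /Cmod /cis /= !Rmult_1_r -sqrt_1. f_equal. have := sin2_cos2 th. rewrite /Rsqr. lra.
Qed.

Lemma cderiv_oscillation_primitive w t : cderiv (oscillation_primitive w) t (cis (- (w * t))).
Proof.
rewrite /oscillation_primitive. case: Req_EM_T => Hw.
  rewrite Hw Rmult_0_l Ropp_0 /cis cos_0 sin_0. split; rewrite /Re /Im /=.
    exact: rderiv_id.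
  exact: rderiv_const.
split; rewrite /Re /Im /cis /= ?cos_neg ?sin_neg.
  auto_derive => //. field. exact: Hw.
auto_derive => //. field. exact: Hw.
Qed.

Lemma oscillation_short w s t : s <= t ->
  Cmod (oscillation_primitive w t - oscillation_primitive w s)%C <= 2 * (t - s).
Proof.
move=> Hst. have -> : 2 * (t - s) = 2 * 1 * (t - s) by ring. apply: cderiv_bound => // u _.
exists (cis (- (w * u))). split; first exact: cderiv_oscillation_primitive. rewrite Cmod_cis. lra.
Qed.

Lemma oscillation_fast w s t : w <> 0 ->
  Cmod (oscillation_primitive w t - oscillation_primitive w s)%C <= 2 / Rabs w.
Proof.
move=> Hw. have Hw' := Rabs_pos_lt _ Hw.
have H u : Cmod (oscillation_primitive w u) = / Rabs w.
  rewrite /oscillation_primitive. case: Req_EM_T => // _.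
  have -> : (sin (w * u) / w, cos (w * u) / w) = (RtoC (/ w) * (sin (w * u), cos (w * u)))%C.
    rewrite /Cmult /RtoC /=. f_equal; field; exact: Hw.
  rewrite Cmod_mult Cmod_R Rabs_inv -[RHS]Rmult_1_r. f_equal.
  rewrite /Cmod /= !Rmult_1_r -sqrt_1. f_equal. have := sin2_cos2 (w * u). rewrite /Rsqr. lra.
apply: Rle_trans (Cmod_triangle _ _) _. rewrite Cmod_opp !H. lra.
Qed.

Lemma Rle_interpolate v A B th : 0 <= v -> v <= A -> v <= B -> 0 < A -> 0 < B -> 0 <= th <= 1 ->
  v <= Rpower A th * Rpower B (1 - th).
Proof.
move=> Hv HA HB A0 B0 Hth. case: Hv => [Hv|<-]; last by left; apply: Rmult_lt_0_compat; exact: exp_pos.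
have {1}-> : v = Rpower v th * Rpower v (1 - th).
  by rewrite -Rpower_plus (_ : th + (1 - th) = 1) ?Rpower_1 //; ring.
apply: Rmult_le_compat; try (left; exact: exp_pos); apply: Rle_Rpower_l; lra.
Qed.

Lemma jap_le_2abs k : k <> 0%Z -> jap k <= 2 * Rabs (IZR k).
Proof.
move=> Hk. rewrite /jap. have : 1 <= Rabs (IZR k) by rewrite -abs_IZR; apply: IZR_le; lia. lra.
Qed.

Lemma symbol_cases n x y : symbol n x y = 0 \/
  (n - x <> 0 /\ n - y <> 0 /\ x + y <> 0)%Z /\ symbol n x y = IZR (x + y).
Proof.
rewrite /symbol /nonresonant. case: Z.eq_dec => H1; first by left; ring.
case: Z.eq_dec => H2; first by left; ring.
case: (Z.eq_dec (x + y) 0) => H3; first by left; rewrite H3; ring.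
right. split; [lia | ring].
Qed.

(** The factor [x + y] of the symbol is also a factor of the phase, so time integration gains exactly the
    derivative that the nonlinearity loses; the exponent above one half comes from interpolating with the
    trivial bound. *)
Lemma integrated_interaction_bound g c0 s t n x y : 0 < g <= 1/64 -> Cmod c0 <= 1 -> s < t ->
  Cmod (integrated_interaction c0 s t n x y) <= 6 * Rpower (t - s) (holder g) * kernel g n x y.
Proof.
move=> Hg Hc Hst. set G := (oscillation_primitive (phase n x y) t - oscillation_primitive (phase n x y) s)%C.
rewrite /integrated_interaction -/G !Cmod_mult Cmod_R.
have P0 : 0 <= 6 * Rpower (t - s) (holder g) * kernel g n x y.
  have := kernel_pos g n x y. have : 0 < Rpower (t - s) (holder g) by exact: exp_pos. nra.
case: (symbol_cases n x y) => [->|[[Hx [Hy Hxy]] ->]].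
  by rewrite Rabs_R0 !Rmult_0_l.
have Hcc := Cmod_ge_0 c0. have HG := Cmod_ge_0 G. have Ha := Rabs_pos (IZR (x + y)).
apply: Rle_trans (Rabs (IZR (x + y)) * Cmod G) _ _ _.
  rewrite Rmult_assoc. apply: Rmult_le_compat_l => //. nra.
have J1 := jap_ge1 (x + y). have J2 := jap_ge1 (n - x). have J3 := jap_ge1 (n - y).
have Jxy : Rabs (IZR (x + y)) <= jap (x + y) by rewrite /jap; lra.
have K1 := jap_le_2abs _ Hx. have K2 := jap_le_2abs _ Hy.
set A := 6 * jap (x + y) * (t - s). set B := 6 * / (jap (n - x) * jap (n - y)).
have A0 : 0 < A by rewrite /A; apply: Rmult_lt_0_compat; lra.
have B0 : 0 < B by apply: Rmult_lt_0_compat; [lra | apply: Rinv_0_lt_compat; nra].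
have Hh : 1/2 < holder g < 1 by rewrite /holder; lra.
have -> : 6 * Rpower (t - s) (holder g) * kernel g n x y = Rpower A (holder g) * Rpower B (1 - holder g).
  have I0 : 0 < / (jap (n - x) * jap (n - y)) by apply: Rinv_0_lt_compat; nra.
  rewrite /A /B -(Rpower_mult_distr (6 * jap (x + y))) -?(Rpower_mult_distr 6) ; try lra.
  rewrite /kernel /wt.
  have -> : Rpower (/ (jap (n - x) * jap (n - y))) (1 - holder g)
    = Rpower (jap (n - x)) (- (1 - holder g)) * Rpower (jap (n - y)) (- (1 - holder g)).
    rewrite Rpower_mult_distr; try lra. rewrite Rpower_Ropp /Rpower ln_Rinv; last nra.
    by rewrite -exp_Ropp; f_equal; ring.
  have -> : Rpower 6 (holder g) = 6 * / Rpower 6 (1 - holder g).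
    rewrite -Rpower_Ropp -{2}(Rpower_1 6); last lra. rewrite -Rpower_plus. f_equal. ring.
  field. apply: Rgt_not_eq. exact: exp_pos.
apply: Rle_interpolate => //; try lra.
- exact: Rmult_le_pos.
- have := oscillation_short (phase n x y) s t ltac:(lra). rewrite -/G /A => H.
  apply: Rle_trans (Rmult_le_compat _ _ _ _ Ha HG Jxy H) _. nra.
have Q1 : 0 < Rabs (IZR (n - x)) by lra. have Q2 : 0 < Rabs (IZR (n - y)) by lra.
have Q3 : 0 < Rabs (IZR (x + y)) by apply: Rabs_pos_lt; exact: not_0_IZR.
have EP : Rabs (phase n x y) = 3 * Rabs (IZR (n - x)) * Rabs (IZR (n - y)) * Rabs (IZR (x + y)).
  rewrite /phase !Rabs_mult (Rabs_pos_eq 3) //. lra.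
have Hp : phase n x y <> 0.
  move=> E. rewrite E Rabs_R0 in EP.
  have : 0 < 3 * Rabs (IZR (n - x)) * Rabs (IZR (n - y)) * Rabs (IZR (x + y)) by repeat apply: Rmult_lt_0_compat; lra.
  lra.
have := oscillation_fast (phase n x y) s t Hp. rewrite -/G EP => H.
apply: Rle_trans (Rmult_le_compat_l _ _ _ Ha H) _.
have -> : Rabs (IZR (x + y)) * (2 / (3 * Rabs (IZR (n - x)) * Rabs (IZR (n - y)) * Rabs (IZR (x + y))))
  = 2/3 * / (Rabs (IZR (n - x)) * Rabs (IZR (n - y))) by field; lra.
rewrite /B. 
have : / (Rabs (IZR (n - x)) * Rabs (IZR (n - y))) <= 4 * / (jap (n - x) * jap (n - y)).
  have -> : 4 * / (jap (n - x) * jap (n - y)) = / (jap (n - x) / 2 * (jap (n - y) / 2)) by field; lra.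
  apply: Rinv_le_contravar; first by apply: Rmult_lt_0_compat; lra.
  apply: Rmult_le_compat; lra.
have : 0 < / (jap (n - x) * jap (n - y)) by apply: Rinv_0_lt_compat; nra.
lra.
Qed.

Lemma trilinear_bound W K a b c n (w : Z -> Z -> R) : (forall x y, Cmod (W x y) <= w x y) ->
  Cmod (trilinear W K a b c n)
    <= double_sum K (fun x y => w x y * (Cmod (a x) * Cmod (b (x + y - n)%Z) * Cmod (c y))).
Proof.
move=> H. apply: Rle_trans (Cmod_symsum _ _) _. apply: SZ_le => x.
apply: Rle_trans (Cmod_symsum _ _) _. apply: SZ_le => y.
rewrite !Cmod_mult Cmod_conj. apply: Rmult_le_compat_r => //.
apply: Rmult_le_pos; last exact: Cmod_ge_0. apply: Rmult_le_pos; exact: Cmod_ge_0.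
Qed.

Lemma trilinear_W_minus W W' K a b c n :
  trilinear (fun x y => W x y - W' x y)%C K a b c n = (trilinear W K a b c n - trilinear W' K a b c n)%C.
Proof.
rewrite /trilinear -SC_minus. apply: symsum_ext => x. rewrite -SC_minus. apply: symsum_ext => y. cring.
Qed.

Lemma trilinear_telescope W K a b n :
  (trilinear W K a a a n - trilinear W K b b b n)%C =
  (trilinear W K (fun k => a k - b k)%C a a n + trilinear W K b (fun k => a k - b k)%C a n
    + trilinear W K b b (fun k => a k - b k)%C n)%C.
Proof.
rewrite /trilinear -SC_minus -!SC_plus. apply: symsum_ext => x.
rewrite -SC_minus -!SC_plus. apply: symsum_ext => y. rewrite Cminus_conj. cring.
Qed.

Lemma cderiv_trilinear_interaction c0 K a n s t :
  cderiv (fun t' => trilinear (integrated_interaction c0 s t' n) K a a a n) t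
    (trilinear (interaction c0 t n) K a a a n).
Proof.
apply: cderiv_symsum => x. apply: cderiv_symsum => y. apply: cderiv_scal_r. apply: cderiv_scal.
apply: cderiv_eq.
  apply: cderiv_minus; [exact: cderiv_oscillation_primitive | exact: cderiv_const].
cring.
Qed.

(** * Bounds for the integrated interaction *)

Definition modulus (a : Z -> C) (n : Z) : R := Cmod (a n).

Lemma integrated_sum_bound g c0 s t K a b c n M : 0 < g <= 1/64 -> Cmod c0 <= 1 -> s < t ->
  double_sum K (fun x y => kernel g n x y * (Cmod (a x) * Cmod (b (x + y - n)%Z) * Cmod (c y))) <= M ->
  Cmod (trilinear (integrated_interaction c0 s t n) K a b c n) <= 6 * Rpower (t - s) (holder g) * M.
Proof.
move=> Hg Hc Hst HM.
apply: Rle_trans (trilinear_bound _ _ _ _ _ _ _ (fun x y => integrated_interaction_bound g c0 s t n x y Hg Hc Hst)) _.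
rewrite (double_sum_ext _ _ (fun x y => 6 * Rpower (t - s) (holder g) *
   (kernel g n x y * (Cmod (a x) * Cmod (b (x + y - n)%Z) * Cmod (c y))))); last by move=> x y; ring.
rewrite double_sum_scal. apply: Rmult_le_compat_l => //.
apply: Rmult_le_pos; [lra | left; exact: exp_pos].
Qed.

(** The output weight improves from [1/8] to [5/16] because the sup bound of weight [1/2] is available for the largest
    of the three frequencies, and [1/2 - 5/16 = 5/16 - 1/8]. *)
Lemma integrated_interaction_sup g R0 : 0 < g <= 1/64 -> 0 <= R0 -> exists C, 0 < C /\
  forall c0 s t K a n, Cmod c0 <= 1 -> s < t ->
    (forall k, Cmod (a k) <= R0 * wt (- (1/2)) k) -> sobolev_bounded g R0 (modulus a) ->
    Cmod (trilinear (integrated_interaction c0 s t n) K a a a n)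
      <= C * Rpower (t - s) (holder g) * wt (- (5/16)) n.
Proof.
move=> Hg HR.
have [Cx [Cx0 Hx]] := trilinear_x g R0 Hg HR.
have [Cy [Cy0 Hy]] := trilinear_y g R0 Hg HR.
have [Cz [Cz0 Hz]] := trilinear_z g R0 Hg HR.
exists (6 * (3 * R0 * (Cx + Cz + Cy)) + 1). split.
  have : 0 <= R0 * (Cx + Cz + Cy) by apply: Rmult_le_pos; lra.
  lra.
move=> c0 s t K a n Hc Hst Ha Hs.
have P := wt_pos (- (5/16)) n. have Pt : 0 < Rpower (t - s) (holder g) by exact: exp_pos.
have {}Hx := Hx K n _ _ Hs Hs. have {}Hy := Hy K n _ _ Hs Hs. have {}Hz := Hz K n _ _ Hs Hs.
apply: Rle_trans (integrated_sum_bound g c0 s t K a a a n (3 * R0 * (Cx + Cz + Cy) * wt (- (5/16)) n) Hg Hc Hst _) _; last by nra.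
apply: Rle_trans (double_sum_le _ _ (fun x y => 3 * R0 * wt (- (3/16)) n *
  (kernel g n x y * (wt (- (5/16)) x * modulus a (x + y - n) * modulus a y)
  + (kernel g n x y * (modulus a x * wt (- (5/16)) (x + y - n) * modulus a y)
  + kernel g n x y * (modulus a x * modulus a (x + y - n) * wt (- (5/16)) y)))) _) _.
  move=> x y.
  have B k : 0 <= Cmod (a k) <= R0 * wt (- (1/2)) k by split; [exact: Cmod_ge_0 | exact: Ha].
  have := largest_frequency R0 _ _ _ n x (x + y - n) y ltac:(lia) (B x) (B (x + y - n)%Z) (B y).
  move=> H. apply: Rle_trans (Rmult_le_compat_l _ _ _ (Rlt_le _ _ (kernel_pos g n x y)) H) _.
  right. rewrite /modulus. ring.
rewrite double_sum_scal !double_sum_plus.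
have -> : wt (- (5/16)) n = wt (- (3/16)) n * wt (- (1/8)) n by rewrite wt_mul; f_equal; lra.
have Q := wt_pos (- (3/16)) n.
rewrite (_ : forall u v, 3 * R0 * (Cx + Cz + Cy) * (u * v) = 3 * R0 * u * (Cx * v + (Cz * v + Cy * v))); last by intros; ring.
apply: Rmult_le_compat_l; first by apply: Rmult_le_pos; lra.
by apply: Rplus_le_compat => //; apply: Rplus_le_compat.
Qed.

Lemma integrated_interaction_lipschitz g R0 : 0 < g <= 1/64 -> 0 <= R0 -> exists C, 0 < C /\
  forall c0 s t K a b n d, Cmod c0 <= 1 -> s < t -> 0 <= d ->
    sobolev_bounded g R0 (modulus a) -> sobolev_bounded g R0 (modulus b) ->
    (forall k, Cmod (a k - b k)%C <= d * wt (- (5/16)) k) ->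
    Cmod (trilinear (integrated_interaction c0 s t n) K a a a n
          - trilinear (integrated_interaction c0 s t n) K b b b n)%C
      <= C * Rpower (t - s) (holder g) * d * wt (- (1/8)) n.
Proof.
move=> Hg HR.
have [Cx [Cx0 Hx]] := trilinear_x g R0 Hg HR.
have [Cy [Cy0 Hy]] := trilinear_y g R0 Hg HR.
have [Cz [Cz0 Hz]] := trilinear_z g R0 Hg HR.
exists (6 * Cx + 6 * Cz + 6 * Cy). split; first lra.
move=> c0 s t K a b n d Hc Hst Hd Ha Hb Hab.
have {}Hx := Hx K n _ _ Ha Ha. have {}Hy := Hy K n _ _ Hb Hb. have {}Hz := Hz K n _ _ Hb Ha.
rewrite trilinear_telescope.
have E F G M : (forall x y, F x y <= d * (kernel g n x y * G x y)) ->
   double_sum K (fun x y => kernel g n x y * G x y) <= M -> double_sum K F <= d * M.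
  move=> H1 H2. apply: Rle_trans (double_sum_le _ _ _ H1) _. rewrite double_sum_scal. exact: Rmult_le_compat_l.
have X1 := integrated_sum_bound g c0 s t K (fun k => a k - b k)%C a a n _ Hg Hc Hst (E _ _ _ _ Hx).
have X2 := integrated_sum_bound g c0 s t K b (fun k => a k - b k)%C a n _ Hg Hc Hst (E _ _ _ _ Hz).
have X3 := integrated_sum_bound g c0 s t K b b (fun k => a k - b k)%C n _ Hg Hc Hst (E _ _ _ _ Hy).
have M k : 0 <= Cmod (a k) by exact: Cmod_ge_0. have M' k : 0 <= Cmod (b k) by exact: Cmod_ge_0.
have Kp x y := Rlt_le _ _ (kernel_pos g n x y).
rewrite /modulus in X1 X2 X3.
apply: Rle_trans (Cmod_triangle _ _) _.
have Y := Cmod_triangle (trilinear (integrated_interaction c0 s t n) K (fun k => a k - b k)%C a a n)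
  (trilinear (integrated_interaction c0 s t n) K b (fun k => a k - b k)%C a n).
have W1 x y : kernel g n x y * (Cmod (a x - b x)%C * Cmod (a (x + y - n)%Z) * Cmod (a y))
   <= d * (kernel g n x y * (wt (- (5/16)) x * Cmod (a (x + y - n)%Z) * Cmod (a y))).
  have -> u v w k' : d * (k' * (u * v * w)) = k' * (d * u * v * w) by ring.
  apply: Rmult_le_compat_l => //. by do 2 (apply: Rmult_le_compat_r => //).
have W2 x y : kernel g n x y * (Cmod (b x) * Cmod (a (x + y - n)%Z - b (x + y - n)%Z)%C * Cmod (a y))
   <= d * (kernel g n x y * (Cmod (b x) * wt (- (5/16)) (x + y - n) * Cmod (a y))).
  have -> u v w k' : d * (k' * (u * v * w)) = k' * (u * (d * v) * w) by ring.
  apply: Rmult_le_compat_l => //.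
  apply: Rmult_le_compat_r => //. by apply: Rmult_le_compat_l.
have W3 x y : kernel g n x y * (Cmod (b x) * Cmod (b (x + y - n)%Z) * Cmod (a y - b y)%C)
   <= d * (kernel g n x y * (Cmod (b x) * Cmod (b (x + y - n)%Z) * wt (- (5/16)) y)).
  have -> u v w k' : d * (k' * (u * v * w)) = k' * (u * v * (d * w)) by ring.
  apply: Rmult_le_compat_l => //. apply: Rmult_le_compat_l => //. exact: Rmult_le_pos.
have {}X1 := X1 W1. have {}X2 := X2 W2. have {}X3 := X3 W3.
have Z1 := Cmod_triangle (trilinear (integrated_interaction c0 s t n) K (fun k => a k - b k)%C a a n
  + trilinear (integrated_interaction c0 s t n) K b (fun k => a k - b k)%C a n)%C
  (trilinear (integrated_interaction c0 s t n) K b b (fun k => a k - b k)%C n).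
lra.
Qed.

(** * The a priori bound *)

(** Bounds that depend on [K]; they only serve to make the limit in [sewing] vanish and to start the iteration in
    [holder_bound]. *)
Lemma trilinear_crude W K a b c n (w : Z -> Z -> R) A1 A2 A3 : (forall x y, Cmod (W x y) <= w x y) ->
  (forall k, Cmod (a k) <= A1) -> (forall k, Cmod (b k) <= A2) -> (forall k, Cmod (c k) <= A3) ->
  Cmod (trilinear W K a b c n) <= A1 * A2 * A3 * double_sum K w.
Proof.
move=> HW Ha Hb Hc. apply: Rle_trans (trilinear_bound _ _ _ _ _ _ _ HW) _.
rewrite -double_sum_scal. apply: double_sum_le => x y. rewrite (Rmult_comm _ (w x y)).
apply: Rmult_le_compat_l; first exact: Rle_trans (Cmod_ge_0 _) (HW x y).
apply: Rmult_le_compat => //; try exact: Cmod_ge_0.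
  apply: Rmult_le_pos; exact: Cmod_ge_0.
apply: Rmult_le_compat => //; exact: Cmod_ge_0.
Qed.

Lemma symbol_abs n x y : Rabs (symbol n x y) <= Rabs (IZR (x + y)).
Proof.
case: (symbol_cases n x y) => [->|[_ ->]]; last lra. rewrite Rabs_R0. exact: Rabs_pos.
Qed.

Lemma interaction_abs c0 t n x y : Cmod c0 <= 1 -> Cmod (interaction c0 t n x y) <= Rabs (IZR (x + y)).
Proof.
move=> Hc. rewrite /interaction !Cmod_mult Cmod_cis Cmod_R Rmult_1_r.
have := symbol_abs n x y. have := Rabs_pos (symbol n x y). have := Cmod_ge_0 c0. nra.
Qed.

Lemma trilinear_0 (W : Z -> Z -> C) K a b c n : (forall x y, W x y = RtoC 0) -> trilinear W K a b c n = RtoC 0.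
Proof.
move=> H. rewrite /trilinear -(SC_0 K). apply: symsum_ext => x. rewrite -(SC_0 K). apply: symsum_ext => y.
rewrite H. cring.
Qed.

Lemma Rpower_small x p : 0 < x <= 1 -> 0 <= p <= 1 -> x <= Rpower x p.
Proof.
move=> Hx Hp. rewrite -{1}(Rpower_1 x); last lra. rewrite /Rpower.
have Hl : ln x <= 0.
  case: (Req_dec x 1) => [->|H]; first by rewrite ln_1; lra.
  rewrite -ln_1. left. apply: ln_increasing; lra.
have H : 1 * ln x <= p * ln x by nra.
case: H => [H|->]; last lra. left. exact: exp_increasing.
Qed.

(** Self-improvement of a Hoelder constant: below the threshold time scale the sewing bound contracts
    the constant, above it the sup bound is already good enough. *)
Lemma interpolation_step y x R0 M D p w1 w2 w5 : 0 <= R0 -> 0 <= M -> 0 <= D -> 0 < p -> 0 < w1 -> 0 < w2 -> 0 < w5 ->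
  w1 * w2 = w5 * w5 -> 0 <= x -> y <= x + M * D * w1 * p * p -> y <= 2 * R0 * w2 ->
  y <= x + (4 * R0 * M + D / 2) * p * w5.
Proof.
move=> HR HM HD Hp H1 H2 H5 E Hx Hy1 Hy2.
have Q1 : 0 <= R0 * M * (p * w5) by repeat apply: Rmult_le_pos; lra.
have Q2 : 0 <= D * (p * w5) by repeat apply: Rmult_le_pos; lra.
case: (Rle_dec (M * w1 * p) (w5 / 2)) => H.
  have := Rmult_le_compat_l (D * p) _ _ ltac:(nra) H. lra.
have G : w2 <= 2 * M * p * w5.
  apply: (Rmult_le_reg_l w1) => //. rewrite E. have : w5 <= 2 * (M * w1 * p) by lra. nra.
have := Rmult_le_compat_l (2 * R0) _ _ ltac:(lra) G. lra.
Qed.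

(** Let [D] be a constant for which increments are bounded by [D * (t - s)^a] with the weight [5/16].  Sewing and
    interpolation with the sup bound show that [B0 + D / 2] is another such constant, with [B0] independent of [K].
    Some finite [D] exists because the sums are finite, and iteration removes its dependence on [K]. *)
Theorem holder_bound g R0 E0 : 0 < g <= 1/64 -> 0 <= R0 -> 0 <= E0 -> exists Ch, 0 < Ch /\
  forall c0 K T1 (a : Z -> R -> C), Cmod c0 <= 1 -> T1 <= 1 ->
    (forall k t, 0 <= t <= T1 -> Cmod (a k t) <= R0 * wt (- (1/2)) k) ->
    (forall t, 0 <= t <= T1 -> sobolev_bounded g R0 (modulus (fun k => a k t))) ->
    (forall k t, (Z.of_nat K < Z.abs k)%Z -> 0 <= t <= T1 -> a k t = 0%C) ->
    (forall k t, (Z.abs k <= Z.of_nat K)%Z -> 0 <= t <= T1 -> exists d, cderiv (a k) t d /\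
       Cmod (d - trilinear (interaction c0 t k) K (fun j => a j t) (fun j => a j t) (fun j => a j t) k)%C
         <= E0 * wt (- (1/2)) k) ->
    forall k s t, 0 <= s < t -> t <= T1 -> Cmod (a k t - a k s)%C <= Ch * Rpower (t - s) (holder g).
Proof.
move=> Hg HR HE.
have [C1 [C10 HC1]] := integrated_interaction_sup g R0 Hg HR.
have [C2 [C20 HC2]] := integrated_interaction_lipschitz g R0 Hg HR.
set al := holder g. have Hal : 1/2 < al < 1 by rewrite /al /holder; lra.
set q := 2 * al. have Hq : 1 < q by rewrite /q; lra.
set Cq := / (1 - Rpower 2 (1 - q)).
have Cq0 : 0 < Cq.
  apply: Rinv_0_lt_compat. have := Rpower_lt 2 (1 - q) 0 ltac:(lra) ltac:(lra). rewrite Rpower_O; lra.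
set M := Cq * C2. have HM : 0 < M by apply: Rmult_lt_0_compat.
set B0 := C1 + 2 * E0 + 4 * R0 * M. have HB0 : 0 <= B0 by rewrite /B0; have := Rmult_le_pos _ _ HR (Rlt_le _ _ HM); lra.
exists (2 * B0 + 1). split; first lra.
move=> c0 K T1 a Hc HT Hsup Hsob Hout Hode.
have wt_le1 := wt_le_1.
have Hsup1 k t : 0 <= t <= T1 -> Cmod (a k t) <= R0.
  move=> Ht. have := Hsup k t Ht. have := wt_le1 (1/2) k ltac:(lra). nra.
pose at_ (t : R) (j : Z) := a j t.
set S0 := double_sum K (fun x y => Rabs (IZR (x + y))).
have S00 : 0 <= S0 by apply: SZ_nonneg => x; apply: SZ_nonneg => y; exact: Rabs_pos.
set Lam := 2 * (R0 * R0 * R0 * S0 + E0).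
have HLam : 0 <= Lam.
  have : 0 <= R0 * R0 * R0 * S0 by apply: Rmult_le_pos => //; apply: Rmult_le_pos => //; exact: Rmult_le_pos.
  rewrite /Lam. lra.
have Lip k s t : 0 <= s <= t -> t <= T1 -> Cmod (a k t - a k s)%C <= Lam * (t - s).
  move=> Hs Ht. case: (Z_le_dec (Z.abs k) (Z.of_nat K)) => Hk; last first.
    rewrite !Hout; try lia; try lra. rewrite (_ : (0 - 0)%C = 0%C) ?Cmod_0; last ring. apply: Rmult_le_pos; lra.
  apply: cderiv_bound; first lra. move=> u Hu. have [d [Hd1 Hd2]] := Hode k u Hk ltac:(lra).
  exists d. split=> //.
  have -> : d = ((d - trilinear (interaction c0 u k) K (at_ u) (at_ u) (at_ u) k) + trilinear (interaction c0 u k) K (at_ u) (at_ u) (at_ u) k)%C by ring.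
  apply: Rle_trans (Cmod_triangle _ _) _.
  have := trilinear_crude (interaction c0 u k) K (at_ u) (at_ u) (at_ u) k _ R0 R0 R0 (fun x y => interaction_abs c0 u k x y Hc)
    (fun j => Hsup1 j u ltac:(lra)) (fun j => Hsup1 j u ltac:(lra)) (fun j => Hsup1 j u ltac:(lra)).
  rewrite -/S0. have := wt_le1 (1/2) k ltac:(lra). have := wt_pos (- (1/2)) k. rewrite -/(at_ u) in Hd2. nra.
pose X s t b k := trilinear (integrated_interaction c0 s t k) K b b b k.
pose r k s t := (a k t - a k s - X s t (at_ s) k)%C.
(* the constant L may depend on K: it disappears in the sewing limit *)
set L := 2 * (3 * (R0 * R0 * Lam * S0)).
have HL : 0 <= L.
  have : 0 <= R0 * R0 * Lam * S0 by apply: Rmult_le_pos => //; apply: Rmult_le_pos => //; exact: Rmult_le_pos.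
  rewrite /L. lra.
have Quad k s t : (Z.abs k <= Z.of_nat K)%Z -> 0 <= s < t -> t <= T1 ->
    Cmod (r k s t) <= L * (t - s) ^ 2 + 2 * E0 * wt (- (1/2)) k * (t - s).
  move=> Hk Hs Ht.
  have rss : r k s s = 0%C.
    rewrite /r /X (trilinear_0 (integrated_interaction c0 s s k)); first ring. move=> x y. rewrite /integrated_interaction. ring.
  have -> : r k s t = (r k s t - r k s s)%C by rewrite rss; ring.
  have -> : L * (t - s) ^ 2 + 2 * E0 * wt (- (1/2)) k * (t - s)
    = 2 * (3 * (R0 * R0 * Lam * S0) * (t - s) + E0 * wt (- (1/2)) k) * (t - s) by rewrite /L; ring.
  apply: (cderiv_bound (r k s)); first lra. move=> u Hu.
  have [d [Hd1 Hd2]] := Hode k u Hk ltac:(lra). rewrite -/(at_ u) in Hd2.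
  exists (d - trilinear (interaction c0 u k) K (at_ s) (at_ s) (at_ s) k)%C. split.
    apply: cderiv_minus; last exact: cderiv_trilinear_interaction.
    apply: cderiv_eq (cderiv_minus _ _ _ _ _ Hd1 (cderiv_const (a k s) u)) _. ring.
  have -> : (d - trilinear (interaction c0 u k) K (at_ s) (at_ s) (at_ s) k)%C
   = ((d - trilinear (interaction c0 u k) K (at_ u) (at_ u) (at_ u) k)
     + (trilinear (interaction c0 u k) K (at_ u) (at_ u) (at_ u) k - trilinear (interaction c0 u k) K (at_ s) (at_ s) (at_ s) k))%C by ring.
  apply: Rle_trans (Cmod_triangle _ _) _. rewrite Rplus_comm. apply: Rplus_le_compat; last exact: Hd2.
  rewrite trilinear_telescope.
  have Hd j : Cmod (at_ u j - at_ s j)%C <= Lam * (t - s).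
    apply: Rle_trans (Lip j s u _ _) _; try lra. apply: Rmult_le_compat_l; lra.
  have Hu1 j : Cmod (at_ u j) <= R0 by apply: Hsup1; lra.
  have Hs1 j : Cmod (at_ s j) <= R0 by apply: Hsup1; lra.
  have I x y := interaction_abs c0 u k x y Hc.
  have Y1 := trilinear_crude _ K _ _ _ k _ _ _ _ I Hd Hu1 Hu1.
  have Y2 := trilinear_crude _ K _ _ _ k _ _ _ _ I Hs1 Hd Hu1.
  have Y3 := trilinear_crude _ K _ _ _ k _ _ _ _ I Hs1 Hs1 Hd.
  rewrite -/S0 in Y1 Y2 Y3.
  apply: Rle_trans (Cmod_triangle _ _) _. apply: Rle_trans (Rplus_le_compat_r _ _ _ (Cmod_triangle _ _)) _.
  lra.
have Defect D : 0 <= D ->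
    (forall j s t, 0 <= s < t -> t <= T1 -> Cmod (a j t - a j s)%C <= D * Rpower (t - s) al * wt (- (5/16)) j) ->
    forall k s t, 0 <= s < t -> t <= T1 ->
      Cmod (r k s t - (r k s ((s + t) / 2)%R + r k ((s + t) / 2)%R t))%C <= C2 * D * wt (- (1/8)) k * Rpower (t - s) q.
  move=> HD H k s t Hs Ht. set u := (s + t) / 2. have Hu : s < u < t by rewrite /u; lra.
  have Add b : X s t b k = (X s u b k + X u t b k)%C.
    rewrite /X. rewrite (_ : trilinear (integrated_interaction c0 s u k) K b b b k
        = trilinear (fun x y => integrated_interaction c0 s t k x y - integrated_interaction c0 u t k x y)%C K b b b k).
      rewrite trilinear_W_minus. ring.
    apply: symsum_ext => x. apply: symsum_ext => y. rewrite /integrated_interaction. cring.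
  have -> : (r k s t - (r k s u + r k u t))%C = (X u t (at_ u) k - X u t (at_ s) k)%C.
    rewrite /r (Add (at_ s)). ring.
  have Pp x : 0 < Rpower x al by exact: exp_pos.
  have := HC2 c0 u t K (at_ u) (at_ s) k (D * Rpower (u - s) al) Hc ltac:(lra)
    (Rmult_le_pos _ _ HD (Rlt_le _ _ (Pp _))) (Hsob u ltac:(lra)) (Hsob s ltac:(lra)) (fun j => H j s u ltac:(lra) ltac:(lra)).
  rewrite -/al -/(X u t (at_ u) k) -/(X u t (at_ s) k) => Z.
  apply: Rle_trans Z _.
  have R1 : Rpower (t - u) al <= Rpower (t - s) al by apply: Rle_Rpower_l; lra.
  have R2 : Rpower (u - s) al <= Rpower (t - s) al by apply: Rle_Rpower_l; lra.
  have -> : Rpower (t - s) q = Rpower (t - s) al * Rpower (t - s) al by rewrite -Rpower_plus; f_equal; rewrite /q; ring.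
  have W := wt_pos (- (1/8)) k.
  have : Rpower (t - u) al * Rpower (u - s) al <= Rpower (t - s) al * Rpower (t - s) al.
    by apply: Rmult_le_compat => //; left.
  move=> Y. have := Rmult_le_compat_l (C2 * D * wt (- (1/8)) k) _ _ ltac:(repeat apply: Rmult_le_pos; lra) Y. lra.
have Step D : 0 <= D ->
    (forall j s t, 0 <= s < t -> t <= T1 -> Cmod (a j t - a j s)%C <= D * Rpower (t - s) al * wt (- (5/16)) j) ->
    forall j s t, 0 <= s < t -> t <= T1 -> Cmod (a j t - a j s)%C <= (B0 + D / 2) * Rpower (t - s) al * wt (- (5/16)) j.
  move=> HD H k s t Hs Ht. 
  have Pp : 0 < Rpower (t - s) al by exact: exp_pos.
  have W5 := wt_pos (- (5/16)) k. have W1 := wt_pos (- (1/8)) k. have W2 := wt_pos (- (1/2)) k.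
  case: (Z_le_dec (Z.abs k) (Z.of_nat K)) => Hk; last first.
    rewrite !Hout; try lia; try lra. rewrite (_ : (0 - 0)%C = 0%C) ?Cmod_0; last ring.
    apply: Rmult_le_pos; last lra. apply: Rmult_le_pos; lra.
  have Sew := sewing q (C2 * D * wt (- (1/8)) k) L (2 * E0 * wt (- (1/2)) k) T1 (r k) Hq
    ltac:(apply: Rmult_le_pos; [nra | lra]) HL (Defect D HD H k) (fun s t h1 h2 => Quad k s t Hk h1 h2) s t Hs Ht.
  have Xb := HC1 c0 s t K (at_ s) k Hc ltac:(lra) (fun j => Hsup j s ltac:(lra)) (Hsob s ltac:(lra)).
  rewrite -/al -/(X s t (at_ s) k) in Xb.
  have Tri : Cmod (a k t - a k s)%C <= Cmod (r k s t) + Cmod (X s t (at_ s) k).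
    apply: Rle_trans _ (Cmod_triangle _ _). right. f_equal. rewrite /r. ring.
  have Triv : Cmod (a k t - a k s)%C <= 2 * R0 * wt (- (1/2)) k.
    apply: Rle_trans (Cmod_triangle _ _) _. rewrite Cmod_opp.
    have := Hsup k t ltac:(lra). have := Hsup k s ltac:(lra). lra.
  have Tau : t - s <= Rpower (t - s) al by apply: Rpower_small; lra.
  have W25 : wt (- (1/2)) k <= wt (- (5/16)) k by apply: wt_le_exp; lra.
  have Eq : Rpower (t - s) q = Rpower (t - s) al * Rpower (t - s) al by rewrite -Rpower_plus; f_equal; rewrite /q; ring.
  have EW : wt (- (1/8)) k * wt (- (1/2)) k = wt (- (5/16)) k * wt (- (5/16)) k by rewrite !wt_mul; f_equal; lra.
  have Lin : 2 * E0 * wt (- (1/2)) k * (t - s) <= 2 * E0 * (Rpower (t - s) al * wt (- (5/16)) k).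
    rewrite Rmult_assoc. apply: Rmult_le_compat_l; first lra. rewrite Rmult_comm. apply: Rmult_le_compat; lra.
  have Q0 : 0 <= Rpower (t - s) al * wt (- (5/16)) k by apply: Rmult_le_pos; lra.
  have := interpolation_step (Cmod (a k t - a k s)%C) ((C1 + 2 * E0) * (Rpower (t - s) al * wt (- (5/16)) k)) R0 M D
    (Rpower (t - s) al) (wt (- (1/8)) k) (wt (- (1/2)) k) (wt (- (5/16)) k) HR (Rlt_le _ _ HM) HD Pp W1 W2 W5 EW
    ltac:(apply: Rmult_le_pos; lra) _ Triv.
  rewrite Eq -/Cq in Sew. rewrite /B0 => F.
  apply: Rle_trans (F _) _; last by right; ring.
  rewrite /M. lra.
set D0 := Lam / wt (- (5/16)) (Z.of_nat K).
have WK := wt_pos (- (5/16)) (Z.of_nat K).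
have HD0 : 0 <= D0 by apply: Rdiv_le_0_compat.
have Iter m : forall j s t, 0 <= s < t -> t <= T1 ->
    Cmod (a j t - a j s)%C <= (2 * B0 + D0 * (/ 2) ^ m) * Rpower (t - s) al * wt (- (5/16)) j.
  elim: m => [|m IH] k s t Hs Ht; last first.
    have Hp : 0 <= D0 * (/ 2) ^ m by apply: Rmult_le_pos => //; apply: pow_le; lra.
    apply: Rle_trans (Step (2 * B0 + D0 * (/ 2) ^ m) _ IH k s t Hs Ht) _; first lra.
    right. simpl. field.
  have Pp : 0 < Rpower (t - s) al by exact: exp_pos. have W5 := wt_pos (- (5/16)) k.
  case: (Z_le_dec (Z.abs k) (Z.of_nat K)) => Hk; last first.
    rewrite !Hout; try lia; try lra. rewrite (_ : (0 - 0)%C = 0%C) ?Cmod_0; last ring.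
    simpl. repeat apply: Rmult_le_pos; lra.
  apply: Rle_trans (Lip k s t _ Ht) _; first lra.
  have Tau : t - s <= Rpower (t - s) al by apply: Rpower_small; lra.
  have WkK : wt (- (5/16)) (Z.of_nat K) <= wt (- (5/16)) k.
    apply: wt_le_neg; first lra. rewrite /jap -!abs_IZR. apply: Rplus_le_compat_l. apply: IZR_le. lia.
  have E : Lam = D0 * wt (- (5/16)) (Z.of_nat K) by rewrite /D0; field; lra.
  have H1 : Lam <= D0 * wt (- (5/16)) k by rewrite {1}E; apply: Rmult_le_compat_l.
  simpl. rewrite Rmult_1_r.
  apply: (Rle_trans _ (D0 * wt (- (5/16)) k * Rpower (t - s) al)).
    apply: Rmult_le_compat => //; lra.
  have : 0 <= B0 * (Rpower (t - s) al * wt (- (5/16)) k) by repeat apply: Rmult_le_pos; lra. lra.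
move=> k s t Hs Ht.
have [N HN] := pow_lt_1_zero (/ 2) ltac:(rewrite Rabs_pos_eq; lra) (/ (D0 + 1)) ltac:(apply: Rinv_0_lt_compat; lra).
have {}HN := HN N (le_n N). have HpN : 0 < (/ 2) ^ N by apply: pow_lt; lra.
rewrite Rabs_pos_eq in HN; last lra.
have HDN : D0 * (/ 2) ^ N <= 1.
  have : (D0 + 1) * (/ 2) ^ N <= (D0 + 1) * / (D0 + 1) by apply: Rmult_le_compat_l; lra.
  rewrite Rinv_r; lra.
have Pp : 0 < Rpower (t - s) al by exact: exp_pos.
apply: Rle_trans (Iter N k s t Hs Ht) _.
have W := wt_le1 (5/16) k ltac:(lra). have W5 := wt_pos (- (5/16)) k.
have Hp : 0 <= D0 * (/ 2) ^ N by apply: Rmult_le_pos; lra.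
rewrite Rmult_assoc. apply: Rmult_le_compat; try lra; try nra.
Qed.

(** * Means over a period *)

(** Complex-valued functions are treated componentwise, as in the definitions of [CInt] and [CDerive]. *)
Definition ccontinuous (f : R -> C) (x : R) : Prop :=
  continuous (fun y => Re (f y)) x /\ continuous (fun y => Im (f y)) x.

Definition continuous_on_period (a : R) (f : R -> C) : Prop :=
  forall x, a <= x <= a + 2 * PI -> ccontinuous f x.

Definition mean (a : R) (f : R -> C) : C := (RtoC (/ (2 * PI)) * CInt f a (a + 2 * PI))%C.

Lemma rcont_plus (f g : R -> R) x : continuous f x -> continuous g x -> continuous (fun y => f y + g y) x.
Proof. exact: continuous_plus. Qed.
Lemma rcont_minus (f g : R -> R) x : continuous f x -> continuous g x -> continuous (fun y => f y - g y) x.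
Proof. exact: continuous_minus. Qed.
Lemma rcont_mult (f g : R -> R) x : continuous f x -> continuous g x -> continuous (fun y => f y * g y) x.
Proof. exact: continuous_mult. Qed.
Lemma rcont_opp (f : R -> R) x : continuous f x -> continuous (fun y => - f y) x.
Proof. exact: continuous_opp. Qed.

Lemma ccontinuous_plus f g x : ccontinuous f x -> ccontinuous g x -> ccontinuous (fun y => f y + g y)%C x.
Proof. move=> [H1 H2] [H3 H4]. split; exact: rcont_plus. Qed.
Lemma ccontinuous_minus f g x : ccontinuous f x -> ccontinuous g x -> ccontinuous (fun y => f y - g y)%C x.
Proof. move=> [H1 H2] [H3 H4]. split; exact: rcont_minus. Qed.
Lemma ccontinuous_mult f g x : ccontinuous f x -> ccontinuous g x -> ccontinuous (fun y => f y * g y)%C x.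
Proof.
move=> [H1 H2] [H3 H4]. split.
  apply: rcont_minus; exact: rcont_mult.
apply: rcont_plus; exact: rcont_mult.
Qed.
Lemma ccontinuous_const c x : ccontinuous (fun _ => c) x.
Proof. split; exact: continuous_const. Qed.
Lemma ccontinuous_conj f x : ccontinuous f x -> ccontinuous (fun y => Cconj (f y)) x.
Proof. move=> [H1 H2]. split=> //. exact: rcont_opp. Qed.
Lemma ccontinuous_deriv f x l : cderiv f x l -> ccontinuous f x.
Proof. move=> [H1 H2]. split; apply: (ex_derive_continuous (K := R_AbsRing)); eexists; eassumption. Qed.
Lemma ccontinuous_RtoC (f : R -> R) x : continuous f x -> ccontinuous (fun y => RtoC (f y)) x.
Proof. move=> H. split=> //. exact: continuous_const. Qed.

Lemma cderiv_RtoC x : cderiv RtoC x (RtoC 1).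
Proof.
split; [exact: rderiv_id | exact: rderiv_const].
Qed.

Lemma cderiv_cis w x : cderiv (fun y => cis (w * y)) x (Ci * RtoC w * cis (w * x))%C.
Proof.
split; rewrite /Re /Im /cis /Ci /=; auto_derive => //; ring.
Qed.

Lemma ccontinuous_cis w x : ccontinuous (fun y => cis (w * y)) x.
Proof. exact: ccontinuous_deriv (cderiv_cis w x). Qed.

Lemma ccontinuous_ext f g x : (forall y, f y = g y) -> ccontinuous f x -> ccontinuous g x.
Proof.
move=> H [H1 H2]. split; [apply: continuous_ext H1 | apply: continuous_ext H2] => y; by rewrite H.
Qed.

Lemma ccontinuous_symsum K (f : Z -> R -> C) x : (forall n, ccontinuous (f n) x) ->
  ccontinuous (fun y => SC K (fun n => f n y)) x.
Proof.
move=> H. rewrite /symsum. elim: (2 * K)%nat => [|L IH].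
  apply: (ccontinuous_ext (f (Z.of_nat 0 - Z.of_nat K)%Z)) => // y. by rewrite sum_O.
apply: (ccontinuous_ext (fun y => sum_n (G := C_AbelianMonoid) (fun k => f (Z.of_nat k - Z.of_nat K)%Z y) L + f (Z.of_nat (S L) - Z.of_nat K)%Z y)%C).
  move=> y. by rewrite sum_Sn.
exact: ccontinuous_plus.
Qed.

Lemma cis_add u v : cis (u + v) = (cis u * cis v)%C.
Proof. rewrite /cis /Cmult /= cos_plus sin_plus. f_equal; ring. Qed.
Lemma cis_neg u : cis (- u) = Cconj (cis u).
Proof. by rewrite /cis /Cconj /= cos_neg sin_neg. Qed.
Lemma cis_0 : cis 0 = RtoC 1.
Proof. by rewrite /cis cos_0 sin_0. Qed.
Lemma cis_period n : cis (IZR n * (2 * PI)) = RtoC 1.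
Proof.
have H k : cis (INR k * (2 * PI)) = RtoC 1.
  rewrite /cis (_ : INR k * (2 * PI) = 0 + 2 * INR k * PI); last ring. by rewrite cos_period sin_period cos_0 sin_0.
case: (Z_le_dec 0 n) => Hn.
  rewrite -(Z2Nat.id n) // -INR_IZR_INZ. exact: H.
rewrite (_ : IZR n * (2 * PI) = - (IZR (- n) * (2 * PI))); last by rewrite opp_IZR; ring.
rewrite cis_neg -(Z2Nat.id (- n)); last lia. rewrite -INR_IZR_INZ H. rewrite /Cconj /RtoC /=. f_equal. ring.
Qed.
Lemma cis_cis u v : (cis u * cis v)%C = cis (u + v).
Proof. by rewrite cis_add. Qed.
Lemma cis_conj_self u : (cis u * Cconj (cis u))%C = RtoC 1.
Proof. rewrite -cis_neg -cis_add -cis_0. f_equal. ring. Qed.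

Lemma CInt_pair f a b : a <= b -> (forall x, a <= x <= b -> ccontinuous f x) ->
  CInt f a b = (RInt (fun x => Re (f x)) a b, RInt (fun x => Im (f x)) a b)
  /\ ex_RInt (fun x => Re (f x)) a b /\ ex_RInt (fun x => Im (f x)) a b.
Proof.
move=> Hab H.
have E1 : ex_RInt (fun x => Re (f x)) a b.
  apply: ex_RInt_continuous => z. rewrite Rmin_left // Rmax_right // => Hz. exact: (proj1 (H z Hz)).
have E2 : ex_RInt (fun x => Im (f x)) a b.
  apply: ex_RInt_continuous => z. rewrite Rmin_left // Rmax_right // => Hz. exact: (proj2 (H z Hz)).
split=> //. apply: (is_RInt_unique (V := C_R_CompleteNormedModule)).
exact: (is_RInt_fct_extend_pair (U := R_NormedModule) (V := R_NormedModule) f a b _ _ (RInt_correct _ _ _ E1) (RInt_correct _ _ _ E2)).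
Qed.

Lemma CInt_ext f g a b : a <= b -> (forall x, a <= x <= b -> f x = g x) -> CInt f a b = CInt g a b.
Proof. move=> Hab H. apply: (RInt_ext (V := C_R_CompleteNormedModule)) => x. rewrite Rmin_left // Rmax_right // => Hx. apply: H. lra. Qed.

Lemma CInt_plus f g a b : a <= b -> (forall x, a <= x <= b -> ccontinuous f x) -> (forall x, a <= x <= b -> ccontinuous g x) ->
  CInt (fun x => f x + g x)%C a b = (CInt f a b + CInt g a b)%C.
Proof.
move=> Hab Hf Hg.
have [E [F1 F2]] := CInt_pair f a b Hab Hf. have [E' [G1 G2]] := CInt_pair g a b Hab Hg.
have [E'' _] := CInt_pair (fun x => f x + g x)%C a b Hab (fun x Hx => ccontinuous_plus _ _ _ (Hf x Hx) (Hg x Hx)).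
rewrite E E' E'' /Cplus /=. f_equal; exact: (RInt_plus (V := R_CompleteNormedModule)).
Qed.

Lemma CInt_scal c f a b : a <= b -> (forall x, a <= x <= b -> ccontinuous f x) ->
  CInt (fun x => c * f x)%C a b = (c * CInt f a b)%C.
Proof.
move=> Hab Hf.
have [E [F1 F2]] := CInt_pair f a b Hab Hf.
have [E'' _] := CInt_pair (fun x => c * f x)%C a b Hab (fun x Hx => ccontinuous_mult _ _ _ (ccontinuous_const c x) (Hf x Hx)).
rewrite E E'' /Cmult /=. f_equal.
  rewrite (RInt_minus (V := R_CompleteNormedModule) (fun x => fst c * fst (f x)) (fun x => snd c * snd (f x))).
  - rewrite !(RInt_scal (V := R_CompleteNormedModule)) //.
  - exact: ex_RInt_scal F1.
  - exact: ex_RInt_scal F2.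
rewrite (RInt_plus (V := R_CompleteNormedModule) (fun x => fst c * snd (f x)) (fun x => snd c * fst (f x))).
- rewrite !(RInt_scal (V := R_CompleteNormedModule)) //.
- exact: ex_RInt_scal F2.
- exact: ex_RInt_scal F1.
Qed.

Lemma CInt_bound f a b M : a <= b -> (forall x, a <= x <= b -> ccontinuous f x) ->
  (forall x, a <= x <= b -> Cmod (f x) <= M) -> Cmod (CInt f a b) <= 2 * M * (b - a).
Proof.
move=> Hab Hf HM. have [E [F1 F2]] := CInt_pair f a b Hab Hf. rewrite E.
have B1 := abs_RInt_le_const _ a b M Hab F1 (fun t Ht => Rle_trans _ _ _ (Re_le_Cmod _) (HM t Ht)).
have B2 := abs_RInt_le_const _ a b M Hab F2 (fun t Ht => Rle_trans _ _ _ (Im_le_Cmod _) (HM t Ht)).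
apply: Rle_trans (Cmod_le_parts _) _. rewrite /Re /Im /= in B1 B2 *. lra.
Qed.

Lemma CInt_derive F f a b : a <= b -> (forall x, a <= x <= b -> cderiv F x (f x)) -> (forall x, a <= x <= b -> ccontinuous f x) ->
  CInt f a b = (F b - F a)%C.
Proof.
move=> Hab HF Hf. have [-> _] := CInt_pair f a b Hab Hf.
have H1 : RInt (fun x => Re (f x)) a b = Re (F b) - Re (F a).
  apply: is_RInt_unique. apply: (is_RInt_derive (V := R_CompleteNormedModule) (fun x => Re (F x))) => x;
    rewrite Rmin_left // Rmax_right // => Hx; [exact: (proj1 (HF x Hx)) | exact: (proj1 (Hf x Hx))].
have H2 : RInt (fun x => Im (f x)) a b = Im (F b) - Im (F a).
  apply: is_RInt_unique. apply: (is_RInt_derive (V := R_CompleteNormedModule) (fun x => Im (F x))) => x;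
    rewrite Rmin_left // Rmax_right // => Hx; [exact: (proj2 (HF x Hx)) | exact: (proj2 (Hf x Hx))].
by rewrite H1 H2.
Qed.

Lemma period_le a : a <= a + 2 * PI.
Proof. have := PI_RGT_0. lra. Qed.

Lemma mean_ext a f g : (forall x, f x = g x) -> mean a f = mean a g.
Proof. move=> H. rewrite /mean. f_equal. apply: CInt_ext => //. exact: period_le. Qed.

Lemma mean_ext_on a f g : (forall x, a <= x <= a + 2 * PI -> f x = g x) -> mean a f = mean a g.
Proof. move=> H. rewrite /mean. f_equal. apply: CInt_ext => //. exact: period_le. Qed.

Lemma mean_plus a f g : continuous_on_period a f -> continuous_on_period a g ->
  mean a (fun x => f x + g x)%C = (mean a f + mean a g)%C.
Proof. move=> Hf Hg. rewrite /mean CInt_plus //; [ring | exact: period_le]. Qed.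

Lemma mean_scal a c f : continuous_on_period a f -> mean a (fun x => c * f x)%C = (c * mean a f)%C.
Proof. move=> Hf. rewrite /mean CInt_scal //; [ring | exact: period_le]. Qed.

Lemma mean_minus a f g : continuous_on_period a f -> continuous_on_period a g ->
  mean a (fun x => f x - g x)%C = (mean a f - mean a g)%C.
Proof.
move=> Hf Hg. rewrite (mean_ext a _ (fun x => f x + - (1) * g x)%C); last by move=> x; ring.
rewrite mean_plus // ?mean_scal //; first ring.
move=> x Hx. apply: ccontinuous_mult; [exact: ccontinuous_const | exact: Hg].
Qed.

Lemma mean_bound a f M : continuous_on_period a f -> (forall x, a <= x <= a + 2 * PI -> Cmod (f x) <= M) ->
  Cmod (mean a f) <= 2 * M.
Proof.
move=> Hf HM. have HP := PI_RGT_0. rewrite /mean Cmod_mult Cmod_R.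
have I0 : 0 < / (2 * PI) by apply: Rinv_0_lt_compat; lra.
rewrite Rabs_pos_eq; last lra.
have := CInt_bound f a (a + 2 * PI) M (period_le a) Hf HM.
rewrite (_ : a + 2 * PI - a = 2 * PI); last ring. move=> H.
apply: (Rle_trans _ (/ (2 * PI) * (2 * M * (2 * PI)))); first by apply: Rmult_le_compat_l; lra.
right. field. lra.
Qed.

Lemma mean_symsum a K (f : Z -> R -> C) : (forall n, continuous_on_period a (f n)) ->
  mean a (fun x => SC K (fun n => f n x)) = SC K (fun n => mean a (f n)).
Proof.
move=> H. rewrite /symsum. elim: (2 * K)%nat => [|L IH].
  rewrite sum_O. apply: mean_ext => x. by rewrite sum_O.
rewrite sum_Sn -IH.
rewrite (mean_ext a _ (fun y => sum_n (G := C_AbelianMonoid) (fun k => f (Z.of_nat k - Z.of_nat K)%Z y) L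
   + f (Z.of_nat (S L) - Z.of_nat K)%Z y)%C); last by move=> x; rewrite sum_Sn.
rewrite mean_plus //. move=> x Hx. clear IH. elim: L => [|L IH].
  apply: (ccontinuous_ext (f (Z.of_nat 0 - Z.of_nat K)%Z)); [move=> y; by rewrite sum_O | exact: H].
apply: (ccontinuous_ext (fun y => sum_n (G := C_AbelianMonoid) (fun k => f (Z.of_nat k - Z.of_nat K)%Z y) L + f (Z.of_nat (S L) - Z.of_nat K)%Z y)%C).
  move=> y. by rewrite sum_Sn.
apply: ccontinuous_plus => //. exact: H.
Qed.

Lemma mean_const a c : mean a (fun _ => c) = c.
Proof.
have HP := PI_RGT_0. rewrite /mean (CInt_derive (fun x => c * RtoC x)%C).
- rewrite RtoC_plus. transitivity (c * (RtoC (/ (2 * PI)) * RtoC (2 * PI)))%C; first ring.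
  rewrite -RtoC_mult Rinv_l; [ring | lra].
- exact: period_le.
- move=> x _. apply: cderiv_eq (cderiv_scal c _ _ _ (cderiv_RtoC x)) _. ring.
- move=> x _. exact: ccontinuous_const.
Qed.

Lemma mean_derive a F f : (forall x, cderiv F x (f x)) -> (forall x, ccontinuous f x) -> F (a + 2 * PI) = F a ->
  mean a f = RtoC 0.
Proof.
move=> HF Hf E. rewrite /mean (CInt_derive F) //; last exact: period_le. rewrite E. ring.
Qed.

Lemma mean_cis a n : mean a (fun x => cis (IZR n * x)) = if Z.eq_dec n 0 then RtoC 1 else RtoC 0.
Proof.
case: Z.eq_dec => [->|Hn].
  rewrite (mean_ext a _ (fun _ => RtoC 1)); first exact: mean_const. move=> x. by rewrite Rmult_0_l cis_0.
have Hn' : IZR n <> 0 by exact: not_0_IZR.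
apply: (mean_derive a (fun x => (/ (Ci * RtoC (IZR n))) * cis (IZR n * x))%C).
- move=> x. apply: cderiv_eq. apply: cderiv_scal. exact: cderiv_cis.
  field. split; [by move=> H; apply: Hn'; case: H | by move=> H; case: H => H; lra].
- move=> x. exact: ccontinuous_cis.
- rewrite Rmult_plus_distr_l cis_add cis_period. ring.
Qed.

(** * Fourier series of smooth periodic functions *)

Definition coef (a : R) (v : R -> C) (n : Z) : C := mean a (fun x => v x * cis (- (IZR n * x)))%C.

Lemma ccontinuous_cis_neg n x : ccontinuous (fun y => cis (- (IZR n * y))) x.
Proof.
apply: (ccontinuous_ext (fun y => cis ((- IZR n) * y))); last exact: ccontinuous_cis.
move=> y. f_equal. ring.
Qed.

Lemma coef_continuous a v n : continuous_on_period a v ->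
  continuous_on_period a (fun x => v x * cis (- (IZR n * x)))%C.
Proof. move=> H x Hx. apply: ccontinuous_mult; [exact: H | exact: ccontinuous_cis_neg]. Qed.

Lemma cderiv_cis_neg n x : cderiv (fun y => cis (- (IZR n * y))) x (- (Ci * RtoC (IZR n)) * cis (- (IZR n * x)))%C.
Proof.
apply: (cderiv_ext (fun y => cis ((- IZR n) * y))); first by move=> y; f_equal; ring.
apply: cderiv_eq (cderiv_cis _ _) _.
rewrite (_ : - IZR n * x = - (IZR n * x)); last ring. rewrite RtoC_opp. ring.
Qed.

Lemma coef_derive a v v' n : (forall x, cderiv v x (v' x)) -> (forall x, ccontinuous v' x) -> periodic v ->
  coef a v' n = (Ci * RtoC (IZR n) * coef a v n)%C.
Proof.
move=> Hv Hv' Hp.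
have Cv x : ccontinuous v x by exact: ccontinuous_deriv (Hv x).
have := mean_derive a (fun x => v x * cis (- (IZR n * x)))%C
  (fun x => v' x * cis (- (IZR n * x)) + v x * (- (Ci * RtoC (IZR n)) * cis (- (IZR n * x))))%C.
rewrite mean_plus.
- rewrite (mean_ext a (fun x => v x * (- (Ci * RtoC (IZR n)) * cis (- (IZR n * x))))%C
    (fun x => (- (Ci * RtoC (IZR n))) * (v x * cis (- (IZR n * x))))%C); last by move=> x; ring.
  rewrite mean_scal; last by apply: coef_continuous => x _.
  rewrite -/(coef a v' n) -/(coef a v n) => H.
  have {}H : (coef a v' n + - (Ci * RtoC (IZR n)) * coef a v n)%C = RtoC 0.
    apply: H.
    + move=> x. apply: cderiv_mult; [exact: Hv | exact: cderiv_cis_neg].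
    + move=> x. apply: ccontinuous_plus; apply: ccontinuous_mult => //; first exact: ccontinuous_cis_neg.
      apply: ccontinuous_mult; [exact: ccontinuous_const | exact: ccontinuous_cis_neg].
    + rewrite Hp. f_equal. rewrite (_ : - (IZR n * (a + 2 * PI)) = - (IZR n * a) + - (IZR n * (2 * PI))); last ring.
      rewrite cis_add (cis_neg (IZR n * (2 * PI))) cis_period /Cconj /RtoC /Cmult /=. 
      rewrite /cis. f_equal; ring.
  transitivity ((coef a v' n + - (Ci * RtoC (IZR n)) * coef a v n) + (Ci * RtoC (IZR n)) * coef a v n)%C; first ring.
  rewrite H. ring.
- by apply: coef_continuous => x _.
- move=> x _. apply: ccontinuous_mult => //. apply: ccontinuous_mult; [exact: ccontinuous_const | exact: ccontinuous_cis_neg].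
Qed.

Definition trig_poly (K : nat) (c : Z -> C) (x : R) : C := SC K (fun n => c n * cis (IZR n * x))%C.

Lemma ccontinuous_trig_poly K c x : ccontinuous (trig_poly K c) x.
Proof. apply: ccontinuous_symsum => n. apply: ccontinuous_mult; [exact: ccontinuous_const | exact: ccontinuous_cis]. Qed.

Lemma mean_cis_cis a m n : mean a (fun x => cis (IZR m * x) * cis (- (IZR n * x)))%C = if Z.eq_dec m n then RtoC 1 else RtoC 0.
Proof.
rewrite (mean_ext a _ (fun x => cis (IZR (m - n) * x))); last first.
  move=> x. rewrite cis_cis minus_IZR. f_equal. ring.
rewrite mean_cis. case: Z.eq_dec => H; case: Z.eq_dec => H' //; lia.
Qed.

Lemma coef_trig_poly a K c n : coef a (trig_poly K c) n = if Z_le_dec (Z.abs n) (Z.of_nat K) then c n else RtoC 0.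
Proof.
rewrite /coef (mean_ext a _ (fun x => SC K (fun m => c m * (cis (IZR m * x) * cis (- (IZR n * x)))))%C); last first.
  move=> x. rewrite /trig_poly -SC_scal_r. apply: symsum_ext => m. cring.
rewrite mean_symsum; last first.
  move=> m x _. apply: ccontinuous_mult; first exact: ccontinuous_const.
  apply: ccontinuous_mult; [exact: ccontinuous_cis | exact: ccontinuous_cis_neg].
rewrite (symsum_ext _ K _ (fun m => c m * (if Z.eq_dec m n then RtoC 1 else RtoC 0))%C); last first.
  move=> m. rewrite mean_scal ?mean_cis_cis // => x _.
  apply: ccontinuous_mult; [exact: ccontinuous_cis | exact: ccontinuous_cis_neg].
case: Z_le_dec => Hn.
  rewrite (symsum_delta _ K n) //; first by case: Z.eq_dec => [_|H]; [cring | case: H].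
  move=> m Hm. case: Z.eq_dec => // _. change (c m * RtoC 0 = RtoC 0)%C. ring.
transitivity (SC K (fun _ => RtoC 0)); last exact: SC_0.
apply: symsum_ext_loc => m Hm. case: Z.eq_dec => H; [lia | cring].
Qed.

Lemma mean_conj a f : continuous_on_period a f -> mean a (fun x => Cconj (f x)) = Cconj (mean a f).
Proof.
move=> Hf. rewrite /mean.
have [-> [F1 F2]] := CInt_pair f a _ (period_le a) Hf.
have [-> _] := CInt_pair (fun x => Cconj (f x)) a _ (period_le a) (fun x Hx => ccontinuous_conj _ _ (Hf x Hx)).
rewrite Cmult_conj /Cconj /RtoC /Cmult /=. rewrite (RInt_opp (V := R_CompleteNormedModule)) //.
rewrite /opp /=. rewrite /Re /Im. f_equal; ring.
Qed.

Lemma mean_Re_nonneg a f : continuous_on_period a f -> (forall x, 0 <= Re (f x)) -> 0 <= Re (mean a f).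
Proof.
move=> Hf H. rewrite /mean. have [-> [F1 F2]] := CInt_pair f a _ (period_le a) Hf.
rewrite /RtoC /Cmult /Re /= Rmult_0_l Rminus_0_r. have HP := PI_RGT_0.
apply: Rmult_le_pos; first by left; apply: Rinv_0_lt_compat; lra.
apply: RInt_ge_0; [exact: period_le | exact: F1 | move=> x _; exact: H].
Qed.

Lemma Cmult_conj_self z : (z * Cconj z)%C = RtoC (Cmod z ^ 2).
Proof. by rewrite Cmod2_conj. Qed.

(** Bessel's inequality: the mean of the squared distance to the Fourier polynomial is nonnegative. *)
Lemma bessel a v K : continuous_on_period a v ->
  SZ K (fun n => Cmod (coef a v n) ^ 2) <= Re (mean a (fun x => v x * Cconj (v x))%C).
Proof.
move=> Hv. pose S := trig_poly K (coef a v).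
have HS x : ccontinuous S x by exact: ccontinuous_trig_poly.
have vS : forall f, continuous_on_period a f ->
    mean a (fun x => f x * Cconj (S x))%C = SC K (fun n => Cconj (coef a v n) * coef a f n)%C.
  move=> f Hf.
  rewrite (mean_ext a _ (fun x => SC K (fun n => Cconj (coef a v n) * (f x * cis (- (IZR n * x))))%C)); last first.
    move=> x. rewrite /S /trig_poly SC_conj -SC_scal. apply: symsum_ext => n. rewrite Cmult_conj cis_neg. cring.
  rewrite mean_symsum.
    apply: symsum_ext => n. by rewrite mean_scal; last exact: coef_continuous.
  move=> n x Hx. apply: ccontinuous_mult; [exact: ccontinuous_const | exact: (coef_continuous a f n Hf)].
have E1 : mean a (fun x => v x * Cconj (S x))%C = RtoC (SZ K (fun n => Cmod (coef a v n) ^ 2)).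
  rewrite vS //. rewrite -[LHS]/(SC K _).
  have -> : RtoC (SZ K (fun n => Cmod (coef a v n) ^ 2)) = SC K (fun n => RtoC (Cmod (coef a v n) ^ 2)).
    apply: injective_projections; rewrite -?[fst _]/(Re _) -?[snd _]/(Im _).
      by rewrite Re_symsum.
    rewrite Im_symsum. transitivity (0 * SZ K (fun _ => 0)); first by rewrite /=; ring.
    rewrite -SZ_scal. apply: symsum_ext => n. rewrite /=. rring.
  apply: symsum_ext => n. rewrite -Cmult_conj_self. cring.
have E2 : mean a (fun x => S x * Cconj (S x))%C = RtoC (SZ K (fun n => Cmod (coef a v n) ^ 2)).
  rewrite vS; last by move=> x _. rewrite -E1 vS //. apply: symsum_ext_loc => n Hn.
  rewrite coef_trig_poly. by case: Z_le_dec => // H; exfalso; apply: H; lia.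
have E3 : mean a (fun x => S x * Cconj (v x))%C = RtoC (SZ K (fun n => Cmod (coef a v n) ^ 2)).
  rewrite (mean_ext a _ (fun x => Cconj (v x * Cconj (S x)))%C); last by move=> x; rewrite Cmult_conj Cconj_conj Cmult_comm.
  rewrite mean_conj.
    rewrite E1 /Cconj /RtoC /=. f_equal. ring.
  move=> x Hx. apply: ccontinuous_mult; [exact: Hv | exact: ccontinuous_conj].
have N := mean_Re_nonneg a (fun x => (v x - S x) * Cconj (v x - S x))%C.
rewrite (mean_ext a (fun x => (v x - S x) * Cconj (v x - S x))%C
   (fun x => (v x * Cconj (v x) - v x * Cconj (S x)) - (S x * Cconj (v x) - S x * Cconj (S x)))%C) in N; last first.
  move=> x. rewrite Cminus_conj. ring.
have cvv : continuous_on_period a (fun x => v x * Cconj (v x))%C by move=> x Hx; apply: ccontinuous_mult; [exact: Hv | apply: ccontinuous_conj; exact: Hv].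
have cvS : continuous_on_period a (fun x => v x * Cconj (S x))%C by move=> x Hx; apply: ccontinuous_mult; [exact: Hv | exact: ccontinuous_conj].
have cSv : continuous_on_period a (fun x => S x * Cconj (v x))%C by move=> x Hx; apply: ccontinuous_mult; [exact: HS | apply: ccontinuous_conj; exact: Hv].
have cSS : continuous_on_period a (fun x => S x * Cconj (S x))%C by move=> x Hx; apply: ccontinuous_mult; [exact: HS | exact: ccontinuous_conj].
rewrite mean_minus in N; last 2 first.
  by move=> x Hx; apply: ccontinuous_minus; [exact: cvv | exact: cvS].
  by move=> x Hx; apply: ccontinuous_minus; [exact: cSv | exact: cSS].
rewrite !mean_minus // E1 E2 E3 in N.
have {}N : 0 <= Re (mean a (fun x => v x * Cconj (v x)) - RtoC (SZ K (fun n => (Cmod (coef a v n) ^ 2)%R)) -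
   (RtoC (SZ K (fun n => (Cmod (coef a v n) ^ 2)%R)) - RtoC (SZ K (fun n => (Cmod (coef a v n) ^ 2)%R))))%C.
  apply: N.
    move=> x Hx. apply: ccontinuous_mult; last apply: ccontinuous_conj; apply: ccontinuous_minus => //; exact: Hv.
  move=> x. rewrite Cmult_conj_self /=. have := Cmod_ge_0 (v x - S x)%C. nra.
rewrite /Re /Cminus /Cplus /Copp /RtoC /= in N *. lra.
Qed.

(** The partial sums of the squared coefficients converge by Bessel's inequality, so their increments vanish. *)
Lemma riemann_lebesgue a v : continuous_on_period a v -> forall eps, 0 < eps ->
  exists N0, forall N, (N0 <= N)%nat ->
    Cmod (coef a v (Z.of_nat (S N))) <= eps /\ Cmod (coef a v (- Z.of_nat (S N))) <= eps.
Proof.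
move=> Hv eps Heps.
pose u N := SZ N (fun n => Cmod (coef a v n) ^ 2).
have uS N : u (S N) = Cmod (coef a v (- Z.of_nat (S N))) ^ 2 + (u N + Cmod (coef a v (Z.of_nat (S N))) ^ 2).
  by rewrite /u symsum_S.
have [l Hl] := ex_finite_lim_seq_incr u (Re (mean a (fun x => v x * Cconj (v x))%C))
  ltac:(move=> N; rewrite uS; have := pow2_ge_0 (Cmod (coef a v (- Z.of_nat (S N))));
        have := pow2_ge_0 (Cmod (coef a v (Z.of_nat (S N)))); lra) (fun N => bessel a v N Hv).
have e2 : 0 < eps ^ 2 / 2 by nra.
have [N0 HN0] := proj2 (is_lim_seq_spec u l) Hl (mkposreal _ e2).
exists N0 => N HN. have H1 := HN0 N HN. have H2 := HN0 (S N) ltac:(lia). rewrite /= uS in H1 H2.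
have {}H1 := Rabs_def2 _ _ H1. have {}H2 := Rabs_def2 _ _ H2.
have P1 := Cmod_ge_0 (coef a v (Z.of_nat (S N))). have P2 := Cmod_ge_0 (coef a v (- Z.of_nat (S N))).
split; apply: Rnot_lt_le => H; nra.
Qed.

(** The difference quotient at the origin, extended by the derivative [l]. *)
Definition slope_fun (h : R -> R) (l y : R) : R := if Req_EM_T y 0 then l else h y / y.

Lemma continuous_slope_fun h l y : (forall x, continuous h x) -> h 0 = 0 -> is_derive h 0 l ->
  continuous (slope_fun h l) y.
Proof.
move=> Hc H0 Hd. case: (Req_EM_T y 0) => [->|Hy].
  apply/continuity_pt_filterlim. 
  have Hs : slope_fun h l 0 = l by rewrite /slope_fun; case: Req_EM_T.
  move=> eps Heps. move/is_derive_Reals: Hd => Hd. have [del Hdel] := Hd eps Heps.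
  exists del. split; first exact: cond_pos. move=> x [[_ Hx] Hxd].
  rewrite /= /Rdist Hs /slope_fun in Hxd *. case: Req_EM_T => Hx0; first by exfalso; exact: Hx.
  have := Hdel x Hx0. rewrite Rplus_0_l H0 !Rminus_0_r. apply. by rewrite Rminus_0_r in Hxd.
apply: (continuous_ext_loc _ (fun z => h z * / z)).
  have Hp : 0 < Rabs y by exact: Rabs_pos_lt.
  exists (mkposreal _ Hp) => z Hz. rewrite /slope_fun. case: Req_EM_T => // Hz0.
  exfalso. rewrite Hz0 /ball /= /AbsRing_ball /abs /minus /plus /opp /= in Hz.
  rewrite Rplus_0_l Rabs_Ropp in Hz. lra.
apply: rcont_mult; first exact: Hc.
apply/continuity_pt_filterlim. apply: continuity_pt_inv => //. exact: continuity_pt_id.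
Qed.

Lemma slope_fun_mul h l y : h 0 = 0 -> y * slope_fun h l y = h y.
Proof.
move=> H0. rewrite /slope_fun. case: Req_EM_T => [->|Hy]; first by rewrite H0; ring. by field.
Qed.

Lemma symsum_telescope N (G : Z -> C) : SC N (fun n => G (n - 1)%Z - G n)%C = (G (- Z.of_nat N - 1)%Z - G (Z.of_nat N))%C.
Proof.
elim: N => [|N IH]; first by rewrite /symsum /= sum_O.
rewrite symsum_S IH.
rewrite (_ : (Z.of_nat (S N) - 1)%Z = Z.of_nat N); last lia.
rewrite (_ : (- Z.of_nat N - 1)%Z = (- Z.of_nat (S N))%Z); last lia.
change ((G (- Z.of_nat (S N) - 1)%Z - G (- Z.of_nat (S N))%Z + (G (- Z.of_nat (S N))%Z - G (Z.of_nat N)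
  + (G (Z.of_nat N) - G (Z.of_nat (S N)))))%C = (G (- Z.of_nat (S N) - 1)%Z - G (Z.of_nat (S N)))%C). ring.
Qed.

Lemma half_angle y : (cis y - 1)%C = (cis (y / 2) * (2 * Ci * RtoC (sin (y / 2))))%C.
Proof.
have E : y = y / 2 + y / 2 by lra.
rewrite {1}E cis_add /cis /Ci /Cmult /Cminus /Cplus /Copp /RtoC /=. have := sin2_cos2 (y / 2). rewrite /Rsqr => H.
f_equal; nra.
Qed.

(** Dividing [w - w 0] by [cis y - 1] turns the symmetric partial sums of the Fourier series at [0] into a
    telescoping sum of two Fourier coefficients of a continuous function, which vanish in the limit. *)
Lemma fourier_inversion_at_0 w d : (forall x, ccontinuous w x) -> cderiv w 0 d -> forall eps, 0 < eps ->
  exists N0, forall N, (N0 <= N)%nat -> Cmod (SC N (coef (- PI) w) - w 0)%C <= eps.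
Proof.
move=> Hc Hd eps Heps. have HP := PI_RGT_0.
pose h1 y := Re (w y) - Re (w 0). pose h2 y := Im (w y) - Im (w 0). pose sn y := sin (y / 2).
have D1 : is_derive h1 0 (Re d).
  apply: rderiv_eq. apply: rderiv_minus. exact: (proj1 Hd). exact: rderiv_const. rewrite /zero /=; ring.
have D2 : is_derive h2 0 (Im d).
  apply: rderiv_eq. apply: rderiv_minus. exact: (proj2 Hd). exact: rderiv_const. rewrite /zero /=; ring.
have D3 : is_derive sn 0 (/ 2).
  rewrite /sn. auto_derive => //. rewrite (_ : 0 * / 2 = 0) ?cos_0; lra.
pose p1 := slope_fun h1 (Re d). pose p2 := slope_fun h2 (Im d). pose p3 := slope_fun sn (/ 2).
have h10 : h1 0 = 0 by rewrite /h1; ring. have h20 : h2 0 = 0 by rewrite /h2; ring.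
have sn0 : sn 0 = 0 by rewrite /sn (_ : 0 / 2 = 0) ?sin_0; lra.
have P1 y : continuous p1 y.
  apply: continuous_slope_fun => // x. apply: rcont_minus; [exact: (proj1 (Hc x)) | exact: continuous_const].
have P2 y : continuous p2 y.
  apply: continuous_slope_fun => // x. apply: rcont_minus; [exact: (proj2 (Hc x)) | exact: continuous_const].
have P3 y : continuous p3 y.
  apply: continuous_slope_fun => // x. apply: (ex_derive_continuous (K := R_AbsRing)). rewrite /sn. by auto_derive.
have N3 y : - PI <= y <= PI -> p3 y <> 0.
  move=> Hy. rewrite /p3 /slope_fun. case: Req_EM_T => Hy0; first lra.
  have S0 : sin (y / 2) <> 0.
    case: (Rtotal_order y 0) => [H|[H|H]] //.
      have := sin_gt_0 (- (y / 2)) ltac:(lra) ltac:(lra). rewrite sin_neg. lra.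
    have := sin_gt_0 (y / 2) ltac:(lra) ltac:(lra). lra.
  rewrite /sn /Rdiv. apply: Rmult_integral_contrapositive_currified => //. exact: Rinv_neq_0_compat.
pose g y := (cis (- (y / 2)) * (RtoC (p1 y) + Ci * RtoC (p2 y)) * (RtoC (/ p3 y) * (/ (2 * Ci))))%C.
have I2 : (2 * Ci)%C <> 0%C by move=> H; case: H => _; lra.
have Cg : continuous_on_period (- PI) g.
  move=> y Hy. rewrite (_ : - PI + 2 * PI = PI) in Hy; last ring.
  apply: ccontinuous_mult; [apply: ccontinuous_mult |].
  - apply: (ccontinuous_ext (fun z => cis ((- / 2) * z))); [by move=> z; f_equal; field | exact: ccontinuous_cis].
  - apply: ccontinuous_plus; first exact: ccontinuous_RtoC.
    apply: ccontinuous_mult; [exact: ccontinuous_const | exact: ccontinuous_RtoC].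
  - apply: ccontinuous_mult; last exact: ccontinuous_const. apply: ccontinuous_RtoC.
    apply/continuity_pt_filterlim. apply: continuity_pt_inv; last exact: N3. apply/continuity_pt_filterlim. exact: P3.
have Eg y : - PI <= y <= - PI + 2 * PI -> (w y - w 0)%C = ((cis y - 1) * g y)%C.
  move=> Hy. rewrite (_ : - PI + 2 * PI = PI) in Hy; last ring.
  have N3' : RtoC (p3 y) <> 0%C by move=> H; apply: (N3 y Hy); case: H.
  rewrite half_angle /g.
  have -> : (w y - w 0)%C = (RtoC y * (RtoC (p1 y) + Ci * RtoC (p2 y)))%C.
    transitivity (RtoC (y * p1 y) + Ci * RtoC (y * p2 y))%C; last by rewrite !RtoC_mult; ring.
    rewrite /p1 /p2 !slope_fun_mul // /h1 /h2 /Cminus /Cplus /Copp /Cmult /Ci /RtoC /Re /Im /=. f_equal; ring.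
  rewrite -[sin (y / 2)]/(sn y) -(slope_fun_mul sn (/ 2) y) // -/p3 RtoC_mult RtoC_inv; last exact: N3.
  have := cis_conj_self (y / 2). rewrite -cis_neg => E.
  have E2 := Cinv_r _ I2. have E3 := Cinv_r _ N3'.
  transitivity ((cis (y / 2) * cis (- (y / 2))) * ((2 * Ci) * / (2 * Ci)) * (RtoC (p3 y) * / RtoC (p3 y))
    * (RtoC y * (RtoC (p1 y) + Ci * RtoC (p2 y))))%C; first by rewrite E E2 E3; ring.
  ring.
have Cw : continuous_on_period (- PI) w by move=> y _; exact: Hc.
have Ec n : coef (- PI) w n = (coef (- PI) g (n - 1) - coef (- PI) g n + (if Z.eq_dec n 0 then w 0 else RtoC 0))%C.
  have cg m : continuous_on_period (- PI) (fun x => g x * cis (- (IZR m * x)))%C by exact: coef_continuous.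
  have cw0 : continuous_on_period (- PI) (fun x => w 0 * cis (IZR (- n) * x))%C.
    move=> x Hx. apply: ccontinuous_mult; [exact: ccontinuous_const | exact: ccontinuous_cis].
  rewrite {1}/coef (mean_ext_on _ _ (fun x => (g x * cis (- (IZR (n - 1) * x)) - g x * cis (- (IZR n * x))) + w 0 * cis (IZR (- n) * x))%C).
    rewrite mean_plus //; last by move=> x Hx; apply: ccontinuous_minus; [exact: (cg (n - 1)%Z x Hx) | exact: (cg n x Hx)].
    rewrite mean_minus // mean_scal; last by move=> x _; exact: ccontinuous_cis.
    rewrite mean_cis -!/(coef (- PI) g _). f_equal.
    case: Z.eq_dec => H; case: Z.eq_dec => H'; try lia; ring.
  move=> x Hx.
  have -> : cis (- (IZR (n - 1) * x)) = (cis x * cis (- (IZR n * x)))%C by rewrite cis_cis minus_IZR; f_equal; ring.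
  rewrite opp_IZR (_ : - IZR n * x = - (IZR n * x)); last ring.
  transitivity (((w x - w 0) + w 0) * cis (- (IZR n * x)))%C; first ring. rewrite Eg //. ring.
have [N0 HN0] := riemann_lebesgue _ g Cg (eps / 2) ltac:(lra).
exists (S N0) => N HN.
have -> : (SC N (coef (- PI) w) - w 0)%C = (coef (- PI) g (- Z.of_nat N - 1) - coef (- PI) g (Z.of_nat N))%C.
  rewrite -symsum_telescope (symsum_ext _ N (coef (- PI) w) _ Ec) SC_plus.
  rewrite (symsum_delta _ N 0 (fun n => if Z.eq_dec n 0 then w 0 else RtoC 0)) /=; [ring | lia |].
  move=> n Hn. by case: Z.eq_dec.
apply: Rle_trans (Cmod_triangle _ _) _. rewrite Cmod_opp.
have [_ H1] := HN0 N ltac:(lia). rewrite (_ : (- Z.of_nat (S N))%Z = (- Z.of_nat N - 1)%Z) in H1; last lia.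
have [H2 _] := HN0 (N - 1)%nat ltac:(lia). rewrite (_ : S (N - 1) = N) in H2; last lia. lra.
Qed.

Lemma RInt_period (k : R -> R) a T : (forall x, continuous k x) -> (forall x, k (x + T) = k x) ->
  RInt k a (a + T) = RInt k 0 T.
Proof.
move=> Hk Hp.
have E b c : ex_RInt k b c by apply: ex_RInt_continuous => z _; exact: Hk.
have C b c d : RInt k b c + RInt k c d = RInt k b d by exact: (RInt_Chasles (V := R_CompleteNormedModule)).
have S : RInt k T (a + T) = RInt k 0 a.
  have := RInt_comp_lin (V := R_CompleteNormedModule) k 1 T 0 a (E _ _).
  rewrite Rmult_0_r Rplus_0_l Rmult_1_l => <-. apply: (RInt_ext (V := R_CompleteNormedModule)) => x _.
  by rewrite Rmult_1_l Hp /scal /= /mult /= Rmult_1_l.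
have := C a 0 (a + T). have := C 0 T (a + T). have := C a 0 a. rewrite RInt_point /zero /= => H1 H2 H3. lra.
Qed.

Lemma RInt_translate (k : R -> R) a b c : (forall x, continuous k x) ->
  RInt (fun y => k (c + y)) a b = RInt k (c + a) (c + b).
Proof.
move=> Hk. have := RInt_comp_lin (V := R_CompleteNormedModule) k 1 c a b.
rewrite !Rmult_1_l !(Rplus_comm _ c) => <-; last by apply: ex_RInt_continuous => z _; exact: Hk.
apply: (RInt_ext (V := R_CompleteNormedModule)) => x _.
by rewrite Rmult_1_l (Rplus_comm x) /scal /= /mult /= Rmult_1_l.
Qed.

Lemma mean_period a f : (forall x, ccontinuous f x) -> periodic f -> mean a f = mean 0 f.
Proof.
move=> Hf Hp. rewrite /mean.
have [-> _] := CInt_pair f a _ (period_le a) (fun x _ => Hf x).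
have [-> _] := CInt_pair f 0 _ (period_le 0) (fun x _ => Hf x).
rewrite Rplus_0_l. f_equal. f_equal; apply: RInt_period => x; rewrite ?Hp //; [exact: (proj1 (Hf x)) | exact: (proj2 (Hf x))].
Qed.

Lemma ccontinuous_translate f c : (forall x, ccontinuous f x) -> forall x, ccontinuous (fun y => f (c + y)) x.
Proof.
have H (k : R -> R) x : (forall x, continuous k x) -> continuous (fun y => k (c + y)) x.
  move=> Hk. apply: (continuous_comp (fun y => c + y) k); last exact: Hk.
  apply: rcont_plus; [exact: continuous_const | exact: continuous_id].
move=> Hf x. split; [apply: (H (fun y => Re (f y))) => y; exact: (proj1 (Hf y)) | apply: (H (fun y => Im (f y))) => y; exact: (proj2 (Hf y))].
Qed.

Lemma mean_translate a c f : (forall x, ccontinuous f x) -> mean a (fun y => f (c + y)) = mean (c + a) f.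
Proof.
move=> Hf. rewrite /mean.
have [-> _] := CInt_pair f (c + a) _ (period_le _) (fun x _ => Hf x).
have [-> _] := CInt_pair (fun y => f (c + y)) a _ (period_le _) (fun x _ => ccontinuous_translate f c Hf x).
rewrite (RInt_translate (fun y => Re (f y))) ?(RInt_translate (fun y => Im (f y))) ?Rplus_assoc //.
- move=> x. exact: (proj2 (Hf x)).
- move=> x. exact: (proj1 (Hf x)).
Qed.

Lemma periodic_mul f g : periodic f -> periodic g -> periodic (fun x => f x * g x)%C.
Proof. move=> Hf Hg x. by rewrite Hf Hg. Qed.

Lemma periodic_cis n : periodic (fun x => cis (- (IZR n * x))).
Proof.
move=> x. rewrite (_ : - (IZR n * (x + 2 * PI)) = - (IZR n * x) + IZR (- n) * (2 * PI)); last by rewrite opp_IZR; ring.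
rewrite cis_add cis_period. ring.
Qed.

Theorem fourier_inversion w x0 d : (forall x, ccontinuous w x) -> periodic w -> cderiv w x0 d -> forall eps, 0 < eps ->
  exists N0, forall N, (N0 <= N)%nat -> Cmod (trig_poly N (coef 0 w) x0 - w x0)%C <= eps.
Proof.
move=> Hc Hp Hd eps Heps.
pose v y := w (x0 + y).
have Cv := ccontinuous_translate w x0 Hc.
have Dv : cderiv v 0 d.
  have H (k : R -> R) l : is_derive k x0 l -> is_derive (fun y => k (x0 + y)) 0 l.
    move=> Hk. apply: rderiv_eq. apply: (is_derive_comp k (fun y => x0 + y)).
      rewrite Rplus_0_r. exact: Hk.
      apply: rderiv_plus; [exact: rderiv_const | exact: rderiv_id].
    rewrite /scal /= /mult /= /zero /one /=. ring.
  split; [exact: (H _ _ (proj1 Hd)) | exact: (H _ _ (proj2 Hd))].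
have [N0 HN0] := fourier_inversion_at_0 v d Cv Dv eps Heps.
exists N0 => N HN. have := HN0 N HN. rewrite /v Rplus_0_r.
have -> : trig_poly N (coef 0 w) x0 = SC N (coef (- PI) (fun y => w (x0 + y))); last by [].
apply: symsum_ext => n. rewrite /coef.
pose k x := (w x * cis (- (IZR n * x)))%C.
have Ck x : ccontinuous k x by apply: ccontinuous_mult => //; exact: ccontinuous_cis_neg.
rewrite (mean_ext _ (fun x => w (x0 + x)%R * cis (- (IZR n * x)))%C (fun x => cis (IZR n * x0) * k (x0 + x)%R)%C).
  rewrite mean_scal; last by move=> x _; exact: ccontinuous_translate.
  rewrite mean_translate // mean_period //; last by apply: periodic_mul => //; exact: periodic_cis. exact: Cmult_comm.
move=> x. rewrite /k. transitivity (w (x0 + x)%R * (cis (IZR n * x0) * cis (- (IZR n * (x0 + x)%R))))%C; last ring.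
rewrite cis_cis. do 2 f_equal. ring.
Qed.

(** * Jointly smooth functions *)

Definition smooth_real2 (g : R -> R -> R) : Prop := forall k, of_class k g.

Lemma smooth_real2_continuous g t x : smooth_real2 g -> continuity_2d_pt g t x.
Proof. move=> H. exact: (proj1 (H 0%nat)). Qed.

Lemma smooth_real2_ex_t g t x : smooth_real2 g -> ex_derive (fun t' => g t' x) t.
Proof. move=> H. have [_ [H1 _]] := H 1%nat. exact: H1. Qed.

Lemma smooth_real2_ex_x g t x : smooth_real2 g -> ex_derive (fun x' => g t x') x.
Proof. move=> H. have [_ [_ [H1 _]]] := H 1%nat. exact: H1. Qed.

Lemma smooth_real2_dt g : smooth_real2 g -> smooth_real2 (fun t x => Derive (fun t' => g t' x) t).
Proof. move=> H k. have [_ [_ [_ [H1 _]]]] := H (S k). exact: H1. Qed.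

Lemma smooth_real2_dx g : smooth_real2 g -> smooth_real2 (fun t x => Derive (fun x' => g t x') x).
Proof. move=> H k. have [_ [_ [_ [_ H1]]]] := H (S k). exact: H1. Qed.

Lemma smooth_real2_dxn g j : smooth_real2 g -> smooth_real2 (fun t x => Derive_n (fun x' => g t x') j x).
Proof.
move=> H. elim: j => [|j IH]; first exact: H. exact: (smooth_real2_dx _ IH).
Qed.

(** Uniform continuity bounds the variation along a segment by the number of steps of length [del]. *)
Lemma continuity_2d_bounded g a b c d : a <= b -> c <= d -> (forall t x, continuity_2d_pt g t x) ->
  exists M, forall t x, a <= t <= b -> c <= x <= d -> Rabs (g t x) <= M.
Proof.
move=> Hab Hcd H.
have [del Hdel] := uniform_continuity_2d g a b c d (fun t x _ _ => H t x) (mkposreal 1 Rlt_0_1).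
have [N HN] := INR_unbounded ((b - a + (d - c)) / del).
have Hd := cond_pos del.
have HN0 : 0 < INR N by apply: Rle_lt_trans HN; apply: Rdiv_le_0_compat; lra.
exists (Rabs (g a c) + INR N) => t x Ht Hx.
have key k : (k <= N)%nat -> Rabs (g (a + (t - a) * (INR k / INR N)) (c + (x - c) * (INR k / INR N))) <= Rabs (g a c) + INR k.
  elim: k => [|k IH] Hk.
    rewrite /= /Rdiv Rmult_0_l !Rmult_0_r !Rplus_0_r. lra.
  have {}IH := IH ltac:(lia).
  have P0 : 0 <= INR k / INR N <= 1.
    split; first by apply: Rdiv_le_0_compat => //; exact: pos_INR.
    apply: (Rmult_le_reg_r (INR N)) => //. rewrite /Rdiv Rmult_assoc Rinv_l; last lra.
    rewrite Rmult_1_r Rmult_1_l. apply: le_INR. lia.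
  have P1 : 0 <= INR (S k) / INR N <= 1.
    split; first by apply: Rdiv_le_0_compat => //; exact: pos_INR.
    apply: (Rmult_le_reg_r (INR N)) => //. rewrite /Rdiv Rmult_assoc Rinv_l; last lra.
    rewrite Rmult_1_r Rmult_1_l. apply: le_INR. lia.
  have Ed : INR (S k) / INR N = INR k / INR N + / INR N by rewrite S_INR; field; lra.
  have Hsm : (b - a + (d - c)) * / INR N < del.
    apply: (Rmult_lt_reg_r (INR N)) => //. rewrite Rmult_assoc Rinv_l; last lra.
    apply: (Rmult_lt_reg_r (/ del)); first exact: Rinv_0_lt_compat.
    rewrite Rmult_1_r (Rmult_comm del) Rmult_assoc Rinv_r; last lra. rewrite Rmult_1_r. exact: HN.
  have IN : 0 < / INR N by exact: Rinv_0_lt_compat.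
  have T0 p q y r : 0 <= r <= 1 -> p <= y <= q -> p <= p + (y - p) * r <= q by move=> Hr Hy; nra.
  have := Hdel (a + (t - a) * (INR k / INR N)) (c + (x - c) * (INR k / INR N))
     (a + (t - a) * (INR (S k) / INR N)) (c + (x - c) * (INR (S k) / INR N))
     (T0 _ _ _ _ P0 Ht) (T0 _ _ _ _ P0 Hx) (T0 _ _ _ _ P1 Ht) (T0 _ _ _ _ P1 Hx).
  rewrite Ed.
  have -> : a + (t - a) * (INR k / INR N + / INR N) - (a + (t - a) * (INR k / INR N)) = (t - a) * / INR N by ring.
  have -> : c + (x - c) * (INR k / INR N + / INR N) - (c + (x - c) * (INR k / INR N)) = (x - c) * / INR N by ring.
  have T y : 0 <= y <= b - a + (d - c) -> Rabs (y * / INR N) < del.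
    move=> Hy. rewrite Rabs_pos_eq; last by apply: Rmult_le_pos; lra.
    apply: Rle_lt_trans Hsm. apply: Rmult_le_compat_r; lra.
  move=> Hl. have {}Hl := Hl (T (t - a) ltac:(lra)) (T (x - c) ltac:(lra)). rewrite /= in Hl.
  rewrite -Ed in Hl *. rewrite S_INR.
  have := Rabs_triang_inv (g (a + (t - a) * (INR (S k) / INR N)) (c + (x - c) * (INR (S k) / INR N)))
    (g (a + (t - a) * (INR k / INR N)) (c + (x - c) * (INR k / INR N))).
  rewrite S_INR in Hl *. lra.
have := key N (le_n N). rewrite /Rdiv Rinv_r; last lra. rewrite !Rmult_1_r.
by rewrite (_ : a + (t - a) = t) 1?(_ : c + (x - c) = x); try ring.
Qed.

Lemma continuity_2d_slice g t x : continuity_2d_pt g t x -> continuous (g t) x.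
Proof.
move=> H. apply/continuity_pt_filterlim => eps Heps. have [del Hdel] := H (mkposreal _ Heps).
exists del. split; first exact: cond_pos. move=> y [_ Hy]. apply: Hdel => //.
rewrite Rminus_eq_0 Rabs_R0. exact: cond_pos.
Qed.

Lemma is_derive_RInt_2d (h ht : R -> R -> R) a b t :
  (forall t x, is_derive (fun t' => h t' x) t (ht t x)) -> (forall t x, continuity_2d_pt ht t x) ->
  (forall t x, continuous (h t) x) ->
  is_derive (fun t' => RInt (h t') a b) t (RInt (ht t) a b).
Proof.
move=> Hd Hc Hx.
have E u x : Derive (fun z => h z x) u = ht u x by exact: is_derive_unique.
have := is_derive_RInt_param h a b t.
rewrite (RInt_ext (V := R_CompleteNormedModule) (fun x => Derive (fun u => h u x) t) (ht t)) => [|x _]; last exact: E.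
apply.
- apply: filter_forall => u x _. eexists. exact: Hd.
- move=> x _. apply: (continuity_2d_pt_ext ht); last exact: Hc. move=> u y. symmetry. exact: E.
- apply: filter_forall => u. apply: ex_RInt_continuous => x _. exact: Hx.
Qed.

Definition continuous2 (w : R -> R -> C) : Prop :=
  (forall t x, continuity_2d_pt (fun t x => Re (w t x)) t x) /\ (forall t x, continuity_2d_pt (fun t x => Im (w t x)) t x).

Lemma continuous2_slice w t x : continuous2 w -> ccontinuous (w t) x.
Proof. move=> [H1 H2]. split; [exact: (continuity_2d_slice _ t x (H1 t x)) | exact: (continuity_2d_slice _ t x (H2 t x))]. Qed.

Lemma continuous2_mult_x w (e : R -> C) : continuous2 w -> (forall x, ccontinuous e x) -> continuous2 (fun t x => w t x * e x)%C.
Proof.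
move=> [H1 H2] He.
have E1 t x : continuity_2d_pt (fun _ x => Re (e x)) t x.
  apply: (continuity_1d_2d_pt_comp (fun x => Re (e x)) (fun _ x => x)); last exact: continuity_2d_pt_id2.
  apply/continuity_pt_filterlim. exact: (proj1 (He x)).
have E2 t x : continuity_2d_pt (fun _ x => Im (e x)) t x.
  apply: (continuity_1d_2d_pt_comp (fun x => Im (e x)) (fun _ x => x)); last exact: continuity_2d_pt_id2.
  apply/continuity_pt_filterlim. exact: (proj2 (He x)).
split=> t x.
  exact: (continuity_2d_pt_minus _ _ _ _ (continuity_2d_pt_mult _ _ _ _ (H1 t x) (E1 t x)) (continuity_2d_pt_mult _ _ _ _ (H2 t x) (E2 t x))).
exact: (continuity_2d_pt_plus _ _ _ _ (continuity_2d_pt_mult _ _ _ _ (H1 t x) (E2 t x)) (continuity_2d_pt_mult _ _ _ _ (H2 t x) (E1 t x))).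
Qed.

Lemma cderiv_mean a w wt' t : (forall t x, cderiv (fun t' => w t' x) t (wt' t x)) -> continuous2 w -> continuous2 wt' ->
  cderiv (fun t' => mean a (w t')) t (mean a (wt' t)).
Proof.
move=> Hd Hw Hwt. rewrite /mean. apply: cderiv_scal.
have E f : continuous2 f -> forall s, CInt (f s) a (a + 2 * PI) = (RInt (fun x => Re (f s x)) a (a + 2 * PI), RInt (fun x => Im (f s x)) a (a + 2 * PI)).
  move=> Hf s. exact: (proj1 (CInt_pair (f s) a _ (period_le a) (fun x _ => continuous2_slice f s x Hf))).
apply: (cderiv_ext (fun t' => (RInt (fun x => Re (w t' x)) a (a + 2 * PI), RInt (fun x => Im (w t' x)) a (a + 2 * PI)))).
  by move=> s; rewrite E.
rewrite E //. split; rewrite /Re /Im /=.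
  apply: (is_derive_RInt_2d (fun t x => Re (w t x)) (fun t x => Re (wt' t x))).
  - move=> s x. exact: (proj1 (Hd s x)).
  - exact: (proj1 Hwt).
  - move=> s x. exact: (proj1 (continuous2_slice w s x Hw)).
apply: (is_derive_RInt_2d (fun t x => Im (w t x)) (fun t x => Im (wt' t x))).
- move=> s x. exact: (proj2 (Hd s x)).
- exact: (proj2 Hwt).
- move=> s x. exact: (proj2 (continuous2_slice w s x Hw)).
Qed.

Lemma smooth2_parts v : smooth2 v -> smooth_real2 (fun t x => Re (v t x)) /\ smooth_real2 (fun t x => Im (v t x)).
Proof. move=> H. split=> k; [exact: (proj1 (H k)) | exact: (proj2 (H k))]. Qed.

Lemma smooth2_dxn_cderiv v j t x : smooth2 v -> cderiv (CDerive_n (v t) j) x (CDerive_n (v t) (S j) x).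
Proof.
move=> /smooth2_parts [H1 H2]. split; apply: Derive_correct.
  exact: (smooth_real2_ex_x _ t x (smooth_real2_dxn _ j H1)).
exact: (smooth_real2_ex_x _ t x (smooth_real2_dxn _ j H2)).
Qed.

Lemma CDerive_n_0 f x : CDerive_n f 0 x = f x.
Proof. rewrite /CDerive_n /=. by case: (f x). Qed.

Lemma smooth2_cderiv_x v t x : smooth2 v -> cderiv (v t) x (CDerive (v t) x).
Proof.
move=> H. apply: cderiv_ext (smooth2_dxn_cderiv v 0 t x H). exact: CDerive_n_0.
Qed.

Lemma smooth2_cderiv_t v t x : smooth2 v -> cderiv (fun t' => v t' x) t (dt v t x).
Proof.
move=> /smooth2_parts [H1 H2]. split; apply: Derive_correct.
  exact: (smooth_real2_ex_t _ t x H1).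
exact: (smooth_real2_ex_t _ t x H2).
Qed.

Lemma smooth2_continuous2_dxn v j : smooth2 v -> continuous2 (fun t x => CDerive_n (v t) j x).
Proof.
move=> /smooth2_parts [H1 H2]. split=> t x; apply: smooth_real2_continuous.
  exact: smooth_real2_dxn _ j H1.
exact: smooth_real2_dxn _ j H2.
Qed.

Lemma smooth2_continuous2 v : smooth2 v -> continuous2 v.
Proof. move=> /smooth2_parts [H1 H2]. split=> t x; exact: smooth_real2_continuous. Qed.

Lemma smooth2_continuous2_dt v : smooth2 v -> continuous2 (dt v).
Proof.
move=> /smooth2_parts [H1 H2]. split=> t x; apply: smooth_real2_continuous.
  exact: smooth_real2_dt _ H1.
exact: smooth_real2_dt _ H2.
Qed.

Lemma continuous2_bounded w a b c d : a <= b -> c <= d -> continuous2 w ->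
  exists M, forall t x, a <= t <= b -> c <= x <= d -> Cmod (w t x) <= M.
Proof.
move=> Hab Hcd [H1 H2].
have [M1 HM1] := continuity_2d_bounded _ a b c d Hab Hcd H1.
have [M2 HM2] := continuity_2d_bounded _ a b c d Hab Hcd H2.
exists (M1 + M2) => t x Ht Hx. apply: Rle_trans (Cmod_le_parts _) _.
have := HM1 t x Ht Hx. have := HM2 t x Ht Hx. lra.
Qed.

Lemma cderiv_unique f x a b : cderiv f x a -> cderiv f x b -> a = b.
Proof.
move=> [H1 H2] [H3 H4]. apply: injective_projections.
  rewrite -[LHS](is_derive_unique _ _ _ H1). exact: is_derive_unique _ _ _ H3.
rewrite -[LHS](is_derive_unique _ _ _ H2). exact: is_derive_unique _ _ _ H4.
Qed.

Lemma cderiv_periodic f f' : (forall x, cderiv f x (f' x)) -> periodic f -> periodic f'.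
Proof.
move=> H Hp x.
have D : cderiv (fun y => f (y + 2 * PI)) x (f' (x + 2 * PI)).
  have K (k : R -> R) l : is_derive k (x + 2 * PI) l -> is_derive (fun y => k (y + 2 * PI)) x l.
    move=> Hk. apply: rderiv_eq. apply: (is_derive_comp k (fun y => y + 2 * PI)); first exact: Hk.
      apply: rderiv_plus; [exact: rderiv_id | exact: rderiv_const].
    rewrite /scal /= /mult /= /zero /one /=. ring.
  split; [exact: (K _ _ (proj1 (H _))) | exact: (K _ _ (proj2 (H _)))].
apply: (cderiv_unique f x); last exact: H. apply: cderiv_ext D. exact: Hp.
Qed.

Lemma smooth2_dxn_periodic v j t : smooth2 v -> periodic (v t) -> periodic (CDerive_n (v t) j).
Proof.
move=> H Hp. elim: j => [|j IH].
  move=> x. by rewrite !CDerive_n_0.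
apply: (cderiv_periodic (CDerive_n (v t) j)) => // x. exact: smooth2_dxn_cderiv.
Qed.

Lemma smooth2_coef_dxn v j t n : smooth2 v -> periodic (v t) ->
  coef 0 (CDerive_n (v t) j) n = ((Ci * RtoC (IZR n)) ^ j * coef 0 (v t) n)%C.
Proof.
move=> H Hp. elim: j => [|j IH].
  rewrite /= Cmult_1_l. apply: mean_ext => x. by rewrite CDerive_n_0.
rewrite (coef_derive 0 (CDerive_n (v t) j)).
- rewrite IH /=. ring.
- move=> x. exact: smooth2_dxn_cderiv.
- move=> x. exact: (continuous2_slice _ t x (smooth2_continuous2_dxn v (S j) H)).
- exact: smooth2_dxn_periodic.
Qed.

(** Four integrations by parts; the fourth power leaves summable weights after one derivative and a rate in [K]. *)
Lemma smooth2_coef_decay v : smooth2 v -> (forall t, periodic (v t)) -> exists B, 0 <= B /\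
  forall t n, 0 <= t <= 1 -> Cmod (coef 0 (v t) n) <= B * wt (- (4)) n.
Proof.
move=> H Hp. have HP := PI_RGT_0.
have [M0 HM0] := continuous2_bounded v 0 1 0 (0 + 2 * PI) ltac:(lra) ltac:(lra) (smooth2_continuous2 v H).
have [M4 HM4] := continuous2_bounded _ 0 1 0 (0 + 2 * PI) ltac:(lra) ltac:(lra) (smooth2_continuous2_dxn v 4 H).
have cb f t n M : continuous2 f -> (forall x, 0 <= x <= 0 + 2 * PI -> Cmod (f t x) <= M) -> Cmod (coef 0 (f t) n) <= 2 * M.
  move=> Hf HM. apply: mean_bound.
    apply: coef_continuous => x _. exact: continuous2_slice.
  move=> x Hx. rewrite Cmod_mult Cmod_cis Rmult_1_r. exact: HM.
have M0p : 0 <= M0 by apply: Rle_trans (Cmod_ge_0 _) (HM0 0 0 _ _); lra.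
have M4p : 0 <= M4 by apply: Rle_trans (Cmod_ge_0 _) (HM4 0 0 _ _); lra.
exists (16 * (2 * M0 + 2 * M4)). split; first lra. move=> t n Ht.
have B0 := cb v t n M0 (smooth2_continuous2 v H) (fun x Hx => HM0 t x Ht Hx).
have B4 := cb _ t n M4 (smooth2_continuous2_dxn v 4 H) (fun x Hx => HM4 t x Ht Hx).
rewrite (smooth2_coef_dxn v 4 t n H (Hp t)) Cmod_mult in B4.
have E : Cmod ((Ci * RtoC (IZR n)) ^ 4)%C = Rabs (IZR n) ^ 4.
  rewrite !Cmod_mult /= Cmod_1 Cmod_R. rewrite Cmod_Ci. ring.
rewrite E in B4.
have W : wt (- (4)) n * jap n ^ 4 = 1.
  rewrite -(wt_opp n 4). f_equal. have := Rpower_pow 4 (jap n) ltac:(have := jap_ge1 n; lra).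
  rewrite /wt. move=> <-. f_equal. rewrite /=. ring.
have J : jap n ^ 4 <= 16 * (1 + Rabs (IZR n) ^ 4).
  rewrite /jap. set r := Rabs (IZR n). have r0 : 0 <= r by exact: Rabs_pos.
  have : 0 <= (r - 1) ^ 2 * (r ^ 2 + 1) by apply: Rmult_le_pos; [exact: pow2_ge_0 | nra].
  have : 0 <= (r ^ 2 - 1) ^ 2 by exact: pow2_ge_0. have : 0 <= (r - 1) ^ 2 by exact: pow2_ge_0. 
  simpl. nra.
have Wp := wt_pos (- (4)) n. have c0 := Cmod_ge_0 (coef 0 (v t) n).
have F : Cmod (coef 0 (v t) n) * jap n ^ 4 <= 16 * (2 * M0 + 2 * M4).
  apply: Rle_trans (Rmult_le_compat_l _ _ _ c0 J) _. lra.
have := Rmult_le_compat_r _ _ _ (Rlt_le _ _ Wp) F. nra.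
Qed.

Lemma smooth2_coef_cderiv v n t : smooth2 v -> cderiv (fun t' => coef 0 (v t') n) t (coef 0 (dt v t) n).
Proof.
move=> H. have He x := ccontinuous_cis_neg n x.
apply: (cderiv_mean 0 (fun t x => v t x * cis (- (IZR n * x)))%C (fun t x => dt v t x * cis (- (IZR n * x)))%C).
- move=> s x. apply: cderiv_scal_r. exact: smooth2_cderiv_t.
- apply: continuous2_mult_x => //. exact: smooth2_continuous2.
- apply: continuous2_mult_x => //. exact: smooth2_continuous2_dt.
Qed.

(** * Conservation of momentum *)

Lemma smooth_real2_swap g t x : smooth_real2 g ->
  Derive (fun t' => Derive (fun x' => g t' x') x) t = Derive (fun x' => Derive (fun t' => g t' x') t) x.
Proof.
move=> H. apply: Schwarz.
- exists (mkposreal 1 Rlt_0_1) => u v _ _. split; [exact: smooth_real2_ex_t | split; [exact: smooth_real2_ex_x | split]].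
    exact: (smooth_real2_ex_t _ _ _ (smooth_real2_dx _ H)).
  exact: (smooth_real2_ex_x _ _ _ (smooth_real2_dt _ H)).
- exact: (smooth_real2_continuous _ _ _ (smooth_real2_dt _ (smooth_real2_dx _ H))).
- exact: (smooth_real2_continuous _ _ _ (smooth_real2_dx _ (smooth_real2_dt _ H))).
Qed.

(** With [v = f + i g] the density is [h = f * g_x - g * f_x].  By the equation its time derivative is the space
    derivative of [H = f * g_t - g * f_t + 2 * (f_x * g_xx - f_xx * g_x)]: the nonlinearity is a real multiple of
    [v_x] and drops out. *)
Lemma momentum_derive sigma v t : smooth_global_solution sigma v -> is_derive (fun t' => momentum (v t')) t 0.
Proof.
move=> [Hs [Hp Heq]]. have [Hf Hg] := smooth2_parts v Hs.
pose f t x := Re (v t x). pose g t x := Im (v t x).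
pose dx (k : R -> R -> R) t x := Derive (fun x' => k t x') x.
pose dtt (k : R -> R -> R) t x := Derive (fun t' => k t' x) t.
rewrite -/f in Hf. rewrite -/g in Hg.
pose h t x := f t x * dx g t x - g t x * dx f t x.
pose ht t x := (dtt f t x * dx g t x + f t x * dtt (dx g) t x) - (dtt g t x * dx f t x + g t x * dtt (dx f) t x).
pose H t x := (f t x * dtt g t x - g t x * dtt f t x) + 2 * (dx f t x * dx (dx g) t x - dx (dx f) t x * dx g t x).
have Dt k s x : smooth_real2 k -> is_derive (fun t' => k t' x) s (dtt k s x).
  move=> Hk. apply: Derive_correct. exact: smooth_real2_ex_t.
have Dx k s x : smooth_real2 k -> is_derive (k s) x (dx k s x).
  move=> Hk. apply: Derive_correct. exact: smooth_real2_ex_x.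
have Hfx := smooth_real2_dx _ Hf. have Hgx := smooth_real2_dx _ Hg.
have Hft := smooth_real2_dt _ Hf. have Hgt := smooth_real2_dt _ Hg.
have Hfxx := smooth_real2_dx _ Hfx. have Hgxx := smooth_real2_dx _ Hgx.
rewrite -/(dx f) in Hfx Hfxx. rewrite -/(dx g) in Hgx Hgxx. rewrite -/(dtt f) in Hft. rewrite -/(dtt g) in Hgt.
rewrite -/(dx (dx f)) in Hfxx. rewrite -/(dx (dx g)) in Hgxx.
have c2 k : smooth_real2 k -> forall t x, continuity_2d_pt k t x by move=> Hk s x; exact: smooth_real2_continuous.
have Hh s x : is_derive (fun t' => h t' x) s (ht s x).
  apply: rderiv_minus; apply: rderiv_mult; exact: Dt.
have Hhx s x : is_derive (H s) x (ht s x).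
  apply: rderiv_eq.
    apply: rderiv_plus.
      apply: rderiv_minus; apply: rderiv_mult; exact: Dx.
    apply: rderiv_mult; first exact: rderiv_const.
    apply: rderiv_minus; apply: rderiv_mult; exact: Dx.
  have := Heq s x. move=> E.
  have E1 : dtt f s x + dx (dx (dx f)) s x = sigma * ((Cmod (v s x) ^ 2 - mass (v s)) * dx f s x).
    apply: eq_trans (f_equal Re E) _. rewrite /nonlin /dx /f /CDerive /CDerive_n /Re /Im /Cmult /RtoC /=. ring.
  have E2 : dtt g s x + dx (dx (dx g)) s x = sigma * ((Cmod (v s x) ^ 2 - mass (v s)) * dx g s x).
    apply: eq_trans (f_equal Im E) _. rewrite /nonlin /dx /g /CDerive /CDerive_n /Re /Im /Cmult /RtoC /=. ring.
  have S1 : dtt (dx f) s x = dx (dtt f) s x by exact: smooth_real2_swap.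
  have S2 : dtt (dx g) s x = dx (dtt g) s x by exact: smooth_real2_swap.
  rewrite /ht S1 S2 /zero /=.
  have F1 := f_equal (fun r => r * dx g s x) E1. have F2 := f_equal (fun r => r * dx f s x) E2. cbv beta in F1, F2. lra.
have Eh s : momentum (v s) = / (2 * PI) * RInt (h s) 0 (2 * PI).
  rewrite /momentum. f_equal. apply: (RInt_ext (V := R_CompleteNormedModule)) => x _.
  rewrite /h /f /g /dx /Cconj /CDerive /CDerive_n /Cmult /Re /Im /=. ring.
apply: (is_derive_ext (fun s => / (2 * PI) * RInt (h s) 0 (2 * PI))); first by move=> s; rewrite Eh.
apply: rderiv_eq.
  apply: rderiv_mult; first exact: rderiv_const.
  apply: (is_derive_RInt_2d h ht) => // s x.
    by apply: continuity_2d_pt_minus; apply: continuity_2d_pt_plus; apply: continuity_2d_pt_mult; apply: c2 => //;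
      apply: smooth_real2_dt.
  apply: rcont_minus; apply: rcont_mult; apply: continuity_2d_slice; exact: c2.
have HP := PI_RGT_0.
have -> : RInt (ht t) 0 (2 * PI) = H t (2 * PI) - H t 0.
  apply: is_RInt_unique. apply: (is_RInt_derive (V := R_CompleteNormedModule) (H t)) => x _; first exact: Hhx.
  apply: rcont_minus; apply: rcont_plus; apply: rcont_mult; apply: continuity_2d_slice; apply: c2 => //; exact: smooth_real2_dt.
have P0 : v t (2 * PI) = v t 0 by rewrite -{1}(Rplus_0_l (2 * PI)); exact: Hp.
have P1 : CDerive_n (v t) 1 (2 * PI) = CDerive_n (v t) 1 0.
  rewrite -{1}(Rplus_0_l (2 * PI)). exact: smooth2_dxn_periodic.
have P2 : CDerive_n (v t) 2 (2 * PI) = CDerive_n (v t) 2 0.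
  rewrite -{1}(Rplus_0_l (2 * PI)). exact: smooth2_dxn_periodic.
have P3 : dt v t (2 * PI) = dt v t 0.
  have Q s : v s (2 * PI) = v s 0 by rewrite -{1}(Rplus_0_l (2 * PI)); exact: Hp.
  rewrite /dt /CDerive /CDerive_n. f_equal; apply: Derive_n_ext => s; by rewrite Q.
have -> : H t (2 * PI) = H t 0.
  have E1 : f t (2 * PI) = f t 0 by rewrite /f P0. have E2 : g t (2 * PI) = g t 0 by rewrite /g P0.
  have E3 : dx f t (2 * PI) = dx f t 0 by exact: (f_equal fst P1).
  have E4 : dx g t (2 * PI) = dx g t 0 by exact: (f_equal snd P1).
  have E5 : dx (dx f) t (2 * PI) = dx (dx f) t 0 by exact: (f_equal fst P2).
  have E6 : dx (dx g) t (2 * PI) = dx (dx g) t 0 by exact: (f_equal snd P2).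
  have E7 : dtt f t (2 * PI) = dtt f t 0 by exact: (f_equal fst P3).
  have E8 : dtt g t (2 * PI) = dtt g t 0 by exact: (f_equal snd P3).
  by rewrite /H E1 E2 E3 E4 E5 E6 E7 E8.
rewrite /zero /=. ring.
Qed.

Theorem momentum_conserved sigma v t : smooth_global_solution sigma v -> 0 <= t -> momentum (v t) = momentum (v 0).
Proof.
move=> Hv Ht.
have := mean_value_bound (fun t => momentum (v t)) (fun _ => 0) 0 t 0 Ht (fun s _ => momentum_derive sigma v s Hv)
  ltac:(move=> s _; rewrite Rabs_R0; lra).
rewrite Rmult_0_l => H. have := Rabs_pos (momentum (v t) - momentum (v 0)). move=> H'.
have H0 : Rabs (momentum (v t) - momentum (v 0)) = 0 by lra.
have := Rabs_eq_0 _ H0. lra.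
Qed.

(** * The nonlinearity in Fourier variables *)

Definition cutoff (K : nat) (c : Z -> C) (n : Z) : C := if Z_le_dec (Z.abs n) (Z.of_nat K) then c n else RtoC 0.

Definition derivative_coefs (c : Z -> C) (n : Z) : C := (Ci * RtoC (IZR n) * c n)%C.

Definition mass_coefs (K : nat) (c : Z -> C) : R := SZ K (fun m => Cmod (c m) ^ 2).

Definition momentum_coefs (K : nat) (c : Z -> C) : R := SZ K (fun m => IZR m * Cmod (c m) ^ 2).

Lemma cutoff_in K c n : (Z.abs n <= Z.of_nat K)%Z -> cutoff K c n = c n.
Proof. rewrite /cutoff. by case: Z_le_dec. Qed.

Lemma RtoC_SZ K f : RtoC (SZ K f) = SC K (fun n => RtoC (f n)).
Proof.
apply: injective_projections; rewrite -?[fst _]/(Re _) -?[snd _]/(Im _).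
  by rewrite Re_symsum.
rewrite Im_symsum. transitivity (0 * SZ K (fun _ => 0)); first by rewrite /=; ring.
rewrite -SZ_scal. apply: symsum_ext => n. rewrite /=. rring.
Qed.

(** Products of exponentials are integrated exactly: integration in [x] of the factor [conj S] picks the
    coefficient at [x + y - n]. *)
Lemma galerkin_coef K c n : (Z.abs n <= Z.of_nat K)%Z ->
  coef 0 (fun x => RtoC (Cmod (trig_poly K c x) ^ 2 - mass_coefs K c)%R * trig_poly K (derivative_coefs c) x)%C n
  = (SC K (fun x => SC K (fun y => c x * Cconj (cutoff K c (x + y - n)) * derivative_coefs c y))
     - RtoC (mass_coefs K c) * derivative_coefs c n)%C.
Proof.
move=> Hn. set S := trig_poly K c. set S1 := trig_poly K (derivative_coefs c). set mu := mass_coefs K c.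
have cS x : ccontinuous S x by exact: ccontinuous_trig_poly.
have cS1 x : ccontinuous S1 x by exact: ccontinuous_trig_poly.
have ce m x := ccontinuous_cis_neg m x.
rewrite /coef (mean_ext 0 _ (fun x => S x * S1 x * (Cconj (S x) * cis (- (IZR n * x))) + - RtoC mu * (S1 x * cis (- (IZR n * x))))%C); last first.
  move=> x. rewrite RtoC_minus -Cmult_conj_self. ring.
have c3 x : ccontinuous (fun x => Cconj (S x) * cis (- (IZR n * x)))%C x.
  apply: ccontinuous_mult; last exact: ce. exact: ccontinuous_conj.
rewrite mean_plus; last 2 first.
- move=> x _. apply: ccontinuous_mult; last exact: c3. exact: ccontinuous_mult.
- move=> x _. apply: ccontinuous_mult; first exact: ccontinuous_const. exact: ccontinuous_mult.
rewrite mean_scal; last by move=> x _; exact: ccontinuous_mult.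
rewrite -/(coef 0 S1 n) coef_trig_poly. case: Z_le_dec => // _.
rewrite (_ : forall u, (u + - RtoC mu * derivative_coefs c n = u - RtoC mu * derivative_coefs c n)%C); last by move=> u; ring.
f_equal.
rewrite (mean_ext 0 _ (fun x => SC K (fun j => SC K (fun k => (c j * derivative_coefs c k) * Cconj (S x * cis (- (IZR (j + k - n) * x)))))%C)); last first.
  move=> x. rewrite {1}/S {1}/S1 /trig_poly -!SC_scal_r. apply: symsum_ext => j.
  rewrite -SC_scal -SC_scal_r. apply: symsum_ext => k.
  rewrite Cmult_conj -cis_neg.
  have -> : - - (IZR (j + k - n) * x) = IZR j * x + IZR k * x + - (IZR n * x) by rewrite minus_IZR plus_IZR; ring.
  rewrite !cis_add. cring.
have c4 j k x : ccontinuous (fun x => c j * derivative_coefs c k * Cconj (S x * cis (- (IZR (j + k - n) * x))))%C x.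
  apply: ccontinuous_mult; first exact: ccontinuous_const. apply: ccontinuous_conj. exact: ccontinuous_mult.
rewrite mean_symsum; last by move=> j x _; apply: ccontinuous_symsum => k.
apply: symsum_ext => j. rewrite mean_symsum; last by move=> k x _.
apply: symsum_ext => k. rewrite mean_scal; last by move=> x _; apply: ccontinuous_conj; exact: ccontinuous_mult.
rewrite mean_conj; last by move=> x _; exact: ccontinuous_mult.
rewrite -/(coef 0 S (j + k - n)) coef_trig_poly -/(cutoff K c (j + k - n)). cring.
Qed.

Definition kronecker (m n : Z) : C := if Z.eq_dec m n then RtoC 1 else RtoC 0.

Lemma SC_kronecker K n (f : Z -> C) : (Z.abs n <= Z.of_nat K)%Z -> SC K (fun m => kronecker m n * f m)%C = f n.
Proof.
move=> Hn. rewrite (symsum_delta _ K n) //.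
  rewrite /kronecker. case: Z.eq_dec => [_|H]; [cring | case: H].
  by [].
move=> m Hm. rewrite /kronecker. case: Z.eq_dec => // _. change (RtoC 0 * f m = RtoC 0)%C. ring.
Qed.

(** Extracting the resonances: [y = n] is cancelled by the subtracted mean, [x = n] produces the momentum, and
    what remains is symmetric in [x] and [y], so that [y] may be replaced by [(x + y) / 2]. *)
Lemma resonance_decomposition K c n : (Z.abs n <= Z.of_nat K)%Z ->
  (SC K (fun x => SC K (fun y => c x * Cconj (cutoff K c (x + y - n)) * derivative_coefs c y))
     - RtoC (mass_coefs K c) * derivative_coefs c n)%C
  = (Ci * RtoC (momentum_coefs K c) * c n - Ci * RtoC (IZR n * Cmod (c n) ^ 2)%R * c n
     + SC K (fun x => SC K (fun y => RtoC (symbol n x y) * (Ci / 2) * (c x * Cconj (cutoff K c (x + y - n)) * c y))))%C.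
Proof.
move=> Hn. pose T x y := (c x * Cconj (cutoff K c (x + y - n)) * c y)%C.
have Tsym x y : T x y = T y x by rewrite /T (Z.add_comm x y); ring.
have Nsym x y : nonresonant n x y = nonresonant n y x.
  rewrite /nonresonant. by case: (Z.eq_dec x n); case: (Z.eq_dec y n).
have I x y : (kronecker y n + kronecker x n * (1 - kronecker y n) + RtoC (nonresonant n x y))%C = RtoC 1.
  rewrite /kronecker /nonresonant. case: (Z.eq_dec x n) => _; case: (Z.eq_dec y n) => _; ring.
have -> : SC K (fun x => SC K (fun y => c x * Cconj (cutoff K c (x + y - n)) * derivative_coefs c y)%C)
  = (SC K (fun x => SC K (fun y => kronecker y n * (Ci * RtoC (IZR y) * T x y)))
    + SC K (fun x => kronecker x n * SC K (fun y => (1 - kronecker y n) * (Ci * RtoC (IZR y) * T x y)))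
    + SC K (fun x => SC K (fun y => RtoC (nonresonant n x y) * (Ci * RtoC (IZR y) * T x y))))%C.
  rewrite -!SC_plus. apply: symsum_ext => x. rewrite -SC_scal -!SC_plus. apply: symsum_ext => y.
  rewrite -[LHS]Cmult_1_l -{1}(I x y) /T /derivative_coefs. cring.
have -> : SC K (fun x => SC K (fun y => kronecker y n * (Ci * RtoC (IZR y) * T x y))%C)
   = (RtoC (mass_coefs K c) * derivative_coefs c n)%C.
  rewrite /mass_coefs RtoC_SZ -SC_scal_r. apply: symsum_ext_loc => x Hx. rewrite SC_kronecker // /T.
  rewrite (_ : (x + n - n)%Z = x); last lia. rewrite cutoff_in; last lia. rewrite -Cmult_conj_self /derivative_coefs. cring.
have -> : SC K (fun x => kronecker x n * SC K (fun y => (1 - kronecker y n) * (Ci * RtoC (IZR y) * T x y)))%C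
   = (Ci * RtoC (momentum_coefs K c) * c n - Ci * RtoC (IZR n * Cmod (c n) ^ 2)%R * c n)%C.
  rewrite SC_kronecker //.
  rewrite (symsum_ext _ K _ (fun y => Ci * RtoC (IZR y) * T n y - kronecker y n * (Ci * RtoC (IZR y) * T n y))%C); last by move=> y; cring.
  rewrite SC_minus SC_kronecker //. f_equal.
    rewrite /momentum_coefs RtoC_SZ -SC_scal -SC_scal_r. apply: symsum_ext_loc => y Hy. rewrite /T.
    rewrite (_ : (n + y - n)%Z = y); last lia. rewrite cutoff_in; last lia. rewrite RtoC_mult -Cmult_conj_self. cring.
  rewrite /T (_ : (n + n - n)%Z = n); last lia. rewrite cutoff_in // RtoC_mult -Cmult_conj_self. ring.
have -> : SC K (fun x => SC K (fun y => RtoC (nonresonant n x y) * (Ci * RtoC (IZR y) * T x y))%C)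
   = SC K (fun x => SC K (fun y => RtoC (symbol n x y) * (Ci / 2) * (c x * Cconj (cutoff K c (x + y - n)) * c y))%C).
  set A := SC K _.
  have EA : A = SC K (fun x => SC K (fun y => RtoC (nonresonant n x y) * (Ci * RtoC (IZR x) * T x y))%C).
    rewrite /A symsum_swap. apply: symsum_ext => x. apply: symsum_ext => y. by rewrite Nsym Tsym.
  have half (X : C) : X = (/ 2 * (X + X))%C by field.
  rewrite (half A).
  rewrite {1}EA /A -SC_plus -SC_scal. apply: symsum_ext => x. rewrite -SC_plus -SC_scal. apply: symsum_ext => y.
  rewrite /symbol plus_IZR RtoC_mult RtoC_plus /T. rewrite /Cdiv. cring.
ring.
Qed.

(** * Truncation errors *)

Lemma symsum_vanishing (G : AbelianMonoid) K N (f : Z -> G) : (K <= N)%nat ->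
  (forall n, (Z.of_nat K < Z.abs n)%Z -> f n = zero) -> symsum f N = symsum f K.
Proof.
move=> HKN Hf. elim: N HKN => [|N IH] HKN; first by have -> : K = 0%nat by lia.
case: (Nat.eq_dec K (S N)) => [->|HK] //.
rewrite symsum_S IH; last lia. rewrite !Hf; try lia. by rewrite plus_zero_l plus_zero_r.
Qed.

(** One power of the decay of the coefficients is spent on a rate in [K], two on summability. *)
Lemma series_tail : exists C3, 0 < C3 /\ forall (c : Z -> C) B x L K, 0 <= B ->
  (forall n, Cmod (c n) <= B * wt (- (3)) n) ->
  (forall eps, 0 < eps -> exists N0, forall N, (N0 <= N)%nat -> Cmod (trig_poly N c x - L)%C <= eps) ->
  Cmod (L - trig_poly K c x)%C <= C3 * B * wt (- (1)) (Z.of_nat K).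
Proof.
have [C3 [C30 HC3]] := sum_wt 2 ltac:(lra). exists C3. split=> // c B x L K HB Hc HL.
apply: le_epsilon => eps Heps. have [N0 HN0] := HL eps Heps.
pose N := (N0 + K)%nat. have {}HN0 := HN0 N ltac:(rewrite /N; lia).
have W1 := wt_pos (- (1)) (Z.of_nat K).
have D : Cmod (trig_poly N c x - trig_poly K c x)%C <= C3 * B * wt (- (1)) (Z.of_nat K).
  have -> : trig_poly K c x = trig_poly N (cutoff K c) x.
    rewrite /trig_poly (symsum_vanishing _ K N (fun n => cutoff K c n * cis (IZR n * x))%C).
    - apply: symsum_ext_loc => n Hn. rewrite cutoff_in //. lia.
    - rewrite /N. lia.
    - move=> n Hn. rewrite /cutoff. case: Z_le_dec => H; first lia.
      change (RtoC 0 * cis (IZR n * x) = RtoC 0)%C. ring.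
  rewrite /trig_poly -SC_minus. apply: Rle_trans (Cmod_symsum _ _) _.
  apply: (Rle_trans _ (SZ N (fun n => B * wt (- (1)) (Z.of_nat K) * wt (- (2)) n))).
    apply: SZ_le => n. rewrite /cutoff. case: Z_le_dec => H.
      rewrite (_ : (c n * cis (IZR n * x) - c n * cis (IZR n * x))%C = RtoC 0); last ring.
      rewrite Cmod_0. apply: Rmult_le_pos; last by exact: wt_ge0. apply: Rmult_le_pos; lra.
    rewrite (_ : (c n * cis (IZR n * x) - 0 * cis (IZR n * x))%C = (c n * cis (IZR n * x))%C); last ring.
    rewrite Cmod_mult Cmod_cis Rmult_1_r. apply: Rle_trans (Hc n) _. rewrite Rmult_assoc.
    apply: Rmult_le_compat_l => //.
    have -> : wt (- (3)) n = wt (- (1)) n * wt (- (2)) n by rewrite -wt_add; f_equal; ring.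
    apply: Rmult_le_compat_r; first by exact: wt_ge0. apply: wt_le_neg; first lra.
    rewrite /jap -!abs_IZR. apply: Rplus_le_compat_l. apply: IZR_le. lia.
  rewrite SZ_scal. have := HC3 N (fun n => n) ltac:(exists 0%Z; left; move=> z; lia).
  have P : 0 <= B * wt (- (1)) (Z.of_nat K) by apply: Rmult_le_pos; lra.
  move=> H. apply: Rle_trans (Rmult_le_compat_l _ _ _ P H) _. right. ring.
have -> : (L - trig_poly K c x)%C = ((trig_poly N c x - trig_poly K c x) + - (trig_poly N c x - L))%C by ring.
apply: Rle_trans (Cmod_triangle _ _) _. rewrite Cmod_opp. lra.
Qed.

Lemma truncation_error v : smooth2 v -> (forall t, periodic (v t)) -> exists A d, 0 <= A /\ 0 <= d /\
  forall t x K, 0 <= t <= 1 -> 0 <= x <= 0 + 2 * PI ->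
    Cmod (v t x) <= A /\ Cmod (CDerive (v t) x) <= A /\
    Cmod (v t x - trig_poly K (coef 0 (v t)) x)%C <= d * wt (- (1)) (Z.of_nat K) /\
    Cmod (CDerive (v t) x - trig_poly K (derivative_coefs (coef 0 (v t))) x)%C <= d * wt (- (1)) (Z.of_nat K).
Proof.
move=> Hs Hp. have HP := PI_RGT_0.
have [M0 HM0] := continuous2_bounded v 0 1 0 (0 + 2 * PI) ltac:(lra) ltac:(lra) (smooth2_continuous2 v Hs).
have [M1 HM1] := continuous2_bounded _ 0 1 0 (0 + 2 * PI) ltac:(lra) ltac:(lra) (smooth2_continuous2_dxn v 1 Hs).
have M0p : 0 <= M0 by apply: Rle_trans (Cmod_ge_0 _) (HM0 0 0 _ _); lra.
have M1p : 0 <= M1 by apply: Rle_trans (Cmod_ge_0 _) (HM1 0 0 _ _); lra.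
have [B [B0 HB]] := smooth2_coef_decay v Hs Hp. have [C3 [C30 HC3]] := series_tail.
exists (M0 + M1), (C3 * B). split; [lra | split; first by apply: Rmult_le_pos; lra].
move=> t x K Ht Hx.
have H0 := HM0 t x Ht Hx. have H1 := HM1 t x Ht Hx.
have W n : wt (- (4)) n <= wt (- (3)) n by apply: wt_le_exp; lra.
split; first lra. split; first by rewrite /CDerive; lra. split.
  apply: HC3 => //.
    move=> n. apply: Rle_trans (HB t n Ht) _. exact: Rmult_le_compat_l.
  apply: (fourier_inversion (v t) x (CDerive (v t) x)) => //.
    move=> y. exact: (continuous2_slice v t y (smooth2_continuous2 v Hs)).
  exact: smooth2_cderiv_x.
have E n : coef 0 (CDerive_n (v t) 1) n = derivative_coefs (coef 0 (v t)) n.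
  rewrite (smooth2_coef_dxn v 1 t n Hs (Hp t)) /derivative_coefs /=. ring.
apply: HC3 => //.
  move=> n. rewrite /derivative_coefs Cmod_mult (Cmod_mult Ci) Cmod_R. rewrite Cmod_Ci Rmult_1_l.
  have -> : B * wt (- (3)) n = jap n * (B * wt (- (4)) n).
    rewrite -(wt_1 n). have -> : wt (- (3)) n = wt 1 n * wt (- (4)) n by rewrite -wt_add; f_equal; ring. ring.
  apply: Rmult_le_compat; [exact: Rabs_pos | exact: Cmod_ge_0 | rewrite /jap; lra | exact: HB].
move=> eps Heps.
have [N0 HN0] := fourier_inversion (CDerive_n (v t) 1) x (CDerive_n (v t) 2 x)
  (fun y => continuous2_slice _ t y (smooth2_continuous2_dxn v 1 Hs)) (smooth2_dxn_periodic v 1 t Hs (Hp t))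
  (smooth2_dxn_cderiv v 1 t x Hs) eps Heps.
exists N0 => N HN. have := HN0 N HN. rewrite /trig_poly.
by rewrite (symsum_ext _ N _ (fun n => derivative_coefs (coef 0 (v t)) n * cis (IZR n * x))%C); last by move=> n; rewrite E.
Qed.

Lemma trig_poly_parseval K c d : mean 0 (fun x => Cconj (trig_poly K c x) * trig_poly K d x)%C = SC K (fun n => Cconj (c n) * d n)%C.
Proof.
rewrite (mean_ext 0 _ (fun x => SC K (fun n => Cconj (c n) * (trig_poly K d x * cis (- (IZR n * x))))%C)); last first.
  move=> x. rewrite {1}/trig_poly SC_conj -SC_scal_r. apply: symsum_ext => n. rewrite Cmult_conj cis_neg. cring.
have H n x : ccontinuous (fun x => trig_poly K d x * cis (- (IZR n * x)))%C x.
  apply: ccontinuous_mult; [exact: ccontinuous_trig_poly | exact: ccontinuous_cis_neg].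
rewrite mean_symsum; last by move=> n x _; apply: ccontinuous_mult; [exact: ccontinuous_const | exact: H].
apply: symsum_ext_loc => n Hn. rewrite mean_scal; last by move=> x _.
rewrite -/(coef 0 (trig_poly K d) n) coef_trig_poly. case: Z_le_dec => // H'. lia.
Qed.

Lemma mean_real (h : R -> R) : (forall x, continuous h x) -> mean 0 (fun x => RtoC (h x)) = RtoC (/ (2 * PI) * RInt h 0 (2 * PI)).
Proof.
move=> Hh. have Hc x : ccontinuous (fun x => RtoC (h x)) x by exact: ccontinuous_RtoC.
rewrite /mean Rplus_0_l. have HP := PI_RGT_0. have [-> _] := CInt_pair (fun x => RtoC (h x)) 0 (2 * PI) ltac:(lra) (fun x _ => Hc x).
rewrite /RtoC /Cmult /Re /Im /=. rewrite (RInt_const (V := R_CompleteNormedModule)).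
rewrite /scal /= /mult /=. change (RInt (fun x => h x)) with (RInt h). f_equal; ring.
Qed.

Lemma ccontinuous_Cmod2 f x : ccontinuous f x -> continuous (fun y => Cmod (f y) ^ 2) x.
Proof.
move=> H. have [H1 _] := ccontinuous_mult _ _ _ H (ccontinuous_conj _ _ H).
apply: continuous_ext H1 => y. by rewrite Cmult_conj_self.
Qed.

Lemma mass_mean f : (forall x, ccontinuous f x) -> RtoC (mass f) = mean 0 (fun x => Cconj (f x) * f x)%C.
Proof.
move=> Hf. rewrite /mass -mean_real; last by move=> x; exact: ccontinuous_Cmod2.
apply: mean_ext => x. by rewrite -Cmult_conj_self Cmult_comm.
Qed.

Lemma momentum_mean f : (forall x, ccontinuous f x) -> (forall x, ccontinuous (CDerive f) x) ->
  momentum f = Im (mean 0 (fun x => Cconj (f x) * CDerive f x)%C).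
Proof.
move=> Hf Hd. have HP := PI_RGT_0. rewrite /mean Rplus_0_l.
have [-> _] := CInt_pair (fun x => Cconj (f x) * CDerive f x)%C 0 (2 * PI) ltac:(lra)
  (fun x _ => ccontinuous_mult _ _ _ (ccontinuous_conj _ _ (Hf x)) (Hd x)).
rewrite /momentum /Cmult /RtoC /Im /=. ring.
Qed.

Lemma momentum_coefs_mean K c : momentum_coefs K c = Im (mean 0 (fun x => Cconj (trig_poly K c x) * trig_poly K (derivative_coefs c) x)%C).
Proof.
rewrite trig_poly_parseval Im_symsum. apply: symsum_ext => n. rewrite /derivative_coefs.
rewrite (_ : (Cconj (c n) * (Ci * RtoC (IZR n) * c n))%C = (Ci * RtoC (IZR n) * (c n * Cconj (c n)))%C); last ring.
rewrite Cmult_conj_self /Ci /RtoC /Cmult /Im /=. rring.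
Qed.

Lemma mass_coefs_mean K c : RtoC (mass_coefs K c) = mean 0 (fun x => Cconj (trig_poly K c x) * trig_poly K c x)%C.
Proof.
rewrite trig_poly_parseval /mass_coefs RtoC_SZ. apply: symsum_ext => n. rewrite -Cmult_conj_self. cring.
Qed.

Lemma product_error (a b a' b' : C) A A' d d' : Cmod a' <= A' -> Cmod b <= A -> Cmod (a - a')%C <= d' -> Cmod (b - b')%C <= d ->
  Cmod (a * b - a' * b')%C <= d' * A + A' * d.
Proof.
move=> H1 H2 H3 H4. have -> : (a * b - a' * b')%C = ((a - a') * b + a' * (b - b'))%C by ring.
apply: Rle_trans (Cmod_triangle _ _) _. rewrite !Cmod_mult.
apply: Rplus_le_compat; apply: Rmult_le_compat => //; exact: Cmod_ge_0.
Qed.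

(** Both quantities are cubic or quadratic expressions in the solution and its derivative, whose truncations converge
    uniformly. *)
Lemma nonlin_truncation v : smooth2 v -> (forall t, periodic (v t)) -> exists C2, 0 <= C2 /\
  forall t K n, 0 <= t <= 1 ->
    Cmod (coef 0 (nonlin (v t)) n
      - coef 0 (fun x => RtoC (Cmod (trig_poly K (coef 0 (v t)) x) ^ 2 - mass_coefs K (coef 0 (v t)))%R
           * trig_poly K (derivative_coefs (coef 0 (v t))) x)%C n)%C <= C2 * wt (- (1)) (Z.of_nat K)
    /\ Rabs (momentum (v t) - momentum_coefs K (coef 0 (v t))) <= C2 * wt (- (1)) (Z.of_nat K).
Proof.
move=> Hs Hp. have [A [d [A0 [d0 H]]]] := truncation_error v Hs Hp.
set B := 2 * A + d. have B0 : 0 <= B by rewrite /B; lra.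
exists (2 * ((3 * B) * A + (3 * A * A + 3 * d * B) * 1) * d + 2 * B * d).
have AA : 0 <= A * A by nra. have BA : 0 <= B * A by nra. have dB : 0 <= d * B by nra.
have Q0 : 0 <= (3 * B) * A + (3 * A * A + 3 * d * B) * 1 by lra.
split.
  have Qd := Rmult_le_pos _ _ Q0 d0. have Bd := Rmult_le_pos _ _ B0 d0. lra.
move=> t K n Ht.
set c := coef 0 (v t). set S := trig_poly K c. set S1 := trig_poly K (derivative_coefs c).
set w := wt (- (1)) (Z.of_nat K). have w0 : 0 < w by exact: wt_pos.
have w1 : w <= 1 by apply: wt_le_1; lra.
set e := d * w. have e0 : 0 <= e by rewrite /e; nra. have ed : e <= d by rewrite /e; nra.
have cu x : ccontinuous (v t) x := continuous2_slice v t x (smooth2_continuous2 v Hs).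
have cu1 x : ccontinuous (CDerive (v t)) x := continuous2_slice _ t x (smooth2_continuous2_dxn v 1 Hs).
have cS x : ccontinuous S x by exact: ccontinuous_trig_poly.
have cS1 x : ccontinuous S1 x by exact: ccontinuous_trig_poly.
have P1 x (Hx : 0 <= x <= 0 + 2 * PI) := H t x K Ht Hx.
have SA x : 0 <= x <= 0 + 2 * PI -> Cmod (S x) <= A + d.
  move=> /P1 [H1 [_ [H3 _]]]. rewrite -/c -/S -/w -/e in H3.
  have -> : S x = (v t x + - (v t x - S x))%C by ring.
  apply: Rle_trans (Cmod_triangle _ _) _. rewrite Cmod_opp. lra.
have Sq x : 0 <= x <= 0 + 2 * PI -> Cmod (Cconj (v t x) * v t x - Cconj (S x) * S x)%C <= e * B.
  move=> Hx. have [H1 [_ [H3 _]]] := P1 x Hx. rewrite -/c -/S -/w -/e in H3.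
  apply: Rle_trans (product_error _ _ _ _ A (A + d) e e _ H1 _ H3) _; last by rewrite /B; right; ring.
    rewrite Cmod_conj. exact: SA.
  by rewrite -Cminus_conj Cmod_conj.
have Mo x : 0 <= x <= 0 + 2 * PI -> Cmod (Cconj (v t x) * CDerive (v t) x - Cconj (S x) * S1 x)%C <= e * B.
  move=> Hx. have [H1 [H2 [H3 H4]]] := P1 x Hx. rewrite -/c -/S -/w -/e in H3. rewrite -/c -/S1 -/w -/e in H4.
  apply: Rle_trans (product_error _ _ _ _ A (A + d) e e _ H2 _ H4) _; last by rewrite /B; right; ring.
    rewrite Cmod_conj. exact: SA.
  by rewrite -Cminus_conj Cmod_conj.
have cc f g x : (forall x, ccontinuous f x) -> (forall x, ccontinuous g x) -> ccontinuous (fun x => Cconj (f x) * g x)%C x.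
  move=> Hf Hg. apply: ccontinuous_mult; [exact: ccontinuous_conj | exact: Hg].
set m := mass (v t). set mu := mass_coefs K c.
have Em : Cmod (RtoC m - RtoC mu)%C <= 2 * (e * B).
  rewrite /m mass_mean // /mu mass_coefs_mean -/S -mean_minus; try by move=> x _; exact: cc.
  apply: mean_bound => //. move=> x _. apply: ccontinuous_minus; exact: cc.
have Bm : Cmod (RtoC m) <= 2 * (A * A).
  rewrite /m mass_mean //. apply: mean_bound; first by move=> x _; exact: cc.
  move=> x Hx. have [H1 _] := P1 x Hx. rewrite Cmod_mult Cmod_conj. apply: Rmult_le_compat => //; exact: Cmod_ge_0.
split.
  have N1 x : nonlin (v t) x = ((Cconj (v t x) * v t x - RtoC m) * CDerive (v t) x)%C.
    rewrite /nonlin RtoC_minus -Cmult_conj_self -/m. ring.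
  have N2 x : (RtoC (Cmod (S x) ^ 2 - mu)%R * S1 x)%C = ((Cconj (S x) * S x - RtoC mu) * S1 x)%C.
    rewrite RtoC_minus -Cmult_conj_self. ring.
  have c1 x : ccontinuous (nonlin (v t)) x.
    apply: (ccontinuous_ext (fun x => (Cconj (v t x) * v t x - RtoC m) * CDerive (v t) x)%C) => //.
    apply: ccontinuous_mult; last exact: cu1. apply: ccontinuous_minus; [exact: cc | exact: ccontinuous_const].
  have c2 x : ccontinuous (fun x => RtoC (Cmod (S x) ^ 2 - mu)%R * S1 x)%C x.
    apply: (ccontinuous_ext (fun x => (Cconj (S x) * S x - RtoC mu) * S1 x)%C) => //.
    apply: ccontinuous_mult; last exact: cS1. apply: ccontinuous_minus; [exact: cc | exact: ccontinuous_const].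
  rewrite /coef -mean_minus; try by apply: coef_continuous => x _.
  apply: (Rle_trans _ (2 * ((3 * (e * B)) * A + (3 * A * A + 3 * d * B) * e))).
    apply: mean_bound.
      by move=> x Hx; apply: ccontinuous_minus; apply: (coef_continuous 0) => // y _.
    move=> x Hx. 
    rewrite (_ : (nonlin (v t) x * cis (- (IZR n * x)) - RtoC (Cmod (S x) ^ 2 - mu)%R * S1 x * cis (- (IZR n * x)))%C
      = ((nonlin (v t) x - RtoC (Cmod (S x) ^ 2 - mu)%R * S1 x) * cis (- (IZR n * x)))%C); last ring.
    rewrite Cmod_mult Cmod_cis Rmult_1_r N1 N2.
    have [H1 [H2 [H3 H4]]] := P1 x Hx. rewrite -/c -/S1 -/w -/e in H4.
    have Hsq := Sq x Hx.
    have D : Cmod (Cconj (v t x) * v t x - RtoC m - (Cconj (S x) * S x - RtoC mu))%C <= 3 * (e * B).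
      have -> : (Cconj (v t x) * v t x - RtoC m - (Cconj (S x) * S x - RtoC mu))%C
       = ((Cconj (v t x) * v t x - Cconj (S x) * S x) + - (RtoC m - RtoC mu))%C by ring.
      apply: Rle_trans (Cmod_triangle _ _) _. rewrite Cmod_opp. lra.
    apply: product_error => //.
    have -> : (Cconj (S x) * S x - RtoC mu)%C = ((Cconj (v t x) * v t x + - RtoC m) + - (Cconj (v t x) * v t x - RtoC m - (Cconj (S x) * S x - RtoC mu)))%C by ring.
    apply: Rle_trans (Cmod_triangle _ _) _. rewrite Cmod_opp.
    have X := Cmod_triangle (Cconj (v t x) * v t x)%C (- RtoC m)%C. rewrite Cmod_opp Cmod_mult Cmod_conj in X.
    have Y : Cmod (v t x) * Cmod (v t x) <= A * A by apply: Rmult_le_compat => //; exact: Cmod_ge_0.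
    have Z : e * B <= d * B by apply: Rmult_le_compat_r. lra.
  rewrite /e. have : 0 <= 2 * B * d * w by repeat apply: Rmult_le_pos; lra. lra.
rewrite momentum_mean // momentum_coefs_mean -/S -/S1.
have -> : Im (mean 0 (fun x => Cconj (v t x) * CDerive (v t) x)%C) - Im (mean 0 (fun x => Cconj (S x) * S1 x)%C)
  = Im (mean 0 (fun x => Cconj (v t x) * CDerive (v t) x - Cconj (S x) * S1 x)%C).
  rewrite mean_minus; try by move=> x _; exact: cc. by [].
apply: Rle_trans (Im_le_Cmod _) _. apply: (Rle_trans _ (2 * (e * B))).
  apply: mean_bound => // x _. apply: ccontinuous_minus; exact: cc.
rewrite /e. have := Rmult_le_pos _ _ (Rmult_le_pos _ _ Q0 d0) (Rlt_le _ _ w0). lra.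
Qed.

(** * The interaction representation *)

(** The coefficients without their linear evolution and without the rotation by the momentum [P]. *)
Definition profile (sigma P : R) (K : nat) (c : Z -> R -> C) (n : Z) (t : R) : C :=
  (cis (- ((IZR n ^ 3 + sigma * P) * t)) * cutoff K (fun m => c m t) n)%C.

Lemma phase_cubes n x y : phase n x y = IZR n ^ 3 - IZR x ^ 3 + IZR (x + y - n) ^ 3 - IZR y ^ 3.
Proof. rewrite /phase !minus_IZR !plus_IZR. ring. Qed.

(** By [phase_cubes] the linear phases of the four profiles combine to the phase of the interaction; the gauge
    factor cancels because two of the three inputs carry it and one carries its conjugate. *)
Lemma trilinear_profile sigma P K c n t : (Z.abs n <= Z.of_nat K)%Z ->
  trilinear (interaction (RtoC sigma * (Ci / 2)) t n) K (fun j => profile sigma P K c j t) (fun j => profile sigma P K c j t) (fun j => profile sigma P K c j t) n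
  = (RtoC sigma * cis (- ((IZR n ^ 3 + sigma * P) * t)) *
    SC K (fun x => SC K (fun y => RtoC (symbol n x y) * (Ci / 2) * (c x t * Cconj (cutoff K (fun m => c m t) (x + y - n)) * c y t))))%C.
Proof.
move=> Hn. rewrite /trilinear -SC_scal. apply: symsum_ext_loc => x Hx. rewrite -SC_scal. apply: symsum_ext_loc => y Hy.
rewrite /profile /interaction (cutoff_in K _ x) ?(cutoff_in K _ y); try lia.
rewrite Cmult_conj -cis_neg.
have E : cis (- (phase n x y * t)) = (cis (- ((IZR n ^ 3 + sigma * P) * t)) * Cconj (cis (- ((IZR x ^ 3 + sigma * P) * t)))
   * cis (- ((IZR (x + y - n) ^ 3 + sigma * P) * t)) * Cconj (cis (- ((IZR y ^ 3 + sigma * P) * t))))%C.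
  rewrite -!cis_neg !cis_cis phase_cubes. f_equal. ring.
rewrite E (cis_neg (- ((IZR (x + y - n) ^ 3 + sigma * P) * t))).
have U1 := cis_conj_self (- ((IZR x ^ 3 + sigma * P) * t)).
have U2 := cis_conj_self (- ((IZR y ^ 3 + sigma * P) * t)).
have U3 := cis_conj_self (- ((IZR (x + y - n) ^ 3 + sigma * P) * t)).
set e1 := cis (- ((IZR x ^ 3 + sigma * P) * t)) in U1 *. set e2 := cis (- ((IZR y ^ 3 + sigma * P) * t)) in U2 *.
set e3 := cis (- ((IZR (x + y - n) ^ 3 + sigma * P) * t)) in U3 *.
transitivity ((e1 * Cconj e1) * (e2 * Cconj e2) * (e3 * Cconj e3) * (RtoC sigma * cis (- ((IZR n ^ 3 + sigma * P) * t)) *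
  (RtoC (symbol n x y) * (Ci / 2) * (c x t * Cconj (cutoff K (fun m => c m t) (x + y - n)) * c y t))))%C; first cring.
rewrite U1 U2 U3. cring.
Qed.

Lemma solution_coef_cderiv sigma v n t : smooth_global_solution sigma v ->
  cderiv (fun t' => coef 0 (v t') n) t (Ci * RtoC (IZR n ^ 3) * coef 0 (v t) n + RtoC sigma * coef 0 (nonlin (v t)) n)%C.
Proof.
move=> [Hs [Hp Heq]]. apply: cderiv_eq (smooth2_coef_cderiv v n t Hs) _.
have c3 x : ccontinuous (CDerive_n (v t) 3) x := continuous2_slice _ t x (smooth2_continuous2_dxn v 3 Hs).
have cdt x : ccontinuous (dt v t) x := continuous2_slice _ t x (smooth2_continuous2_dt v Hs).
have cu x : ccontinuous (v t) x := continuous2_slice v t x (smooth2_continuous2 v Hs).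
have cu1 x : ccontinuous (CDerive (v t)) x := continuous2_slice _ t x (smooth2_continuous2_dxn v 1 Hs).
have cN x : ccontinuous (nonlin (v t)) x.
  apply: (ccontinuous_ext (fun x => (Cconj (v t x) * v t x - RtoC (mass (v t))) * CDerive (v t) x)%C).
    move=> y. rewrite /nonlin RtoC_minus -Cmult_conj_self. ring.
  apply: ccontinuous_mult; last exact: cu1. apply: ccontinuous_minus; last exact: ccontinuous_const.
  apply: ccontinuous_mult; [exact: ccontinuous_conj | exact: cu].
have -> : coef 0 (dt v t) n = (RtoC sigma * coef 0 (nonlin (v t)) n - coef 0 (CDerive_n (v t) 3) n)%C.
  rewrite /coef -mean_scal; last by apply: coef_continuous => x _.
  rewrite -mean_minus; [|  | by apply: coef_continuous => x _].
    apply: mean_ext => x. have E := Heq t x. rewrite /dx3 in E.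
    transitivity ((dt v t x + CDerive_n (v t) 3 x - CDerive_n (v t) 3 x) * cis (- (IZR n * x)))%C; first ring.
    rewrite E. ring.
  move=> x Hx. apply: ccontinuous_mult; first exact: ccontinuous_const. by apply: (coef_continuous 0) => // y _.
rewrite (smooth2_coef_dxn v 3 t n Hs (Hp t)) RtoC_pow.
have Ci3 : (Ci * (Ci * Ci) = - Ci)%C by rewrite /Ci /Cmult /Copp /=; f_equal; ring.
rewrite /=. transitivity (RtoC sigma * coef 0 (nonlin (v t)) n - (Ci * (Ci * Ci)) * (RtoC (IZR n) * (RtoC (IZR n) * RtoC (IZR n))) * coef 0 (v t) n)%C; first ring.
rewrite Ci3. ring.
Qed.

Lemma wt_neg_small : forall (p eps : R), 0 < p -> 0 < eps -> exists K0, forall K, (K0 <= K)%nat -> wt (- p) (Z.of_nat K) <= eps.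
Proof.
move=> p eps Hp He.
have [K0 HK0] := INR_unbounded (Rpower eps (- / p)).
exists K0 => K HK.
have PJ : Rpower eps (- / p) <= jap (Z.of_nat K).
  rewrite /jap -INR_IZR_INZ Rabs_pos_eq; last exact: pos_INR. have := le_INR _ _ HK. lra.
rewrite /wt. apply: Rle_trans (Rpower_base_anti _ _ p _ (conj (exp_pos _) PJ)) _; first lra.
rewrite -/(Rpower _ _) Rpower_mult (_ : - / p * - p = 1) ?Rpower_1 //; [lra | by field; lra].
Qed.

(** Three terms remain beside the interaction: the truncation errors of the nonlinearity and of the momentum, which
    are small for large [K], and the self-interaction [n * |c n|^2 * c n], which the sup bound of weight [1/2]
    controls. *)
Lemma profile_ode sigma v R0 : sigma = 1 \/ sigma = -1 -> smooth_global_solution sigma v -> 0 <= R0 ->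
  exists K0, forall K, (K0 <= K)%nat -> forall n t, (Z.abs n <= Z.of_nat K)%Z -> 0 <= t <= 1 ->
    Cmod (coef 0 (v t) n) <= R0 * wt (- (1/2)) n ->
    let a := profile sigma (momentum (v 0)) K (fun m t => coef 0 (v t) m) in
    exists d, cderiv (a n) t d /\
      Cmod (d - trilinear (interaction (RtoC sigma * (Ci / 2)) t n) K (fun j => a j t) (fun j => a j t) (fun j => a j t) n)%C
        <= (1 + R0 ^ 3) * wt (- (1/2)) n.
Proof.
move=> Hsig Hv HR. have [Hs [Hp Heq]] := Hv.
have [C2 [C20 HC2]] := nonlin_truncation v Hs Hp.
set P := momentum (v 0).
have Q0 : 0 < C2 * (1 + R0) + 1 by nra.
have [K0 HK0] := wt_neg_small (1/2) (/ (C2 * (1 + R0) + 1)) ltac:(lra) ltac:(exact: Rinv_0_lt_compat).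
exists K0 => K HK n t Hn Ht cn a.
set c := coef 0 (v t).
set e := cis (- ((IZR n ^ 3 + sigma * P) * t)).
set GK := coef 0 (fun x => RtoC (Cmod (trig_poly K c x) ^ 2 - mass_coefs K c)%R * trig_poly K (derivative_coefs c) x)%C n.
have [Hnl Hmom] := HC2 t K n Ht. rewrite -/c -/GK in Hnl Hmom.
rewrite (momentum_conserved sigma v t Hv) -/P in Hmom; last lra.
exists (e * (RtoC sigma * coef 0 (nonlin (v t)) n - Ci * RtoC (sigma * P) * c n))%C. split.
  apply: (cderiv_ext (fun s => cis (- (IZR n ^ 3 + sigma * P) * s) * coef 0 (v s) n)%C).
    move=> s. rewrite /a /profile cutoff_in //. do 2 f_equal. ring.
  apply: cderiv_eq (cderiv_mult _ _ _ _ _ (cderiv_cis _ _) (solution_coef_cderiv sigma v n t Hv)) _.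
  rewrite -/c (_ : - (IZR n ^ 3 + sigma * P) * t = - ((IZR n ^ 3 + sigma * P) * t)); last ring. rewrite -/e RtoC_opp RtoC_plus. ring.
rewrite /a trilinear_profile // -/e -/c.
have Dec := resonance_decomposition K c n Hn. rewrite -galerkin_coef // -/GK in Dec.
set NR := SC K _ in Dec *.
have -> : (e * (RtoC sigma * coef 0 (nonlin (v t)) n - Ci * RtoC (sigma * P) * c n) - RtoC sigma * e * NR)%C
  = (RtoC sigma * e * ((coef 0 (nonlin (v t)) n - GK) + - (Ci * RtoC (P - momentum_coefs K c) * c n) + - (Ci * RtoC (IZR n * Cmod (c n) ^ 2)%R * c n)))%C.
  rewrite Dec RtoC_minus (RtoC_mult sigma P). ring.
rewrite !(Cmod_mult _ (_ + _ + _)%C) (Cmod_mult (RtoC sigma)) Cmod_cis Cmod_R.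
have -> : Rabs sigma = 1 by case: Hsig => ->; rewrite ?Rabs_R1 // Rabs_left; lra.
rewrite !Rmult_1_l.
apply: Rle_trans (Cmod_triangle _ _) _. apply: Rle_trans (Rplus_le_compat_r _ _ _ (Cmod_triangle _ _)) _.
rewrite !Cmod_opp (Cmod_mult (Ci * RtoC (P - momentum_coefs K c))) (Cmod_mult (Ci * RtoC (IZR n * Cmod (c n) ^ 2)%R)) !(Cmod_mult Ci) !Cmod_R.
rewrite Cmod_Ci !Rmult_1_l.
rewrite -/c in cn. have cn0 := Cmod_ge_0 (c n).
have W := wt_pos (- (1/2)) n. have WK := wt_pos (- (1/2)) (Z.of_nat K).
have W1 : wt (- (1/2)) n <= 1 by apply: wt_le_1; lra.
have cR : Cmod (c n) <= R0 by nra.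
have WnK : wt (- (1/2)) (Z.of_nat K) <= wt (- (1/2)) n.
  apply: wt_le_neg; first lra. rewrite /jap -!abs_IZR. apply: Rplus_le_compat_l. apply: IZR_le. lia.
have T3 : Rabs (IZR n * Cmod (c n) ^ 2) * Cmod (c n) <= R0 ^ 3 * wt (- (1/2)) n.
  rewrite Rabs_mult (Rabs_pos_eq (Cmod (c n) ^ 2)); last exact: pow2_ge_0.
  rewrite Rmult_assoc (_ : Cmod (c n) ^ 2 * Cmod (c n) = Cmod (c n) ^ 3); last ring.
  have C3 : Cmod (c n) ^ 3 <= (R0 * wt (- (1/2)) n) ^ 3 by apply: pow_incr.
  have J : Rabs (IZR n) <= jap n by rewrite /jap; lra.
  apply: Rle_trans (Rmult_le_compat _ _ _ _ (Rabs_pos _) (pow_le _ 3 cn0) J C3) _.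
  right. rewrite -(wt_1 n) Rpow_mult_distr.
  transitivity (R0 ^ 3 * (wt 1 n * (wt (- (1/2)) n * (wt (- (1/2)) n * wt (- (1/2)) n)))); first ring.
  rewrite -!wt_add. do 2 f_equal. lra.
have KK : wt (- (1)) (Z.of_nat K) = wt (- (1/2)) (Z.of_nat K) * wt (- (1/2)) (Z.of_nat K) by rewrite -wt_add; f_equal; lra.
have T12 : C2 * wt (- (1)) (Z.of_nat K) * (1 + R0) <= wt (- (1/2)) n.
  rewrite KK. have H1 := HK0 K HK.
  have H2 : (C2 * (1 + R0)) * wt (- (1/2)) (Z.of_nat K) <= 1.
    have := Rmult_le_compat_l _ _ _ (Rlt_le _ _ Q0) H1. rewrite Rinv_r; last lra. nra.
  have := Rmult_le_compat_r _ _ _ (Rlt_le _ _ WK) H2. lra.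
have T2 : Rabs (P - momentum_coefs K c) * Cmod (c n) <= C2 * wt (- (1)) (Z.of_nat K) * R0.
  apply: Rmult_le_compat => //. exact: Rabs_pos.
lra.
Qed.

(** * Fourier-Lebesgue norms *)

Definition FL_term (s p : R) (c : Z -> C) (n : Z) : R := rpow (Rpower (bracket n) s * Cmod (c n)) p.

Lemma rpow_nonneg x p : 0 <= rpow x p.
Proof. rewrite /rpow. case: Rle_dec => _; [lra | left; exact: exp_pos]. Qed.

Lemma rpow_pos x p : 0 < x -> rpow x p = Rpower x p.
Proof. move=> H. rewrite /rpow. case: Rle_dec => // H'. lra. Qed.

(** The partial sums increase, so their limit exists and dominates them. *)
Lemma FL_partial_sum s p f eps : 1 <= p -> 0 < eps -> Rbar_lt (FL_norm s p f) eps ->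
  forall K, SZ K (FL_term s p (fourier_coef f)) <= Rpower eps p.
Proof.
move=> Hp He. rewrite /FL_norm. set u := symsum _.
have u0 K : 0 <= u K by apply: SZ_nonneg => n; exact: rpow_nonneg.
have uS K : u K <= u (S K) by apply: SZ_mono; [move=> n; exact: rpow_nonneg | lia].
have Hlim := Lim_seq_correct u (ex_lim_seq_incr u uS).
move: Hlim. case: (Lim_seq u) => [r| |] Hlim Hlt K.
- have HK := is_lim_seq_incr_compare u r Hlim uS K.
  apply: Rle_trans HK _. rewrite /= in Hlt.
  case: (Rle_dec r 0) => Hr; first by apply: Rle_trans Hr _; left; exact: exp_pos.
  rewrite rpow_pos in Hlt; last lra.
  have -> : r = Rpower (Rpower r (/ p)) p by rewrite Rpower_mult Rinv_l ?Rpower_1 //; lra.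
  apply: Rle_Rpower_l; first lra. split; [exact: exp_pos | lra].
- by [].
- have := is_lim_seq_le (fun _ => 0) u 0 m_infty u0 (is_lim_seq_const 0) Hlim. by [].
Qed.

Lemma bracket_ge1 n : 1 <= bracket n.
Proof.
rewrite /bracket -{1}sqrt_1. apply: sqrt_le_1_alt. have := pow2_ge_0 (IZR n). lra.
Qed.

Lemma jap_le_bracket n : jap n <= 2 * bracket n.
Proof.
have H := bracket_ge1 n. have : Rabs (IZR n) <= bracket n.
  rewrite /bracket -sqrt_Rsqr_abs. apply: sqrt_le_1_alt. rewrite /Rsqr /=. lra.
rewrite /jap. lra.
Qed.

Lemma FL_term_bound s p c n eps : 0 <= s -> 1 <= p -> 0 < eps -> FL_term s p c n <= Rpower eps p ->
  Rpower (bracket n) s * Cmod (c n) <= eps.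
Proof.
move=> Hs Hp He. rewrite /FL_term => H. apply: Rnot_lt_le => Hlt.
rewrite rpow_pos in H; last lra.
have := Rlt_Rpower_l _ _ p ltac:(lra) (conj He Hlt). lra.
Qed.

Lemma FL_coef_bound s p f eps n : 0 <= s -> 1 <= p -> 0 < eps -> Rbar_lt (FL_norm s p f) eps ->
  Cmod (fourier_coef f n) <= eps.
Proof.
move=> Hs Hp He H.
have B := FL_partial_sum s p f eps Hp He H (Z.to_nat (Z.abs n)).
have T := SZ_term (Z.to_nat (Z.abs n)) n (FL_term s p (fourier_coef f)) (fun m => rpow_nonneg _ _) ltac:(lia).
have := FL_term_bound s p _ n eps Hs Hp He (Rle_trans _ _ _ T B).
have : 1 <= Rpower (bracket n) s.
  have := Rle_Rpower_l 1 (bracket n) s Hs ltac:(have := bracket_ge1 n; lra).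
  by rewrite {1}/Rpower ln_1 Rmult_0_r exp_0.
have := Cmod_ge_0 (fourier_coef f n). nra.
Qed.

(** [2 * s - 3/2 + 2 / p] is positive exactly when [FL^{s,p}] with [2 <= p] embeds into a Sobolev space above [H^{1/4}]. *)
Definition gain (s p : R) : R := Rmin (1/64) ((2 * s - 3/2 + 2 / p) / 4).

Lemma admissible_gain s p : admissible s p ->
  1/2 <= s /\ 1 <= p /\ 0 < gain s p <= 1/64 /\ 4 * gain s p <= 2 * s - 3/2 + 2 / p.
Proof.
move=> H.
have [Hs [Hp D]] : 1/2 <= s /\ 1 <= p /\ 0 < 2 * s - 3/2 + 2 / p.
  case: H => [[Hs [Hp Hlt]]|[Hs Hp]]; split; try lra; split=> //.
    have H3 : 0 < 3 - 4 * s by lra.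
    have H4 : p * (3 - 4 * s) < 4.
      have := Rmult_lt_compat_r _ _ _ H3 Hlt. rewrite /Rdiv Rmult_assoc Rinv_l; lra.
    have ip : 0 < / p by apply: Rinv_0_lt_compat; lra.
    have := Rmult_lt_compat_l _ _ _ ip H4. rewrite -Rmult_assoc Rinv_l; last lra.
    rewrite /Rdiv. lra.
  have : 0 < 2 / p by apply: Rdiv_lt_0_compat; lra. lra.
split=> //. split=> //. rewrite /gain. split.
  split; [apply: Rmin_glb_lt; lra | exact: Rmin_l].
have := Rmin_r (1/64) ((2 * s - 3/2 + 2 / p) / 4). lra.
Qed.

Lemma wt_le_bracket q n : 0 <= q <= 1 -> wt q n <= 2 * Rpower (bracket n) q.
Proof.
move=> Hq. have J := jap_ge1 n. have Hb := bracket_ge1 n.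
apply: Rle_trans (Rle_Rpower_l (jap n) (2 * bracket n) q _ _) _; [lra | have := jap_le_bracket n; lra |].
rewrite -Rpower_mult_distr; try lra. apply: Rmult_le_compat_r; first by left; exact: exp_pos.
apply: Rpower2_le. lra.
Qed.

Lemma FL_sup_bound s c n : 1/2 <= s -> Rpower (bracket n) s * Cmod (c n) <= 1 -> Cmod (c n) <= 2 * wt (- (1/2)) n.
Proof.
move=> Hs H. have Hb := bracket_ge1 n. have W := wt_le_bracket (1/2) n ltac:(lra).
have B : Rpower (bracket n) (1/2) <= Rpower (bracket n) s.
  case: Hb => [Hb|Hb]; last by rewrite -Hb /Rpower ln_1 !Rmult_0_r; lra.
  case: Hs => [Hs|<-]; last lra. left. exact: Rpower_lt.
have c0 := Cmod_ge_0 (c n). have O := wt_opp n (1/2). have P := wt_pos (- (1/2)) n. have P' := wt_pos (1/2) n.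
have : wt (1/2) n * Cmod (c n) <= 2 by nra.
move=> H2. have := Rmult_le_compat_l _ _ _ (Rlt_le _ _ P) H2. rewrite -Rmult_assoc O. lra.
Qed.

(** Either the term is dominated by the corresponding term of the [FL_norm], or the coefficient is so small that
    the weight alone is summable; the second alternative uses the admissibility condition. *)
Lemma FL_sobolev_bound s p g : 1/2 <= s -> 1 <= p -> 0 < g <= 1/64 -> 4 * g <= 2 * s - 3/2 + 2 / p ->
  exists Ce, 0 <= Ce /\ forall c : Z -> C, (forall K, SZ K (FL_term s p c) <= 1) ->
    (forall n, Rpower (bracket n) s * Cmod (c n) <= 1) -> sobolev_bounded g Ce (modulus c).
Proof.
move=> Hs Hp Hg HD.
set b := 2 * s - 1/2 - 2 * g. have Hb : 0 < b by rewrite /b; lra.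
have [q [Hq Hpq]] : exists q, 1 < q /\ (2 < p -> q = b + b * (2 / (p - 2))).
  case: (Rlt_dec 2 p) => H2; last by exists 2; split; [lra | move=> H; lra].
  exists (b + b * (2 / (p - 2))); split=> //.
  have -> : b + b * (2 / (p - 2)) = b * p / (p - 2) by field; lra.
  apply: (Rmult_lt_reg_r (p - 2)); first lra. rewrite /Rdiv Rmult_assoc Rinv_l; last lra.
  have : p * (1 - 2 / p) < p * b.
    apply: Rmult_lt_compat_l; first lra. rewrite /b. lra.
  rewrite Rmult_minus_distr_l (_ : p * (2 / p) = 2); last by field; lra. lra.
have [C2 [C20 HC2]] := sum_wt q Hq.
exists (2 + 2 * (Rpower 2 q * C2)). have P2 : 0 < Rpower 2 q by exact: exp_pos.
split; first by have := Rmult_lt_0_compat _ _ P2 C20; lra.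
move=> c Hsum Hsup K.
apply: Rle_trans (SZ_le _ _ (fun n => 2 * FL_term s p c n + 2 * (Rpower 2 q * wt (- q) n)) _) _; last first.
  rewrite SZ_plus !SZ_scal. have H1 := Hsum K. have H2 := HC2 K (fun n => n) ltac:(exists 0%Z; left; move=> z; lia).
  have H3 := Rmult_le_compat_l _ _ _ (Rlt_le _ _ P2) H2.
  apply: Rplus_le_compat; [lra | apply: Rmult_le_compat_l; [lra | exact: H3]].
move=> n. have B1 := bracket_ge1 n.
set y := Rpower (bracket n) s * Cmod (c n).
have y0 : 0 <= y by apply: Rmult_le_pos; [left; exact: exp_pos | exact: Cmod_ge_0].
have y1 : y <= 1 by exact: Hsup.
have Wq : 0 <= Rpower 2 q * wt (- q) n by apply: Rmult_le_pos; left; [exact: exp_pos | exact: wt_pos].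
have Main : wt (1/2 + 2 * g) n * Cmod (c n) ^ 2 <= 2 * (y ^ 2 * Rpower (bracket n) (- b)).
  have W := wt_le_bracket (1/2 + 2 * g) n ltac:(lra).
  have E : Rpower (bracket n) (1/2 + 2 * g) = Rpower (bracket n) s * Rpower (bracket n) s * Rpower (bracket n) (- b).
    rewrite -!Rpower_plus. f_equal. rewrite /b. ring.
  apply: Rle_trans (Rmult_le_compat_r _ _ _ (pow2_ge_0 _) W) _. rewrite E /y. right. ring.
rewrite /modulus. apply: Rle_trans Main _.
have Bb : Rpower (bracket n) (- b) <= 1.
  apply: Rle_trans (Rpower_base_anti 1 (bracket n) b ltac:(lra) ltac:(lra)) _.
  rewrite /Rpower ln_1 Rmult_0_r exp_0. lra.
have Bp : 0 < Rpower (bracket n) (- b). by apply: exp_pos.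
rewrite /FL_term -/y. have R0 := rpow_nonneg y p.
case: (Rle_lt_or_eq_dec 0 y y0) => Hy; last first.
  have -> : y ^ 2 = 0 by rewrite -Hy; ring. lra.
suff S : y ^ 2 * Rpower (bracket n) (- b) <= rpow y p + Rpower 2 q * wt (- q) n by lra.
rewrite rpow_pos // in R0 *.
have Ey r : Rpower y r = Rpower y 2 * Rpower y (r - 2) by rewrite -Rpower_plus; f_equal; ring.
have Y2 : Rpower y 2 = y ^ 2 by have := Rpower_pow 2 y Hy; rewrite /=; move=> <-; f_equal; lra.
have Lny : ln y <= 0.
  case: y1 => [y1|->]; last by rewrite ln_1; lra. rewrite -ln_1. left. exact: ln_increasing.
case: (Rle_dec p 2) => H2.
  have : y ^ 2 <= Rpower y p.
    rewrite -Y2 /Rpower. have : 2 * ln y <= p * ln y by nra. case=> [H|->]; last lra. left. exact: exp_increasing.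
  have := pow2_ge_0 y. nra.
have {}H2 : 2 < p by lra.
case: (Rle_dec (Rpower (bracket n) (- b)) (Rpower y (p - 2))) => Hc.
  rewrite (Ey p) Y2. have := pow2_ge_0 y. nra.
have Hy2 : y ^ 2 <= Rpower (bracket n) (- (b * (2 / (p - 2)))).
  rewrite -Y2. have -> : Rpower y 2 = Rpower (Rpower y (p - 2)) (2 / (p - 2)) by rewrite Rpower_mult; f_equal; field; lra.
  have -> : Rpower (bracket n) (- (b * (2 / (p - 2)))) = Rpower (Rpower (bracket n) (- b)) (2 / (p - 2)) by rewrite Rpower_mult; f_equal; ring.
  apply: Rle_Rpower_l; first by apply: Rdiv_le_0_compat; lra. split; [exact: exp_pos | lra].
have F : y ^ 2 * Rpower (bracket n) (- b) <= Rpower (bracket n) (- q).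
  rewrite (Hpq H2) Ropp_plus_distr Rpower_plus (Rmult_comm (Rpower _ (- b))). apply: Rmult_le_compat_r; lra.
have G : Rpower (bracket n) (- q) <= Rpower 2 q * wt (- q) n.
  have -> : Rpower (bracket n) (- q) = Rpower 2 q * Rpower (2 * bracket n) (- q).
    rewrite -Rpower_mult_distr; try lra. rewrite -Rmult_assoc -Rpower_plus Rplus_opp_r Rpower_O; lra.
  apply: Rmult_le_compat_l; first lra. apply: Rpower_base_anti; first lra.
  have := jap_le_bracket n. have := jap_ge1 n. lra.
lra.
Qed.

(** * Rotation of the Fourier coefficients *)

Lemma sobolev_bounded_dom g A (f f' : Z -> R) : (forall n, 0 <= f' n <= f n) -> sobolev_bounded g A f -> sobolev_bounded g A f'.
Proof.
move=> H Hf K. apply: Rle_trans (Hf K). apply: SZ_le => n. apply: Rmult_le_compat_l; first by exact: wt_ge0.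
apply: pow_incr. exact: H.
Qed.

Lemma fourier_coef_minus f f' n : fourier_coef (dist_minus f f') n = (fourier_coef f n - fourier_coef f' n)%C.
Proof. rewrite /fourier_coef /dist_minus. ring. Qed.

Lemma fourier_coef_fun v n : fourier_coef (dist_of_fun v) n = coef 0 v n.
Proof. by rewrite /coef /mean /fourier_coef /dist_of_fun Rplus_0_l. Qed.

Lemma coef_dirichlet N f v n : (Z.abs n <= Z.of_nat N)%Z -> (forall x, v x = dirichlet N f x) -> coef 0 v n = fourier_coef f n.
Proof.
move=> Hn Hv. rewrite /coef (mean_ext 0 _ (fun x => trig_poly N (fourier_coef f) x * cis (- (IZR n * x)))%C); last by move=> x; rewrite Hv.
rewrite -/(coef 0 (trig_poly N (fourier_coef f)) n) coef_trig_poly. by case: Z_le_dec.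
Qed.

Lemma momentum_ext f f' : (forall x, f x = f' x) -> momentum f = momentum f'.
Proof.
move=> H. rewrite /momentum. f_equal. apply: (RInt_ext (V := R_CompleteNormedModule)) => x _.
rewrite H /CDerive /CDerive_n. do 2 f_equal. f_equal; apply: Derive_n_ext => y; by rewrite H.
Qed.

Lemma infinite_momentum_nonzero f : infinite_momentum f -> exists n, fourier_coef f n <> RtoC 0.
Proof.
move=> Hinf. apply: Classical_Prop.NNPP => Hne.
have Z n : fourier_coef f n = RtoC 0.
  apply: Classical_Prop.NNPP => H. apply: Hne. by exists n.
have D N x : dirichlet N f x = RtoC 0.
  rewrite -(SC_0 N). apply: symsum_ext => n. rewrite Z. change (RtoC 0 * cis (IZR n * x) = RtoC 0)%C. ring.
have M N : Rabs (momentum (dirichlet N f)) = 0.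
  rewrite (momentum_ext _ _ (D N)) /momentum (RInt_ext (V := R_CompleteNormedModule) _ (fun _ => 0)).
    rewrite (RInt_const (V := R_CompleteNormedModule)) /scal /= /mult /= !Rmult_0_r. exact: Rabs_R0.
  move=> x _. rewrite /Cconj /RtoC /Cmult /Im /=. ring.
have L : is_lim_seq (fun N => Rabs (momentum (dirichlet N f))) 0.
  apply: (is_lim_seq_ext (fun _ => 0)); [by move=> N; rewrite M | exact: is_lim_seq_const].
have := is_lim_seq_unique _ _ L. by rewrite (is_lim_seq_unique _ _ Hinf).
Qed.

(** Differences with the limit are bounded by convergence, and the limit is compared with a single smooth solution
    [uN N0], whose coefficients decay fast, uniformly in time. *)
Lemma converges_FL_bounded T s p uN u : admissible s p -> 0 < T -> T <= 1 ->
  (forall N, smooth2 (uN N) /\ forall t, periodic (uN N t)) -> converges_FL T s p uN u ->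
  exists R0 N0, 0 <= R0 /\ forall N t, (N0 <= N)%nat -> 0 <= t <= T ->
    (forall n, Cmod (coef 0 (uN N t) n) <= R0 * wt (- (1/2)) n) /\
    sobolev_bounded (gain s p) R0 (modulus (coef 0 (uN N t))).
Proof.
move=> Hadm HT0 HT1 Hsm Hconv. have [Hs [Hp [Hg HD]]] := admissible_gain s p Hadm.
have [Ce [Ce0 HCe]] := FL_sobolev_bound s p (gain s p) Hs Hp Hg HD.
have [N0 HN0] := Hconv 1 Rlt_0_1.
have [B [B0 HB]] := smooth2_coef_decay (uN N0) (proj1 (Hsm N0)) (proj2 (Hsm N0)).
have [C2 [C20 HC2]] := sum_wt 2 ltac:(lra).
set g := gain s p.
exists (4 + B + (3 * (2 * Ce) + 3 * (B * B * C2))), N0.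
have BB : 0 <= B * B * C2 by apply: Rmult_le_pos; nra.
split; first lra. move=> N t HN Ht.
pose d M n := fourier_coef (dist_minus (dist_of_fun (uN M t)) (u t)) n.
have Hd M : (N0 <= M)%nat -> (forall n, Cmod (d M n) <= 2 * wt (- (1/2)) n) /\ sobolev_bounded g Ce (modulus (d M)).
  move=> HM. have Hlt := HN0 M HM t ltac:(lra).
  have Hsum := FL_partial_sum s p _ 1 Hp Rlt_0_1 Hlt.
  have H1 : Rpower 1 p = 1 by rewrite /Rpower ln_1 Rmult_0_r exp_0.
  rewrite H1 in Hsum.
  have Hsup n : Rpower (bracket n) s * Cmod (d M n) <= 1.
    apply: (FL_term_bound s p (d M) n 1); try lra. rewrite H1. apply: Rle_trans (Hsum (Z.to_nat (Z.abs n))).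
    apply: (SZ_term _ n (FL_term s p (d M))); [move=> m; exact: rpow_nonneg | lia].
  split; [move=> n; exact: FL_sup_bound Hs (Hsup n) | exact: HCe].
have [S1 L1] := Hd N HN. have [S2 L2] := Hd N0 (le_n N0).
have Ec n : coef 0 (uN N t) n = ((d N n + - d N0 n) + coef 0 (uN N0 t) n)%C.
  rewrite /d !fourier_coef_minus !fourier_coef_fun. ring.
have Tri n : Cmod (coef 0 (uN N t) n) <= Cmod (d N n) + Cmod (d N0 n) + Cmod (coef 0 (uN N0 t) n).
  rewrite Ec. apply: Rle_trans (Cmod_triangle _ _) _. apply: Rplus_le_compat_r.
  apply: Rle_trans (Cmod_triangle _ _) _. rewrite Cmod_opp. lra.
have Bn n := HB t n ltac:(lra).
split.
  move=> n. have W : wt (- (4)) n <= wt (- (1/2)) n by apply: wt_le_exp; lra.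
  have W0 := wt_pos (- (1/2)) n. have := Rmult_le_compat_l _ _ _ B0 W.
  have : 0 <= (3 * (2 * Ce) + 3 * (B * B * C2)) * wt (- (1/2)) n by apply: Rmult_le_pos; lra.
  have := Tri n. have := S1 n. have := S2 n. have := Bn n. lra.
move=> K.
apply: Rle_trans (SZ_le _ _ (fun n => 3 * (wt (1/2 + 2 * g) n * modulus (d N) n ^ 2 + wt (1/2 + 2 * g) n * modulus (d N0) n ^ 2) + 3 * (B * B) * wt (- (2)) n) _) _; last first.
  rewrite SZ_plus !SZ_scal SZ_plus. have X1 := L1 K. have X2 := L2 K.
  have X3 := HC2 K (fun n => n) ltac:(exists 0%Z; left; move=> z; lia).
  have BB' : 0 <= 3 * (B * B) by nra. have X4 := Rmult_le_compat_l _ _ _ BB' X3.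
  apply: Rle_trans (Rplus_le_compat _ _ _ _ (Rmult_le_compat_l 3 _ _ ltac:(lra) (Rplus_le_compat _ _ _ _ X1 X2)) X4) _. lra.
move=> n. rewrite /modulus -/g.
set x := Cmod (d N n). set y := Cmod (d N0 n). set z := Cmod (coef 0 (uN N0 t) n).
have x0 : 0 <= x by exact: Cmod_ge_0. have y0 : 0 <= y by exact: Cmod_ge_0. have z0 : 0 <= z by exact: Cmod_ge_0.
have Q : Cmod (coef 0 (uN N t) n) ^ 2 <= 3 * (x ^ 2 + y ^ 2) + 3 * z ^ 2.
  have := pow_incr _ _ 2 (conj (Cmod_ge_0 _) (Tri n)). rewrite -/x -/y -/z.
  have := pow2_ge_0 (x - y). have := pow2_ge_0 (y - z). have := pow2_ge_0 (x - z). lra.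
have Zb : wt (1/2 + 2 * g) n * z ^ 2 <= B * B * wt (- (2)) n.
  have Z2 : z ^ 2 <= (B * wt (- (4)) n) ^ 2 by apply: pow_incr; exact: conj z0 (Bn n).
  apply: Rle_trans (Rmult_le_compat_l _ _ _ (wt_ge0 _ _) Z2) _.
  rewrite Rpow_mult_distr wt_sqr.
  rewrite (_ : wt (1/2 + 2 * g) n * (B ^ 2 * wt (2 * - (4)) n) = B * B * (wt (1/2 + 2 * g) n * wt (2 * - (4)) n)); last ring.
  apply: Rmult_le_compat_l; first nra. rewrite -wt_add. apply: wt_le_exp. rewrite /g. lra.
have := Rmult_le_compat_l _ _ _ (Rlt_le _ _ (wt_pos (1/2 + 2 * g) n)) Q. lra.
Qed.

(** The constant depends on the solution only through [R0]: the truncation frequency [K] at which [holder_bound] is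
    applied may be chosen after the solution. *)
Lemma rotated_coefficient_equicontinuous g R0 : 0 < g <= 1/64 -> 0 <= R0 -> exists Ch, 0 < Ch /\
  forall sigma v T, sigma = 1 \/ sigma = -1 -> smooth_global_solution sigma v -> T <= 1 ->
    (forall t, 0 <= t <= T -> (forall n, Cmod (coef 0 (v t) n) <= R0 * wt (- (1/2)) n) /\
        sobolev_bounded g R0 (modulus (coef 0 (v t)))) ->
    forall n t, 0 < t <= T ->
      Cmod (cis (- ((IZR n ^ 3 + sigma * momentum (v 0)) * t)) * coef 0 (v t) n - coef 0 (v 0) n)%C
        <= Ch * Rpower t (holder g).
Proof.
move=> Hg HR. have R3 : 0 <= 1 + R0 ^ 3 by have := pow_le R0 3 HR; lra.
have [Ch [Ch0 HCh]] := holder_bound g R0 (1 + R0 ^ 3) Hg HR R3.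
exists Ch. split=> // sigma v T Hsig Hv HT Hb n t Ht.
have [K0 HK0] := profile_ode sigma v R0 Hsig Hv HR.
pose K := (K0 + Z.to_nat (Z.abs n))%nat.
pose a := profile sigma (momentum (v 0)) K (fun m t => coef 0 (v t) m).
have Ha k s : Cmod (a k s) <= Cmod (coef 0 (v s) k).
  rewrite /a /profile Cmod_mult Cmod_cis Rmult_1_l /cutoff. case: Z_le_dec => _; first lra.
  rewrite Cmod_0. exact: Cmod_ge_0.
have c1 : Cmod (RtoC sigma * (Ci / 2))%C <= 1.
  rewrite Cmod_mult Cmod_div; last by move=> H; case: H; lra.
  rewrite !Cmod_R. rewrite Cmod_Ci.
  have -> : Rabs sigma = 1 by case: Hsig => ->; rewrite ?Rabs_R1 // Rabs_left; lra.
  rewrite (Rabs_pos_eq 2); lra.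
have Hc s : 0 <= s <= T -> (Z.abs n <= Z.of_nat K)%Z -> a n s = (cis (- ((IZR n ^ 3 + sigma * momentum (v 0)) * s)) * coef 0 (v s) n)%C.
  by move=> _ H; rewrite /a /profile cutoff_in.
have Hn : (Z.abs n <= Z.of_nat K)%Z by rewrite /K; lia.
have Hsup k s : 0 <= s <= T -> Cmod (a k s) <= R0 * wt (- (1/2)) k.
  move=> Hs. apply: Rle_trans (Ha k s) _. exact: (proj1 (Hb s Hs)).
have Hsob s : 0 <= s <= T -> sobolev_bounded g R0 (modulus (fun k => a k s)).
  move=> Hs. apply: sobolev_bounded_dom (proj2 (Hb s Hs)) => k. split; [exact: Cmod_ge_0 | exact: Ha].
have Hout k s : (Z.of_nat K < Z.abs k)%Z -> 0 <= s <= T -> a k s = RtoC 0.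
  move=> Hk _. rewrite /a /profile /cutoff. case: Z_le_dec => H; [lia | ring].
have Hode k s : (Z.abs k <= Z.of_nat K)%Z -> 0 <= s <= T -> exists d, cderiv (a k) s d /\
       Cmod (d - trilinear (interaction (RtoC sigma * (Ci / 2)) s k) K (fun j => a j s) (fun j => a j s) (fun j => a j s) k)%C
         <= (1 + R0 ^ 3) * wt (- (1/2)) k.
  move=> Hk Hs. apply: HK0 => //; [rewrite /K; lia | lra | exact: (proj1 (Hb s Hs))].
have := HCh (RtoC sigma * (Ci / 2))%C K T a c1 HT Hsup Hsob Hout Hode n 0 t ltac:(lra) ltac:(lra).
rewrite Rminus_0_r !Hc //; try lra. rewrite Rmult_0_r Ropp_0 cis_0 Cmult_1_l. by [].
Qed.

Lemma Rpower_small_time p eps : 0 < p -> 0 < eps -> exists d, 0 < d /\ forall t, 0 < t <= d -> Rpower t p <= eps.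
Proof.
move=> Hp He. exists (Rpower eps (/ p)). split; first exact: exp_pos. move=> t Ht.
apply: Rle_trans (Rle_Rpower_l _ _ p _ Ht) _; first lra.
rewrite Rpower_mult Rinv_l ?Rpower_1 //; lra.
Qed.

Lemma cis_near_one w t : 0 <= t -> Cmod (cis (w * t) - 1)%C <= 2 * Rabs w * t.
Proof.
move=> Ht. have := cderiv_bound (fun y => cis (w * y)) 0 t (Rabs w) Ht _.
rewrite Rmult_0_r cis_0 Rminus_0_r. apply. move=> s _. exists (Ci * RtoC w * cis (w * s))%C. split; first exact: cderiv_cis.
rewrite Cmod_mult Cmod_cis (Cmod_mult Ci) Cmod_R. rewrite Cmod_Ci. lra.
Qed.

Theorem theorem1p5 (sigma s p : R) (u0 : functional) (T : R)
    (uN : nat -> R -> R -> C) :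
  sigma = 1 \/ sigma = -1 ->
  admissible s p ->
  in_FL s p u0 ->
  infinite_momentum u0 ->
  0 < T ->
  (forall N, smooth_global_solution sigma (uN N) /\
             forall x, uN N 0 x = dirichlet N u0 x) ->
  ~ exists u : R -> functional,
      continuous_FL T s p u /\
      distributional_solution sigma T u /\
      dist_eq (u 0) u0 /\
      converges_FL T s p uN u.
Proof.
move=> Hsig Hadm _ Hinf HT Hsol [u [_ [_ [_ Hconv]]]]. have HPI := PI_RGT_0.
have [Hs [Hp [Hg HD]]] := admissible_gain s p Hadm.
have [n0 Hn0] := infinite_momentum_nonzero u0 Hinf.
set z0 := fourier_coef u0 n0 in Hn0.
have Hz0 : 0 < Cmod z0 by exact: (proj1 (Cmod_gt_0 z0) Hn0).
set T1 := Rmin T 1. have HT1 : 0 < T1 by apply: Rmin_glb_lt; lra.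
have HT1T : T1 <= T by exact: Rmin_l. have HT11 : T1 <= 1 by exact: Rmin_r.
have Hconv1 : converges_FL T1 s p uN u.
  move=> eps He. have [N0 HN0] := Hconv eps He. exists N0 => N HN t Ht. apply: HN0 => //. lra.
have [R0 [N0 [HR0 Hb]]] := converges_FL_bounded T1 s p uN u Hadm HT1 HT11
  (fun N => conj (proj1 (proj1 (Hsol N))) (proj1 (proj2 (proj1 (Hsol N))))) Hconv1.
have [Ch [Ch0 HCh]] := rotated_coefficient_equicontinuous (gain s p) R0 Hg HR0.
set e := Cmod z0 / 8. have He : 0 < e by rewrite /e; lra.
(* uniform convergence transfers the continuity of one solution uN M at time zero to all later ones *)
have [N1 HN1] := Hconv1 e He.
pose M := (N0 + N1 + Z.to_nat (Z.abs n0))%nat.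
have Hinit N : (M <= N)%nat -> coef 0 (uN N 0) n0 = z0.
  move=> HN. apply: (coef_dirichlet N); last exact: (proj2 (Hsol N)). rewrite /M in HN. lia.
have Hclose N t : (M <= N)%nat -> 0 <= t <= T1 -> Cmod (coef 0 (uN N t) n0 - fourier_coef (u t) n0)%C <= e.
  move=> HN Ht. rewrite -fourier_coef_fun -fourier_coef_minus. apply: (FL_coef_bound s p); try lra.
  apply: HN1; [rewrite /M in HN; lia | lra].
have [d1 [Hd1 Hcont]] : exists d, 0 < d /\ forall t, 0 <= t <= d -> Cmod (coef 0 (uN M t) n0 - coef 0 (uN M 0) n0)%C <= e.
  have [H1 H2] := ccontinuous_deriv _ _ _ (smooth2_coef_cderiv (uN M) n0 0 (proj1 (proj1 (Hsol M)))).
  move/continuity_pt_filterlim: H1 => H1. move/continuity_pt_filterlim: H2 => H2.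
  have [d1 [D1 C1]] := H1 (e / 2) ltac:(lra). have [d2 [D2 C2]] := H2 (e / 2) ltac:(lra).
  have m1 := Rmin_l d1 d2. have m2 := Rmin_r d1 d2.
  exists (Rmin d1 d2 / 2). split; first by have := Rmin_glb_lt _ _ _ D1 D2; lra.
  move=> t Ht. case: (Req_dec t 0) => [->|Ht0].
    rewrite (_ : forall z : C, (z - z)%C = RtoC 0) ?Cmod_0; [lra | move=> z; ring].
  have I : D_x no_cond 0 t by split=> //; exact: not_eq_sym.
  have L1 : R_dist t 0 < d1 by rewrite /R_dist Rminus_0_r Rabs_pos_eq; lra.
  have L2 : R_dist t 0 < d2 by rewrite /R_dist Rminus_0_r Rabs_pos_eq; lra.
  have F1 : Rabs (Re (coef 0 (uN M t) n0) - Re (coef 0 (uN M 0) n0)) < e / 2 by exact: (C1 t (conj I L1)).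
  have F2 : Rabs (Im (coef 0 (uN M t) n0) - Im (coef 0 (uN M 0) n0)) < e / 2 by exact: (C2 t (conj I L2)).
  apply: Rle_trans (Cmod_le_parts _) _.
  change (Rabs (Re (coef 0 (uN M t) n0) - Re (coef 0 (uN M 0) n0)) + Rabs (Im (coef 0 (uN M t) n0) - Im (coef 0 (uN M 0) n0)) <= e). lra.
have Hstay N t : (M <= N)%nat -> 0 <= t <= T1 -> t <= d1 -> Cmod (coef 0 (uN N t) n0 - z0)%C <= 5 * e.
  move=> HN Ht Htd.
  have A1 := Hclose N t HN Ht. have A2 := Hclose M t (le_n M) Ht.
  have A3 := Hcont t ltac:(lra). have A4 := Hclose M 0 (le_n M) ltac:(lra). have A5 := Hclose N 0 HN ltac:(lra).
  rewrite (Hinit M) // in A3 A4.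
  have -> : (coef 0 (uN N t) n0 - z0)%C = ((coef 0 (uN N t) n0 - fourier_coef (u t) n0)
     + (- (coef 0 (uN M t) n0 - fourier_coef (u t) n0) + (coef 0 (uN M t) n0 - z0)))%C by ring.
  apply: Rle_trans (Cmod_triangle _ _) _. apply: Rle_trans (Rplus_le_compat_l _ _ _ (Cmod_triangle _ _)) _.
  rewrite Cmod_opp. lra.
have Hal : 0 < holder (gain s p) by rewrite /holder; lra.
have [d2 [Hd2 Hsmall]] := Rpower_small_time (holder (gain s p)) (e / Ch) Hal ltac:(exact: Rdiv_lt_0_compat).
set k := 1 + Rabs (IZR n0 ^ 3). have Hk : 0 < k by rewrite /k; have := Rabs_pos (IZR n0 ^ 3); lra.
set d := Rmin (Rmin T1 d1) (Rmin d2 (/ (16 * k))).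
have Hd0 : 0 < d.
  apply: Rmin_glb_lt; apply: Rmin_glb_lt => //. apply: Rinv_0_lt_compat. lra.
have dT : d <= T1 by apply: Rle_trans (Rmin_l _ _) (Rmin_l _ _).
have dd1 : d <= d1 by apply: Rle_trans (Rmin_l _ _) (Rmin_r _ _).
have dd2 : d <= d2 by apply: Rle_trans (Rmin_r _ _) (Rmin_l _ _).
have dk : d <= / (16 * k) by apply: Rle_trans (Rmin_r _ _) (Rmin_r _ _).
(* the time t below is PI / |P|, at which the gauge factor equals -1; large N makes it smaller than d *)
have [N2 HN2] := proj2 (is_lim_seq_spec _ _) Hinf (PI / d).
pose N := (M + N2)%nat. have HMN : (M <= N)%nat by rewrite /N; lia.
set P := momentum (uN N 0).
have HP : PI / d < Rabs P.
  rewrite /P (momentum_ext _ _ (proj2 (Hsol N))). apply: HN2. rewrite /N. lia.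
have HP0 : 0 < Rabs P by apply: Rlt_trans HP; apply: Rdiv_lt_0_compat.
set t := PI / Rabs P. have Ht0 : 0 < t by apply: Rdiv_lt_0_compat.
have Htd : t <= d.
  rewrite /t. apply: (Rmult_le_reg_r (Rabs P)) => //. rewrite /Rdiv Rmult_assoc Rinv_l; last lra.
  have := Rmult_lt_compat_r d _ _ Hd0 HP. rewrite /Rdiv Rmult_assoc Rinv_l; lra.
have Hrot := HCh sigma (uN N) T1 Hsig (proj1 (Hsol N)) HT11 (fun t Ht => Hb N t ltac:(rewrite /N /M; lia) Ht) n0 t ltac:(lra).
rewrite Hinit // -/P in Hrot.
have Hsm := Hsmall t ltac:(lra).
have {}Hrot : Cmod (cis (- ((IZR n0 ^ 3 + sigma * P) * t)) * coef 0 (uN N t) n0 - z0)%C <= e.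
  apply: Rle_trans Hrot _. have := Rmult_le_compat_l _ _ _ (Rlt_le _ _ Ch0) Hsm.
  rewrite (_ : Ch * (e / Ch) = e); [by [] | field; lra].
have Hm1 : cis (- (sigma * P * t)) = RtoC (-1).
  have C1 : cis PI = RtoC (-1) by rewrite /cis cos_PI sin_PI.
  have C2 : cis (- PI) = RtoC (-1) by rewrite cis_neg C1 /Cconj /RtoC /=; f_equal; ring.
  have E : P * t = PI \/ P * t = - PI.
    rewrite /t. case: (Rle_dec 0 P) => H.
      left. rewrite (Rabs_pos_eq P) // in HP0 *. field. lra.
    right. rewrite (Rabs_left P) in HP0 *; try lra. field. lra.
  rewrite Rmult_assoc. case: Hsig => ->; case: E => ->.
  - by rewrite Rmult_1_l.
  - by rewrite Rmult_1_l Ropp_involutive.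
  - by rewrite (_ : - (-1 * PI) = PI) //; ring.
  - by rewrite (_ : - (-1 * - PI) = - PI) //; ring.
set c := coef 0 (uN N t) n0 in Hrot *.
set w := cis (- (IZR n0 ^ 3) * t).
have Ew : cis (- ((IZR n0 ^ 3 + sigma * P) * t)) = (- w)%C.
  rewrite (_ : - ((IZR n0 ^ 3 + sigma * P) * t) = - (IZR n0 ^ 3) * t + - (sigma * P * t)); last ring.
  have E : RtoC (-1) = (- RtoC 1)%C by rewrite /RtoC /Copp /=; f_equal; ring.
  rewrite cis_add Hm1 -/w E. ring.
rewrite Ew in Hrot.
have Hw : Cmod (w - 1)%C <= 1/8.
  apply: Rle_trans (cis_near_one (- (IZR n0 ^ 3)) t ltac:(lra)) _. rewrite Rabs_Ropp.
  have t16 : t <= / (16 * k) by lra.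
  have ik : k * / (16 * k) = / 16 by field; lra.
  have := Rmult_le_compat (Rabs (IZR n0 ^ 3)) k t (/ (16 * k)) (Rabs_pos _) ltac:(lra) ltac:(rewrite /k; lra) t16.
  rewrite ik. lra.
have Hc5 : Cmod (c - z0)%C <= 5 * e by apply: Hstay => //; lra.
have Hc : Cmod c <= Cmod z0 + 5 * e.
  have -> : c = (z0 + (c - z0))%C by ring. apply: Rle_trans (Cmod_triangle _ _) _. lra.
have : 2 * Cmod z0 <= e + (1/8 * (Cmod z0 + 5 * e) + 5 * e); last by rewrite /e; lra.
have -> : 2 * Cmod z0 = Cmod (- (- w * c - z0) + (- ((w - 1) * c) + - (c - z0)))%C.
  rewrite (_ : (- (- w * c - z0) + (- ((w - 1) * c) + - (c - z0)))%C = (RtoC 2 * z0)%C); last ring.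
  rewrite Cmod_mult Cmod_R Rabs_pos_eq; lra.
apply: Rle_trans (Cmod_triangle _ _) _. rewrite Cmod_opp. apply: Rplus_le_compat => //.
apply: Rle_trans (Cmod_triangle _ _) _. rewrite !Cmod_opp. apply: Rplus_le_compat => //.
rewrite Cmod_mult. apply: Rmult_le_compat => //; exact: Cmod_ge_0.
Qed.
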